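(* Let $(F,\Omega_F)$, $F=\{f_j\}_{j\in\tilde\Lambda}$, be a finite holomorphic IFS satisfying the strong separation condition, with attractor $A=A_F$. For $\mathbf{v},\tilde{\mathbf{v}}\in\tilde\Lambda^*$ let $$R_{\mathbf{v},\tilde{\mathbf{v}}}:=f_{\mathbf{v}}\circ f_{\tilde{\mathbf{v}}}\circ f_{\mathbf{v}}^{-1},$$ which maps the domain $f_{\mathbf{v}}(\Omega_F)$ into itself and has a unique fixed point there. Then: (i) For each $l\in\mathbb{N}$ and each $R_{\mathbf{v},\tilde{\mathbf{v}}}$, there exist precisely $l$ different local (i.e., defined and holomorphic in a neighborhood of the fixed point of $R_{\mathbf{v},\tilde{\mathbf{v}}}$) solutions $g^{(r)}_{\mathbf{v},\tilde{\mathbf{v}},l}$, $r=1,\dots,l$, of the equation $g^l=R_{\mathbf{v},\tilde{\mathbf{v}}}$, where $g^l$ is the $l$-th iterate of $g$. (ii) If $(G,\Omega_G)$ is any other holomorphic IFS satisfying the strong separation condition with the same attractor $A$, then there exists $K\in\mathbb{N}$ such that each $g_i\in G$ is a holomorphic continuation of one of the local functions $$\{g^{(r)}_{\mathbf{v},\tilde{\mathbf{v}},l}:\ \mathbf{v},\tilde{\mathbf{v}}\in\tilde\Lambda^*,\ l=1,\dots,K,\ r=1,\dots,l\}.$$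
   Context: A holomorphic IFS is a pair $(G,\Omega)$ where $\Omega$ is a bounded domain in $\mathbb{C}$ and $G=\{g_i:\Omega\to\Omega\}_{i\in\Lambda}$ is a finite collection of univalent (holomorphic injective) maps with $\overline{g_i(\Omega)}\subset\Omega$ for all $i$. (Each $g_i$ is then a strict contraction of $\Omega$ in its hyperbolic metric.) Its attractor $A_G$ is the unique non-empty compact set $A\subset\Omega$ with $A=\bigcup_{i\in\Lambda}g_i(A)$; it is always assumed that $\#A_G\ge2$. The strong separation condition (SSC) means $g_i(A_G)\cap g_j(A_G)=\emptyset$ for all $i\neq j$. $\tilde\Lambda^*$ is the set of all finite words $\mathbf{v}=(j_1,\dots,j_k)$, $k\ge1$, with letters in $\tilde\Lambda$; $f_{\mathbf{v}}=f_{j_1}\circ\dots\circ f_{j_k}:\Omega_F\to\Omega_F$, and $f_{\mathbf{v}}^{-1}:f_{\mathbf{v}}(\Omega_F)\to\Omega_F$ is its inverse. *)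

(* Defs.v *)
From HB Require Import structures.
From mathcomp Require Import all_boot all_order all_algebra.
From mathcomp Require Import complex.
From mathcomp Require Import all_classical all_reals all_analysis.

Set Implicit Arguments.
Unset Strict Implicit.
Unset Printing Implicit Defensive.

Import Order.TTheory GRing.Theory Num.Theory.
Import numFieldNormedType.Exports.

Local Open Scope classical_set_scope.
Local Open Scope complex_scope.
Local Open Scope ring_scope.

(* The complex plane, declared at type numFieldType so that the library's
   topology, norm and derivative on a numFieldType apply to it (R[i] itself has
   no declared topology). Derivability in the direction 1 over this field is
   complex differentiability. *)
Definition Cx (R : realType) : numFieldType := R[i].

(* Below, maps on subsets of the plane are total functions Cx R -> Cx R; their
   values outside the set at hand are never used. *)

Definition bounded_domain (R : realType) (U : set (Cx R)) : Prop :=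
  [/\ U !=set0, open U, connected U & bounded_set U].

Definition holomorphic_on (R : realType) (U : set (Cx R)) (g : Cx R -> Cx R) :
    Prop :=
  forall z, U z -> derivable g z 1.

(* The last condition implies that g i maps Om into itself. *)
Definition holomorphic_IFS (R : realType) (I : finType) (Om : set (Cx R))
    (g : I -> Cx R -> Cx R) : Prop :=
  bounded_domain Om /\
  forall i, [/\ holomorphic_on Om (g i),
                {in Om &, injective (g i)} &
                closure (g i @` Om) `<=` Om].

(* The set A with these properties is unique, by contraction in the
   hyperbolic metric; uniqueness is therefore not part of the definition. *)
Definition is_attractor (R : realType) (I : finType) (Om : set (Cx R))
    (g : I -> Cx R -> Cx R) (A : set (Cx R)) : Prop :=
  [/\ A !=set0, compact A, A `<=` Om & A = \bigcup_i (g i @` A)].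

Definition strong_separation (R : realType) (I : finType)
    (g : I -> Cx R -> Cx R) (A : set (Cx R)) : Prop :=
  forall i j : I, i != j -> (g i @` A) `&` (g j @` A) = set0.

Definition word_map (R : realType) (J : finType) (f : J -> Cx R -> Cx R)
    (v : seq J) : Cx R -> Cx R :=
  foldr (fun j h => f j \o h) id v.

Definition conj_map (R : realType) (J : finType) (Om : set (Cx R))
    (f : J -> Cx R -> Cx R) (v w : seq J) : Cx R -> Cx R :=
  word_map f v \o word_map f w \o 'pinv_(fun=> 0) Om (word_map f v).

(* The domain of the l-th iterate (l >= 1) of g, for g defined on U. *)
Definition iter_dom (R : realType) (U : set (Cx R)) (g : Cx R -> Cx R)
    (l : nat) : set (Cx R) :=
  [set z | forall k, (k < l)%N -> U (iter k g z)].

(* g, defined and holomorphic on some open neighborhood U of p, solves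
   g^l = S, where S is defined on D: its l-th iterate (as a partial map on U)
   is defined at p, and wherever it is defined it agrees with S. When p is the
   only fixed point of S in D, this forces g p = p. *)
Definition local_root (R : realType) (D : set (Cx R)) (S : Cx R -> Cx R)
    (p : Cx R) (l : nat) (g : Cx R -> Cx R) : Prop :=
  exists U : set (Cx R),
    [/\ open U, U p, holomorphic_on U g, iter_dom U g l p &
        forall z, iter_dom U g l z -> D z /\ iter l g z = S z].

Definition same_germ (R : realType) (p : Cx R) (g h : Cx R -> Cx R) : Prop :=
  \forall z \near p, g z = h z.

(* Main.v *)
(**
  Goursat's lemma on squares gives a Cauchy inequality that tolerates finitely
  many exceptional points. Hence divided differences of a holomorphic function
  are holomorphic and bounded, and this replaces Cauchy's integral formula:
  removable singularities, limits of holomorphic functions, local inverses, the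
  identity theorem and the non-vanishing of the derivative of an injective map
  all follow from it.

  (i) Word maps contract by the Earle-Hamilton argument, so R = f_v f_w f_v^-1
  has an attracting fixed point. In Koenigs' linearising coordinate R is
  multiplication by its multiplier lam with 0 < |lam| < 1. A local solution of
  g^l = R commutes with R, and germs commuting with multiplication by lam are
  linear, so the solutions correspond to the l roots of mu^l = lam.

  (ii) Fix a map g of the second system, let v_n be the longest word such that
  g^n(A) lies in f_{v_n}(A), and put h_n = f_{v_n}^-1 g^n : A -> A. By bounded
  distortion and separation the h_n and their difference quotients are bounded
  and equicontinuous, and each h_n(A) contains all points of A within a uniform
  distance. By the pigeonhole principle h_m and h_n are close for some m < n;
  then h_n^-1 h_m is a self-map of A close to the identity, and such a map is
  the identity. Thus v_n = v_m w and g^(n-m) = f_{v_n} f_w f_{v_n}^-1 on g^n(A),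
  which accumulates at the fixed point of g; there the two sides agree by the
  identity theorem.
*)
Require Import Defs.
From HB Require Import structures.
From mathcomp Require Import all_boot all_order all_algebra.
From mathcomp Require Import all_field.
From mathcomp Require Import complex.
From mathcomp Require Import all_classical all_reals all_analysis.
From mathcomp Require Import ring lra.

Set Implicit Arguments.
Unset Strict Implicit.
Unset Printing Implicit Defensive.

Import Order.TTheory GRing.Theory Num.Theory.
Import numFieldNormedType.Exports.

Local Open Scope classical_set_scope.
Local Open Scope complex_scope.
Local Open Scope ring_scope.

Local Notation Re := complex.Re.
Local Notation Im := complex.Im.

(** * Complex differentiability *)

(** In (ii) the maps f_v^-1 g^n are controlled only on A: the image under g^n of a neighbourhood of
    A need not lie in f_v(Omega_F), so no normal-family argument is directly available. The
    comparison therefore works with pairs of points of A, and with divided differences in place of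
    derivatives. Taking v_n as long as possible keeps the rescaled maps from degenerating: h_n(A)
    then meets two different first-level pieces of A, so it contains two points a fixed gap apart,
    and bounded distortion turns this into a lower bound for all difference quotients of h_n. The
    quotients enter the pigeonhole argument together with the maps because h_n^-1 h_m must be close
    to the identity in the Lipschitz sense: uniform closeness says nothing about pieces of A smaller
    than the error, whereas a relative error has the same meaning at every scale. In the
    complex-analytic part the constant in the Cauchy inequality is disposable, since the inequality
    is applied to n-th powers; hence crude bounds on contour integrals suffice, and the value 2 pi i
    is never computed. *)

Section Modulus.
Variable R : realType.
Implicit Types (x y z w : R[i]) (a b : R).

(** A real-valued modulus: the norm of [R[i]] takes values in [R[i]], which is only partially
    ordered, whereas the estimates below need a linear order. *)
Definition abs z : R := Normc.normc z.
Arguments abs : simpl never.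

Lemma normE z : `|z| = (abs z)%:C :> R[i]. Proof. by []. Qed.
Lemma abs_ge0 z : 0 <= abs z. Proof. by case: z => a b; apply: sqrtr_ge0. Qed.
Lemma abs0 : abs 0 = 0. Proof. exact: Normc.normc0. Qed.
Lemma abs1 : abs 1 = 1. Proof. exact: Normc.normc1. Qed.
Lemma abs0P z : abs z = 0 -> z = 0. Proof. exact: Normc.eq0_normc. Qed.
Lemma abs_eq0 z : (abs z == 0) = (z == 0).
Proof. by apply/eqP/eqP => [/abs0P//|->]; exact: abs0. Qed.
Lemma abs_gt0 z : (0 < abs z) = (z != 0).
Proof. by rewrite lt_def abs_ge0 abs_eq0 andbT. Qed.
Lemma absM x y : abs (x * y) = abs x * abs y. Proof. exact: Normc.normcM. Qed.
Lemma absV x : abs x^-1 = (abs x)^-1. Proof. exact: Normc.normcV. Qed.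
Lemma abs_div x y : abs (x / y) = abs x / abs y. Proof. by rewrite absM absV. Qed.
Lemma absX x n : abs (x ^+ n) = abs x ^+ n.
Proof. by elim: n => [|n IH]; rewrite ?expr0 ?abs1 // !exprS absM IH. Qed.
Lemma absN x : abs (- x) = abs x. Proof. exact: normcN. Qed.
Lemma absC x y : abs (x - y) = abs (y - x). Proof. by rewrite -absN opprB. Qed.
Lemma abs_addle x y : abs (x + y) <= abs x + abs y. Proof. exact: le_normcD. Qed.
Lemma abs_suble x y : abs (x - y) <= abs x + abs y.
Proof. by rewrite -[abs y]absN; apply: abs_addle. Qed.
Lemma abs_dist y x z : abs (x - z) <= abs (x - y) + abs (y - z).
Proof. by rewrite -[x - z](subrKA y); apply: abs_addle. Qed.
Lemma abs_lesub x y : abs x - abs y <= abs (x - y).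
Proof. by rewrite lerBlDr -{1}(subrK y x); apply: abs_addle. Qed.
Lemma abs_real a : abs a%:C = `|a|.
Proof. by rewrite /abs /= expr0n /= addr0 sqrtr_sqr. Qed.
Lemma abs_Re z : `|Re z| <= abs z.
Proof.
case: z => a b /=; rewrite -sqrtr_sqr /abs /=.
by apply: ler_wsqrtr; rewrite lerDl sqr_ge0.
Qed.
Lemma abs_Im z : `|Im z| <= abs z.
Proof.
case: z => a b /=; rewrite -sqrtr_sqr /abs /=.
by apply: ler_wsqrtr; rewrite lerDr sqr_ge0.
Qed.
Lemma abs_leReIm z : abs z <= `|Re z| + `|Im z|.
Proof.
case: z => a b /=.
rewrite [X in abs X](_ : _ = a%:C + 'i%C * b%:C); last first.
  by apply/eqP; rewrite eq_complex /=; apply/andP; split; apply/eqP; ring.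
apply: (le_trans (abs_addle _ _)); rewrite absM !abs_real.
by rewrite /abs /= expr0n /= add0r expr1n sqrtr1 mul1r.
Qed.
Lemma abs_prod (I : Type) (s : seq I) (F : I -> R[i]) :
  abs (\prod_(i <- s) F i) = \prod_(i <- s) abs (F i).
Proof. by apply: (big_morph abs absM abs1). Qed.
Lemma abs_nat n : abs n%:R = n%:R.
Proof. by rewrite -(rmorph_nat (real_complex R)) abs_real ger0_norm. Qed.
End Modulus.
Arguments abs : simpl never.

Section Bridge.
Variable R : realType.
Local Notation C := (R[i]).
Implicit Types (z w : C).

Lemma Cx_nbhsP (z : Cx R) (U : set (Cx R)) :
  nbhs z U <-> exists2 r : R, 0 < r & forall w : C, abs (w - z) < r -> U w.
Proof.
split.
  move/nbhs_ballP => [e /= e0 He]; exists (Re e).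
    by move: e0; rewrite ltcE /= => /andP[].
  move=> w wz; apply: He; rewrite /ball /=.
  have := e0; rewrite ltcE /= => /andP[/eqP ei _].
  have -> : e = (Re e)%:C by case: (e) ei => a b /= ->.
  by rewrite distrC [X in X < _]normE ltcR.
move=> [r r0 Hr]; apply/nbhs_ballP; exists r%:C => /=; first by rewrite ltcR.
move=> w; rewrite /ball /= distrC [X in X < _]normE ltcR; exact: Hr.
Qed.

Lemma Cx_openP (U : set (Cx R)) :
  open U <-> forall z : C, U z -> exists2 r : R, 0 < r & forall w : C, abs (w - z) < r -> U w.
Proof.
rewrite openE; split=> H z Uz; first by have /Cx_nbhsP := H z Uz.
by apply/Cx_nbhsP/H.
Qed.

(** A one-constructor inductive, so that it stays an opaque predicate: unification does not see
    through its quantifiers, and the modulus of continuity is reached by case analysis. *)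
Variant ccont (f : C -> C) (z : C) : Prop :=
  CCont of forall e : R, 0 < e ->
    exists2 r : R, 0 < r & forall w, abs (w - z) < r -> abs (f w - f z) < e.

Lemma ccontP f z : ccont f z <->
  forall e : R, 0 < e -> exists2 r : R, 0 < r & forall w, abs (w - z) < r -> abs (f w - f z) < e.
Proof. by split => [[]|]. Qed.

End Bridge.

Section CCont.
Variable R : realType.
Local Notation C := (R[i]).
Implicit Types (z w : C) (f g q : C -> C).

Lemma ccont_eq f g z : ccont f z ->
  (exists2 r : R, 0 < r & forall w, abs (w - z) < r -> f w = g w) -> ccont g z.
Proof.
move=> /ccontP cf [r r0 fg]; apply/ccontP => e e0.
have [s s0 Hs] := cf _ e0; exists (Num.min r s); first by rewrite lt_min r0.
move=> w; rewrite lt_min => /andP[wr ws].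
by rewrite -!fg ?subrr ?abs0 //; apply: Hs.
Qed.
Lemma ccont_cst c z : ccont (fun=> c) z.
Proof. by apply/ccontP => e e0; exists 1 => // w _; rewrite subrr abs0. Qed.
Lemma ccont_id z : ccont id z.
Proof. by apply/ccontP => e e0; exists e. Qed.
Lemma ccontD f g z : ccont f z -> ccont g z -> ccont (fun w => f w + g w) z.
Proof.
move=> [cf] [cg]; apply/ccontP => e e0; have e2 : 0 < e / 2 by lra.
have [r r0 Hr] := cf _ e2; have [s s0 Hs] := cg _ e2.
exists (Num.min r s); first by rewrite lt_min r0.
move=> w; rewrite lt_min => /andP[/Hr h1 /Hs h2].
have -> : f w + g w - (f z + g z) = (f w - f z) + (g w - g z) by ring.
by apply: (le_lt_trans (abs_addle _ _)); lra.
Qed.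
Lemma ccontM f g z : ccont f z -> ccont g z -> ccont (fun w => f w * g w) z.
Proof.
move=> [cf] [cg]; apply/ccontP => e e0.
have := abs_ge0 (f z); have := abs_ge0 (g z) => gz0 fz0.
have a0 : 0 < abs (g z) + 1 by lra.
have b0 : 0 < abs (f z) + 1 by lra.
have e1 : 0 < e / 2 / (abs (g z) + 1) by rewrite !divr_gt0.
have e2 : 0 < Num.min 1 (e / 2 / (abs (f z) + 1)) by rewrite lt_min ltr01 !divr_gt0.
have [r r0 Hr] := cf _ e1; have [s s0 Hs] := cg _ e2.
exists (Num.min r s); first by rewrite lt_min r0.
move=> w; rewrite lt_min => /andP[/Hr h1 /Hs]; rewrite lt_min => /andP[h2 h3].
have -> : f w * g w - f z * g z = (f w - f z) * g w + f z * (g w - g z) by ring.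
apply: (le_lt_trans (abs_addle _ _)); rewrite !absM.
have gw : abs (g w) <= abs (g z) + 1.
  by have := abs_lesub (g w) (g z); lra.
move: h1 h3; rewrite !ltr_pdivlMr // => h1 h3.
have k1 : abs (f w - f z) * abs (g w) <= abs (f w - f z) * (abs (g z) + 1).
  by apply: ler_wpM2l => //; exact: abs_ge0.
have k2 : abs (f z) * abs (g w - g z) <= abs (g w - g z) * (abs (f z) + 1).
  by rewrite mulrC; apply: ler_wpM2l; [exact: abs_ge0|lra].
by lra.
Qed.
Lemma ccontN f z : ccont f z -> ccont (fun w => - f w) z.
Proof.
move=> [cf]; apply/ccontP => e /cf[r r0 Hr]; exists r => // w /Hr.
by rewrite -opprD absN.
Qed.
Lemma ccontB f g z : ccont f z -> ccont g z -> ccont (fun w => f w - g w) z.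
Proof. by move=> cf cg; apply: ccontD => //; apply: ccontN. Qed.
Lemma ccontV f z : f z != 0 -> ccont f z -> ccont (fun w => (f w)^-1) z.
Proof.
rewrite -abs_gt0 => fz [cf]; apply/ccontP => e e0.
have e1 : 0 < Num.min (abs (f z) / 2) (e * (abs (f z) ^+ 2 / 2)).
  by rewrite lt_min divr_gt0 //= mulr_gt0 // divr_gt0 // exprn_gt0.
have [r r0 Hr] := cf _ e1; exists r => // w /Hr; rewrite lt_min => /andP[h1 h2].
have fw : abs (f z) / 2 < abs (f w).
  by have := abs_lesub (f z) (f w); rewrite absC; lra.
have fw0 : 0 < abs (f w) by lra.
have -> : (f w)^-1 - (f z)^-1 = (f z - f w) / (f z * f w).
  by field; rewrite -!abs_gt0 fz fw0.
rewrite abs_div absM absC ltr_pdivrMr ?mulr_gt0 //; apply: (lt_le_trans h2).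
by rewrite ler_pM2l // expr2 -mulrA ler_pM2l // ltW.
Qed.
Lemma ccont_comp f g z : ccont g z -> ccont f (g z) -> ccont (fun w => f (g w)) z.
Proof.
move=> [cg] [cf]; apply/ccontP => e /cf[r /cg[s s0 Hs] Hr].
by exists s => // w /Hs/Hr.
Qed.
Lemma ccontX f n z : ccont f z -> ccont (fun w => f w ^+ n) z.
Proof.
move=> cf; elim: n => [|n IH].
  by apply: (ccont_eq (ccont_cst 1 z)); exists 1 => // w _; rewrite expr0.
by apply: (ccont_eq (ccontM cf IH)); exists 1 => // w _; rewrite exprS.
Qed.

(* Caratheodory's form of the derivative, in which the chain and product rules are
   algebraic identities between the slope functions [q]. *)
Definition cderiv f z d : Prop :=
  exists q, [/\ ccont q z, q z = d & forall w, f w = f z + q w * (w - z)].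
Definition cdiff f z : Prop := exists d, cderiv f z d.

Lemma cderiv_diff f z d : cderiv f z d -> cdiff f z. Proof. by exists d. Qed.

Lemma cderiv_cont f z d : cderiv f z d -> ccont f z.
Proof.
move=> [q [cq _ fE]].
have c : ccont (fun w => f z + q w * (w - z)) z.
  apply: ccontD; first exact: ccont_cst.
  by apply: ccontM => //; apply: ccontB; [exact: ccont_id|exact: ccont_cst].
by apply: (ccont_eq c); exists 1 => // w _; rewrite -fE.
Qed.
Lemma cdiff_cont f z : cdiff f z -> ccont f z.
Proof. by move=> [d]; apply: cderiv_cont. Qed.

(** The slope identity in [cderiv] is required for every [w], also far from [z], so a slope for [g]
    is rebuilt from its own quotients; only near [z] do these coincide with the slope of [f]. *)
Lemma cderiv_eq f g z d : cderiv f z d ->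
  (exists2 r : R, 0 < r & forall w, abs (w - z) < r -> f w = g w) -> cderiv g z d.
Proof.
move=> [q [cq qz fE]] [r r0 fg].
have fgz : f z = g z by apply: fg; rewrite subrr abs0.
exists (fun w => if w == z then q z else (g w - g z) / (w - z)); split.
- apply: (ccont_eq cq); exists r => // w wr; case: eqP => [->//|/eqP wz].
  by rewrite -fg// -fgz fE addrC addKr mulfK// subr_eq0.
- by rewrite eqxx.
- move=> w; case: eqP => [->|/eqP wz]; first by rewrite subrr mulr0 addr0.
  by rewrite divfK ?subr_eq0// addrC subrK.
Qed.
Lemma cdiff_eq f g z : cdiff f z ->
  (exists2 r : R, 0 < r & forall w, abs (w - z) < r -> f w = g w) -> cdiff g z.
Proof. by move=> [d fd] fg; exists d; apply: cderiv_eq fg. Qed.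

Lemma cderiv_uniq f z d d' : cderiv f z d -> cderiv f z d' -> d = d'.
Proof.
move=> [q [/ccontP cq <- fE]] [q' [/ccontP cq' <- fE']].
apply/eqP; case: (eqVneq (q z) (q' z)) => // ne.
have e0 : 0 < abs (q z - q' z) / 2 by rewrite divr_gt0 // abs_gt0 subr_eq0.
have [r r0 Hr] := cq _ e0; have [r' r'0 Hr'] := cq' _ e0.
have m0 : 0 < Num.min r r' / 2 by rewrite divr_gt0 // lt_min r0.
pose w := z + (Num.min r r' / 2)%:C.
have aw : abs (w - z) = Num.min r r' / 2 by rewrite /w addrC addKr abs_real gtr0_norm.
have wz : w - z != 0 by rewrite -abs_gt0 aw.
have ltm : abs (w - z) < Num.min r r' by rewrite aw; lra.
have /(mulIf wz) qq : q w * (w - z) = q' w * (w - z).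
  by apply: (addrI (f z)); rewrite -fE -fE'.
move: ltm; rewrite lt_min => /andP[/Hr h1 /Hr' h2].
have := abs_dist (q w) (q z) (q' z).
by rewrite [abs (q z - q w)]absC {2}qq; lra.
Qed.

Lemma cderiv_cst c z : cderiv (fun=> c) z 0.
Proof.
by exists (fun=> 0); split => [||w]; [exact: ccont_cst| |rewrite mul0r addr0].
Qed.
Lemma cderiv_id z : cderiv id z 1.
Proof.
by exists (fun=> 1); split => [||w]; [exact: ccont_cst| |rewrite mul1r addrC subrK].
Qed.
Lemma cderivD f g z a b : cderiv f z a -> cderiv g z b -> cderiv (fun w => f w + g w) z (a + b).
Proof.
move=> [q [cq <- fE]] [p [cp <- gE]]; exists (fun w => q w + p w); split => //.
  exact: ccontD.
by move=> w; rewrite fE (gE w); ring.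
Qed.
Lemma cderivM f g z a b : cderiv f z a -> cderiv g z b ->
  cderiv (fun w => f w * g w) z (a * g z + f z * b).
Proof.
move=> df dg; have cg := cderiv_cont dg.
case: df dg => [q [cq <- fE]] [p [cp <- gE]].
exists (fun w => q w * g w + f z * p w); split => //.
  by apply: ccontD; apply: ccontM => //; exact: ccont_cst.
by move=> w; rewrite fE (gE w); ring.
Qed.
Lemma cderivZ c f z a : cderiv f z a -> cderiv (fun w => c * f w) z (c * a).
Proof. by move=> df; have := cderivM (cderiv_cst c z) df; rewrite mul0r add0r. Qed.
Lemma cderivN f z a : cderiv f z a -> cderiv (fun w => - f w) z (- a).
Proof.
move=> /(cderivZ (-1)); rewrite mulN1r => H; apply: (cderiv_eq H).
by exists 1 => // w _; rewrite mulN1r.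
Qed.
Lemma cderivB f g z a b : cderiv f z a -> cderiv g z b -> cderiv (fun w => f w - g w) z (a - b).
Proof. by move=> df dg; apply: cderivD => //; apply: cderivN. Qed.
Lemma cderivV f z a : f z != 0 -> cderiv f z a -> cderiv (fun w => (f w)^-1) z (- a / f z ^+ 2).
Proof.
move=> fz df; have cf := cderiv_cont df.
have [r r0 fr] : exists2 r : R, 0 < r & forall w, abs (w - z) < r -> f w != 0.
  have /ccontP/(_ (abs (f z))) := cf; rewrite abs_gt0 => /(_ fz)[r r0 Hr].
  by exists r => // w /Hr; apply: contraTneq => ->; rewrite sub0r absN ltxx.
case: df => [q [cq <- fE]].
(* The slope identity is global and [0^-1 = 0], so at the zeros of [f] the reciprocal is first
   replaced by a value that makes the identity true; these zeros stay away from [z]. *)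
suff : cderiv (fun w => if f w == 0 then (f z)^-1 - q w / f z ^+ 2 * (w - z) else (f w)^-1)
         z (- q z / f z ^+ 2).
  by move=> H; apply: (cderiv_eq H); exists r => // w /fr/negPf ->.
have H : ccont (fun w => - q w / (f z * f w)) z.
  apply: ccontM; first exact: ccontN.
  apply: ccontV; first by rewrite mulf_neq0.
  by apply: ccontM => //; exact: ccont_cst.
exists (fun w => if f w == 0 then - q w / f z ^+ 2 else - q w / (f z * f w)); split.
- by apply: (ccont_eq H); exists r => // w /fr/negPf ->.
- by rewrite (negPf fz) expr2.
- move=> w; rewrite (negPf fz); case: eqP => [_|/eqP fw].
    by rewrite mulNr mulNr.
  have qe : q w * (w - z) = f w - f z by rewrite [f w]fE; ring.
  have -> : - q w / (f z * f w) * (w - z) = - (q w * (w - z)) / (f z * f w) by ring.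
  by rewrite qe; field; rewrite fw fz.
Qed.
Lemma cderiv_comp f g z a b : cderiv g z b -> cderiv f (g z) a ->
  cderiv (fun w => f (g w)) z (a * b).
Proof.
move=> dg; have cg := cderiv_cont dg.
case: dg => [p [cp <- gE]] [q [cq <- fE]].
exists (fun w => q (g w) * p w); split => //.
  by apply: ccontM => //; exact: ccont_comp.
by move=> w; rewrite fE -mulrA; congr (_ + _ * _); rewrite {1}gE addrC addKr.
Qed.

Lemma cdiff_cst c z : cdiff (fun=> c) z. Proof. by exists 0; exact: cderiv_cst. Qed.
Lemma cdiff_id z : cdiff id z. Proof. by exists 1; exact: cderiv_id. Qed.
Lemma cdiffD f g z : cdiff f z -> cdiff g z -> cdiff (fun w => f w + g w) z.
Proof. by move=> [a df] [b dg]; exists (a + b); exact: cderivD. Qed.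
Lemma cdiffB f g z : cdiff f z -> cdiff g z -> cdiff (fun w => f w - g w) z.
Proof. by move=> [a df] [b dg]; exists (a - b); exact: cderivB. Qed.
Lemma cdiffM f g z : cdiff f z -> cdiff g z -> cdiff (fun w => f w * g w) z.
Proof. by move=> [a df] [b dg]; eexists; exact: cderivM df dg. Qed.
Lemma cdiffV f z : f z != 0 -> cdiff f z -> cdiff (fun w => (f w)^-1) z.
Proof. by move=> fz [a df]; eexists; exact: cderivV fz df. Qed.
Lemma cdiff_comp f g z : cdiff g z -> cdiff f (g z) -> cdiff (fun w => f (g w)) z.
Proof. by move=> [b dg] [a df]; eexists; exact: cderiv_comp dg df. Qed.
Lemma cdiffX f n z : cdiff f z -> cdiff (fun w => f w ^+ n) z.
Proof.
move=> cf; elim: n => [|n IH].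
  by apply: (cdiff_eq (cdiff_cst 1 z)); exists 1 => // w _; rewrite expr0.
by apply: (cdiff_eq (cdiffM cf IH)); exists 1 => // w _; rewrite exprS.
Qed.

Lemma ccont_sub c z : ccont (fun w => w - c) z.
Proof. by apply: ccontB; [exact: ccont_id|exact: ccont_cst]. Qed.
Lemma cdiff_sub c z : cdiff (fun w => w - c) z.
Proof. by apply: cdiffB; [exact: cdiff_id|exact: cdiff_cst]. Qed.
Lemma ccont_inv_sub c z : z != c -> ccont (fun w => (w - c)^-1) z.
Proof. by move=> zc; apply: ccontV; [rewrite subr_eq0|exact: ccont_sub]. Qed.
Lemma cdiff_inv_sub c z : z != c -> cdiff (fun w => (w - c)^-1) z.
Proof. by move=> zc; apply: cdiffV; [rewrite subr_eq0|exact: cdiff_sub]. Qed.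
Lemma ccont_quotient f b c z : z != c -> ccont f z -> ccont (fun w => (f w - b) / (w - c)) z.
Proof.
move=> zc cf; apply: ccontM; last exact: ccont_inv_sub.
by apply: ccontB => //; exact: ccont_cst.
Qed.
Lemma cdiff_quotient f b c z : z != c -> cdiff f z -> cdiff (fun w => (f w - b) / (w - c)) z.
Proof.
move=> zc df; apply: cdiffM; last exact: cdiff_inv_sub.
by apply: cdiffB => //; exact: cdiff_cst.
Qed.

Lemma derivable_cdiff f z : derivable (f : Cx R -> Cx R) z 1 <-> cdiff f z.
Proof.
split.
  move=> /cvg_ex[/= d Hd]; exists d.
  exists (fun w => if w == z then d else (f w - f z) / (w - z)); split.
  - apply/ccontP => e e0; rewrite eqxx.
    pose U : set (Cx R) := fun w => abs ((w : C) - d) < e.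
    have /Hd : nbhs (d : Cx R) U by apply/Cx_nbhsP; exists e.
    move=> /Cx_nbhsP[r r0 Hr]; exists r => // w wr.
    case: eqP => [_|/eqP wz]; first by rewrite subrr abs0.
    have wz0 : w - z != 0 by rewrite subr_eq0.
    have := Hr (w - z); rewrite subr0 => /(_ wr wz0).
    rewrite /U /= [(w - z) *: _]mulr1 subrK => h; rewrite mulrC; exact: h.
  - by rewrite eqxx.
  - move=> w; case: eqP => [->|/eqP wz]; first by rewrite subrr mulr0 addr0.
    by rewrite divfK ?subr_eq0// addrC subrK.
move=> [d [q [cq _ fE]]]; apply/cvg_ex; exists (q z : Cx R) => U /= /Cx_nbhsP [e e0 HU].
have /ccontP/(_ _ e0)[r r0 Hr] := cq.
apply/Cx_nbhsP; exists r => // h; rewrite subr0 => hr h0; apply: HU.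
have -> : h^-1 *: (f (h *: (1 : Cx R) + z) - f z) = q (h + z).
  rewrite [h *: _]mulr1 fE addrK [f z + _]addrC addrK [_ *: _]mulrC.
  by rewrite mulfK.
by apply: Hr; rewrite addrK.
Qed.
End CCont.

(** * Nested squares and compactness *)

Section NestedSquares.
Variable R : realType.
Local Notation C := (R[i]).
Implicit Types (x y s : R) (z w : C).

Definition in_square x y s z : Prop :=
  [/\ x <= Re z, Re z <= x + s, y <= Im z & Im z <= y + s].

(** Bisection: if [P] failed for the big square it would fail for one of its quarters, and so on;
    the nested squares shrink to a point, where the local hypothesis is violated. This serves both
    Goursat's lemma and the compactness arguments. *)
Lemma square_ind (P : R -> R -> R -> Prop) x0 y0 s0 : 0 < s0 ->
  (forall x y s, 0 < s -> x0 <= x -> y0 <= y -> x + s <= x0 + s0 -> y + s <= y0 + s0 ->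
     P x y (s / 2) -> P (x + s / 2) y (s / 2) -> P x (y + s / 2) (s / 2) ->
     P (x + s / 2) (y + s / 2) (s / 2) -> P x y s) ->
  (forall z, in_square x0 y0 s0 z -> exists2 r : R, 0 < r &
     forall x y s, 0 < s -> s < r -> x0 <= x -> y0 <= y -> x + s <= x0 + s0 ->
       y + s <= y0 + s0 -> in_square x y s z -> P x y s) ->
  P x0 y0 s0.
Proof.
move=> s00 Hq Hloc; apply: contrapT => nP.
pose ok (t : R * R * R) := [/\ 0 < t.2, x0 <= t.1.1, y0 <= t.1.2,
  t.1.1 + t.2 <= x0 + s0 & t.1.2 + t.2 <= y0 + s0].
pose bad (t : R * R * R) := ok t /\ ~ P t.1.1 t.1.2 t.2.
have step (t : {t | bad t}) : {t' : {t | bad t} | [/\ (sval t').2 = (sval t).2 / 2,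
    (sval t).1.1 <= (sval t').1.1, (sval t').1.1 + (sval t').2 <= (sval t).1.1 + (sval t).2,
    (sval t).1.2 <= (sval t').1.2 & (sval t').1.2 + (sval t').2 <= (sval t).1.2 + (sval t).2]}.
  apply: cid; case: t => [[[x y] s] [/= [/= s_0 xx yy xs ys] nPt]].
  have [h1|h1] := pselect (P x y (s / 2)); last first.
    unshelve eexists; [exists (x, y, s / 2); split=> //; split => /=; lra|].
    by split => /=; lra.
  have [h2|h2] := pselect (P (x + s / 2) y (s / 2)); last first.
    unshelve eexists; [exists (x + s / 2, y, s / 2); split=> //; split => /=; lra|].
    by split => /=; lra.
  have [h3|h3] := pselect (P x (y + s / 2) (s / 2)); last first.
    unshelve eexists; [exists (x, y + s / 2, s / 2); split=> //; split => /=; lra|].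
    by split => /=; lra.
  have [h4|h4] := pselect (P (x + s / 2) (y + s / 2) (s / 2)); last first.
    unshelve eexists; [exists (x + s / 2, y + s / 2, s / 2); split=> //; split => /=; lra|].
    by split => /=; lra.
  by exfalso; apply: nPt; apply: Hq.
have b0 : bad (x0, y0, s0) by split => //; split => /=; lra.
pose T n := iter n (fun t => sval (step t)) (exist _ _ b0).
pose X n := (sval (T n)).1.1; pose Y n := (sval (T n)).1.2; pose S n := (sval (T n)).2.
have st n : [/\ S n.+1 = S n / 2, X n <= X n.+1, X n.+1 + S n.+1 <= X n + S n,
    Y n <= Y n.+1 & Y n.+1 + S n.+1 <= Y n + S n].
  by have := svalP (step (T n)).
have SE n : S n = s0 / 2 ^+ n.
  elim: n => [|n IH]; first by rewrite expr0 divr1.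
  have [-> _ _ _ _] := st n; rewrite IH exprS; field.
  by rewrite expf_neq0 // pnatr_eq0.
have S0 n : 0 < S n by rewrite SE divr_gt0 // exprn_gt0.
have lim (Z : nat -> R) : (forall n, Z n <= Z n.+1) -> (forall n, Z n.+1 + S n.+1 <= Z n + S n) ->
    exists u, forall n, Z n <= u /\ u <= Z n + S n.
  move=> Zi Zd.
  have Zi' n m : Z n <= Z (n + m)%N.
    by elim: m => [|m IH]; rewrite ?addn0 // addnS (le_trans IH).
  have Zd' n m : Z (n + m)%N + S (n + m)%N <= Z n + S n.
    by elim: m => [|m IH]; rewrite ?addn0 // addnS (le_trans (Zd _)).
  have ub n m : Z m <= Z n + S n.
    have [/subnKC <-|/ltnW/subnKC <-] := leqP n m.
      by apply: le_trans (Zd' n (m - n)%N); rewrite lerDl ltW.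
    by apply: (le_trans (Zi' m (n - m)%N)); rewrite lerDl ltW.
  have hs : has_sup (range Z).
    split; first by exists (Z 0); exists 0.
    by exists (Z 0 + S 0) => _ [m _ <-].
  exists (sup (range Z)) => n; split; first by apply: ub_le_sup => //; case: hs.
  apply: ge_sup; first by case: hs.
  by move=> _ [m _ <-].
have [a Ha] := lim X (fun n => let: And5 _ h _ _ _ := st n in h) (fun n => let: And5 _ _ h _ _ := st n in h).
have [b Hb] := lim Y (fun n => let: And5 _ _ _ h _ := st n in h) (fun n => let: And5 _ _ _ _ h := st n in h).
have [|r r0 Hr] := Hloc (a +i* b).
  have [h1 h2] := Ha 0; have [h3 h4] := Hb 0.
  by split.
have [n Hn] : exists n, S n < r.
  have [N HN] : exists N : nat, s0 / r < N%:R.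
    exists (Num.truncn (s0 / r)).+1; exact: truncnS_gt.
  exists N; rewrite SE ltr_pdivrMr ?exprn_gt0 // mulrC -ltr_pdivrMr //.
  apply: (lt_trans HN); have := ltn_expl N (isT : 1 < 2)%N.
  by rewrite -(ltr_nat R) natrX.
have [[/= t0 t1 t2 t3 t4] ] := svalP (T n); apply; apply: Hr => //.
by have [h1 h2] := Ha n; have [h3 h4] := Hb n; split.
Qed.

Lemma square_abs x y s z w : 0 <= s -> in_square x y s z -> in_square x y s w -> abs (z - w) <= 2 * s.
Proof.
move=> s0 [? ? ? ?] [? ? ? ?]; apply: (le_trans (abs_leReIm _)).
have -> : Re (z - w) = Re z - Re w by case: (z) (w) => ? ? [].
have -> : Im (z - w) = Im z - Im w by case: (z) (w) => ? ? [].
have h1 : `|Re z - Re w| <= s by rewrite ler_norml; lra.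
have h2 : `|Im z - Im w| <= s by rewrite ler_norml; lra.
by lra.
Qed.

Lemma in_squareP M z : abs z <= M -> in_square (- M) (- M) (2 * M) z.
Proof.
move=> zM; have := abs_Re z; have := abs_Im z.
by rewrite !ler_norml => /andP[? ?] /andP[? ?]; split; lra.
Qed.

Definition cbounded (K : set C) : Prop := exists M : R, forall z, K z -> abs z <= M.
Definition cclosed (K : set C) : Prop :=
  forall z, ~ K z -> exists2 r : R, 0 < r & forall w, abs (w - z) < r -> ~ K w.

Lemma cbounded_pos (K : set C) : cbounded K ->
  exists2 M : R, 0 < M & forall z, K z -> abs z <= M.
Proof.
move=> [M KM]; exists (Num.max M 1); first by rewrite lt_max ltr01 orbT.
by move=> z /KM h; rewrite le_max h.
Qed.

(* Compactness of closed bounded sets, in the form "a locally uniform bound is uniform". *)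
Lemma uniform_bound (K : set C) (Q : C -> R -> Prop) : cbounded K -> cclosed K ->
  (forall z c c', Q z c -> 0 < c' -> c' <= c -> Q z c') ->
  (forall z, K z -> exists2 c : R, 0 < c & exists2 r : R, 0 < r &
     forall w, K w -> abs (w - z) < r -> Q w c) ->
  exists2 c : R, 0 < c & forall z, K z -> Q z c.
Proof.
move=> Kb Kc Qm Hloc; have [M M1 KM] := cbounded_pos Kb.
pose P x y s := exists2 c : R, 0 < c & forall z, in_square x y s z -> K z -> Q z c.
have [|||c c0 Hc] := @square_ind P (- M) (- M) (2 * M); first by lra.
- move=> x y s s0 _ _ _ _ [a a0 Ha] [b b0 Hb] [c c0 Hc] [d d0 Hd].
  exists (Num.min (Num.min a b) (Num.min c d)); first by rewrite !lt_min a0 b0 c0 d0.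
  set m := Num.min _ _.
  have m0 : 0 < m by rewrite !lt_min a0 b0 c0 d0.
  have ma : m <= a by rewrite !ge_min lexx.
  have mb : m <= b by rewrite !ge_min lexx !orbT.
  have mc : m <= c by rewrite !ge_min lexx !orbT.
  have md : m <= d by rewrite !ge_min lexx !orbT.
  move=> z [z1 z2 z3 z4] Kz.
  have [h1|h1] := leP (Re z) (x + s / 2); have [h2|h2] := leP (Im z) (y + s / 2).
  + by apply: Qm (Ha z _ Kz) _ _ => //; split; lra.
  + by apply: Qm (Hc z _ Kz) _ _ => //; split; lra.
  + by apply: Qm (Hb z _ Kz) _ _ => //; split; lra.
  + by apply: Qm (Hd z _ Kz) _ _ => //; split; lra.
- move=> z zin; have [Kz|nKz] := pselect (K z).
    have [c c0 [r r0 Hr]] := Hloc z Kz; exists (r / 2); first by lra.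
    move=> x y s s0 sr _ _ _ _ zi; exists c => // w wi Kw; apply: Hr => //.
    by have := square_abs (ltW s0) wi zi; lra.
  have [r r0 Hr] := Kc z nKz; exists (r / 2); first by lra.
  move=> x y s s0 sr _ _ _ _ zi; exists 1 => // w wi Kw; exfalso; apply: (Hr w) => //.
  by have := square_abs (ltW s0) wi zi; lra.
by exists c => // z Kz; apply: Hc => //; apply: in_squareP; apply: KM.
Qed.

(** Two nested applications of [uniform_bound]. For fixed [z] the inner one uses a predicate whose
    constant is also the radius around [z] on which it is valid, so that this radius becomes uniform
    in [w]. *)
Lemma uniform_bound2 (K : set C) (Q : C -> C -> R -> Prop) : cbounded K -> cclosed K ->
  (forall z w c c', Q z w c -> 0 < c' -> c' <= c -> Q z w c') ->
  (forall z w, K z -> K w -> exists2 c : R, 0 < c & exists2 r : R, 0 < r &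
     forall z' w', K z' -> K w' -> abs (z' - z) < r -> abs (w' - w) < r -> Q z' w' c) ->
  exists2 c : R, 0 < c & forall z w, K z -> K w -> Q z w c.
Proof.
move=> Kb Kc Qm Hloc.
suff [c c0 H] : exists2 c : R, 0 < c & forall z, K z -> forall w, K w -> Q z w c.
  by exists c => // z w Kz; apply: H.
apply: (@uniform_bound K (fun z c => forall w, K w -> Q z w c)) => //.
  by move=> z c c' Hz c0 cc w Kw; apply: Qm (Hz w Kw) _ _.
move=> z Kz.
have [|w Kw|c c0 Hc] := @uniform_bound K (fun w c => forall z', K z' -> abs (z' - z) < c -> Q z' w c) Kb Kc.
- move=> w c c' Hw c0 cc z' Kz' zz.
  by apply: Qm (Hw _ Kz' _) _ _ => //; apply: lt_le_trans zz cc.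
- have [c c0 [r r0 Hr]] := Hloc z w Kz Kw.
  exists (Num.min c r); first by rewrite lt_min c0.
  exists r => // w' Kw' ww z' Kz'; rewrite lt_min => /andP[zc zr].
  by apply: Qm (Hr _ _ Kz' Kw' zr ww) _ _; rewrite ?lt_min ?c0 // ge_min lexx.
by exists c => //; exists c => // z' Kz' zz w Kw; apply: Hc.
Qed.

(** The centres are taken inside [K], because the maps sampled on the net are controlled only there:
    a small square contributes one of its points in [K] if it has any. *)
Lemma finite_net (K : set C) (e : R) : cbounded K -> 0 < e ->
  exists t : seq C, (forall a, a \in t -> K a) /\
    forall z, K z -> exists2 a, a \in t & abs (z - a) < e.
Proof.
move=> Kb e0; have [M M1 KM] := cbounded_pos Kb.
pose P x y s := exists t : seq C, (forall a, a \in t -> K a) /\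
    forall z, in_square x y s z -> K z -> exists2 a, a \in t & abs (z - a) < e.
have [|||t [t1 t2]] := @square_ind P (- M) (- M) (2 * M); first by lra.
- move=> x y s s0 _ _ _ _ [a [a0 Ha]] [b [b0 Hb]] [c [c0 Hc]] [d [d0 Hd]].
  exists (a ++ b ++ c ++ d); split.
    by move=> z; rewrite !mem_cat => /or4P[/a0|/b0|/c0|/d0].
  move=> z [z1 z2 z3 z4] Kz.
  have [h1|h1] := leP (Re z) (x + s / 2); have [h2|h2] := leP (Im z) (y + s / 2).
  + have [|u ut hu] := Ha z _ Kz; first by split; lra.
    by exists u => //; rewrite !mem_cat ut.
  + have [|u ut hu] := Hc z _ Kz; first by split; lra.
    by exists u => //; rewrite !mem_cat ut !orbT.
  + have [|u ut hu] := Hb z _ Kz; first by split; lra.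
    by exists u => //; rewrite !mem_cat ut !orbT.
  + have [|u ut hu] := Hd z _ Kz; first by split; lra.
    by exists u => //; rewrite !mem_cat ut !orbT.
- move=> z _; exists (e / 2); first by lra.
  move=> x y s s0 se _ _ _ _ _.
  have [[a [ai Ka]]|nK] := pselect (exists a, in_square x y s a /\ K a).
    exists [:: a]; split; first by move=> u; rewrite inE => /eqP ->.
    move=> w wi Kw; exists a; first by rewrite inE.
    by have := square_abs (ltW s0) wi ai; lra.
  by exists [::]; split => // w wi Kw; exfalso; apply: nK; exists w.
by exists t; split => // z Kz; apply: t2 => //; apply: in_squareP; apply: KM.
Qed.

End NestedSquares.

(** * Goursat's lemma and Cauchy's inequality *)

Section RealIntegral.
Variable R : realType.
Implicit Types (a b c s t M : R) (u v : R -> R).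
Local Notation mu := (@lebesgue_measure R).

Definition rint a b u : R := \int[mu]_(x in `[a, b]) u x.

(** [s] ranges over the whole line, also at the end points: the integrands are restrictions to a
    side of functions that are continuous at its points as functions on the plane. *)
Definition rcont a b u : Prop := forall t, a <= t <= b -> forall e : R, 0 < e ->
  exists2 r : R, 0 < r & forall s, `|s - t| < r -> `|u s - u t| < e.

Lemma rcont_integrable a b u : rcont a b u -> mu.-integrable `[a, b] (EFin \o u).
Proof.
move=> cu; apply: continuous_compact_integrable; first exact: segment_compact.
apply: continuous_in_subspaceT => t; rewrite inE /= in_itv /= => tab.
apply/cvgrPdist_lt => e e0; have [r r0 Hr] := cu t tab e e0.
apply/nbhs_ballP; exists r => //= s; rewrite /ball /= distrC => /Hr.
by rewrite distrC.
Qed.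

Lemma eq_rint a b u v : (forall t, a <= t <= b -> u t = v t) -> rint a b u = rint a b v.
Proof. by move=> uv; apply: eq_Rintegral => t; rewrite inE /= in_itv /= => /uv. Qed.

Lemma rintD a b u v : rcont a b u -> rcont a b v ->
  rint a b (fun t => u t + v t) = rint a b u + rint a b v.
Proof. by move=> /rcont_integrable iu /rcont_integrable iv; apply: RintegralD. Qed.

Lemma rintB a b u v : rcont a b u -> rcont a b v ->
  rint a b (fun t => u t - v t) = rint a b u - rint a b v.
Proof. by move=> /rcont_integrable iu /rcont_integrable iv; apply: RintegralB. Qed.

Lemma rint_cst a b c : a <= b -> rint a b (fun=> c) = c * (b - a).
Proof.
move=> ab; rewrite /rint Rintegral_cst //= lebesgue_measure_itv /= lte_fin.
by move: ab; rewrite le_eqVlt => /predU1P[->|->]; rewrite ?ltxx ?subrr ?mulr0.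
Qed.

Lemma rcont_cst a b c : rcont a b (fun=> c).
Proof. by move=> t _ e e0; exists 1 => // s _; rewrite subrr normr0. Qed.

Lemma rint_split a b c u : a <= c <= b -> rcont a b u ->
  rint a b u = rint a c u + rint c b u.
Proof.
move=> /andP[ac cb] cu; have iu := rcont_integrable cu.
have := @Rintegral_itvB R u (BLeft a) (BRight b) c iu.
rewrite !bnd_simp => /(_ ac cb) H.
have ic : mu.-integrable `]c, b] (EFin \o u).
  by apply: integrableS iu => //; apply: subset_itvr; rewrite bnd_simp.
by rewrite /rint -(Rintegral_itv_obnd_cbnd ic) -H addrC subrK.
Qed.

Lemma rint_ge a b c u : a <= b -> rcont a b u -> (forall t, a <= t <= b -> c <= u t) ->
  c * (b - a) <= rint a b u.
Proof.
move=> ab cu cle; rewrite -rint_cst //; apply: le_Rintegral => //.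
- by apply: rcont_integrable; exact: rcont_cst.
- exact: rcont_integrable.
Qed.

Lemma rint_le a b c u : a <= b -> rcont a b u -> (forall t, a <= t <= b -> u t <= c) ->
  rint a b u <= c * (b - a).
Proof.
move=> ab cu cle; rewrite -rint_cst //; apply: le_Rintegral => //.
- exact: rcont_integrable.
- by apply: rcont_integrable; exact: rcont_cst.
Qed.

Lemma rint_norm a b M u : a <= b -> rcont a b u -> (forall t, a <= t <= b -> `|u t| <= M) ->
  `|rint a b u| <= M * (b - a).
Proof.
move=> ab cu uM; rewrite ler_norml; apply/andP; split.
  by rewrite -mulNr; apply: rint_ge => // t /uM; rewrite ler_norml => /andP[].
by apply: rint_le => // t /uM; rewrite ler_norml => /andP[].
Qed.
End RealIntegral.

Section ComplexIntegral.
Variable R : realType.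
Local Notation C := (R[i]).
Implicit Types (a b c s t M : R) (p q : R -> C).

Definition cint a b p : C := rint a b (fun t => Re (p t)) +i* rint a b (fun t => Im (p t)).
Definition pcont a b p : Prop := forall t, a <= t <= b -> forall e : R, 0 < e ->
  exists2 r : R, 0 < r & forall s, `|s - t| < r -> abs (p s - p t) < e.

Lemma ReB (z w : C) : Re (z - w) = Re z - Re w. Proof. by case: z w => ? ? []. Qed.
Lemma ImB (z w : C) : Im (z - w) = Im z - Im w. Proof. by case: z w => ? ? []. Qed.
Lemma ReD (z w : C) : Re (z + w) = Re z + Re w. Proof. by case: z w => ? ? []. Qed.
Lemma ImD (z w : C) : Im (z + w) = Im z + Im w. Proof. by case: z w => ? ? []. Qed.

Lemma pcont_Re a b p : pcont a b p -> rcont a b (fun t => Re (p t)).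
Proof.
move=> cp t tab e /(cp t tab)[r r0 Hr]; exists r => // s /Hr.
by rewrite -ReB; apply: le_lt_trans (abs_Re _).
Qed.
Lemma pcont_Im a b p : pcont a b p -> rcont a b (fun t => Im (p t)).
Proof.
move=> cp t tab e /(cp t tab)[r r0 Hr]; exists r => // s /Hr.
by rewrite -ImB; apply: le_lt_trans (abs_Im _).
Qed.
Lemma pcontB a b p q : pcont a b p -> pcont a b q -> pcont a b (fun t => p t - q t).
Proof.
move=> cp cq t tab e e0; have e2 : 0 < e / 2 by lra.
have [r r0 Hr] := cp t tab _ e2; have [s s0 Hs] := cq t tab _ e2.
exists (Num.min r s); first by rewrite lt_min r0.
move=> w; rewrite lt_min => /andP[/Hr h1 /Hs h2].
have -> : p w - q w - (p t - q t) = (p w - p t) - (q w - q t) by ring.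
by apply: (le_lt_trans (abs_suble _ _)); lra.
Qed.

Lemma eq_cint a b p q : (forall t, a <= t <= b -> p t = q t) -> cint a b p = cint a b q.
Proof. by move=> pq; congr (_ +i* _); apply: eq_rint => t /pq ->. Qed.

Lemma cintD a b p q : pcont a b p -> pcont a b q ->
  cint a b (fun t => p t + q t) = cint a b p + cint a b q.
Proof.
move=> cp cq; apply/eqP; rewrite eq_complex /=; apply/andP; split; apply/eqP.
  by rewrite -rintD; [apply: eq_rint => t _; rewrite ReD|exact: pcont_Re|exact: pcont_Re].
by rewrite -rintD; [apply: eq_rint => t _; rewrite ImD|exact: pcont_Im|exact: pcont_Im].
Qed.

Lemma cintB a b p q : pcont a b p -> pcont a b q ->
  cint a b (fun t => p t - q t) = cint a b p - cint a b q.
Proof.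
move=> cp cq; apply/eqP; rewrite eq_complex /=; apply/andP; split; apply/eqP.
  by rewrite -rintB; [apply: eq_rint => t _; rewrite ReB|exact: pcont_Re|exact: pcont_Re].
by rewrite -rintB; [apply: eq_rint => t _; rewrite ImB|exact: pcont_Im|exact: pcont_Im].
Qed.

Lemma cint_cst a b (c : C) : a <= b -> cint a b (fun=> c) = c * (b - a)%:C.
Proof.
move=> ab; case: c => c d; rewrite /cint !rint_cst //.
by apply/eqP; rewrite eq_complex /=; apply/andP; split; apply/eqP; ring.
Qed.

Lemma cint_split a b c p : a <= c <= b -> pcont a b p ->
  cint a b p = cint a c p + cint c b p.
Proof.
move=> acb cp; apply/eqP; rewrite eq_complex /=.
by rewrite -!rint_split ?eqxx //; [exact: pcont_Im|exact: pcont_Re].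
Qed.

(** Real and imaginary parts are estimated separately, hence the factor [2]. It costs nothing later,
    because the resulting Cauchy inequality is only applied to [n]-th powers. *)
Lemma cint_abs a b M p : a <= b -> pcont a b p -> (forall t, a <= t <= b -> abs (p t) <= M) ->
  abs (cint a b p) <= 2 * M * (b - a).
Proof.
move=> ab cp pM; apply: (le_trans (abs_leReIm _)) => /=.
have h1 : `|rint a b (fun t => Re (p t))| <= M * (b - a).
  by apply: rint_norm => // [|t /pM]; [exact: pcont_Re|apply: le_trans (abs_Re _)].
have h2 : `|rint a b (fun t => Im (p t))| <= M * (b - a).
  by apply: rint_norm => // [|t /pM]; [exact: pcont_Im|apply: le_trans (abs_Im _)].
by lra.
Qed.

Lemma pcont_hor (f : C -> C) a b y : (forall t, a <= t <= b -> ccont f (t +i* y)) ->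
  pcont a b (fun t => f (t +i* y)).
Proof.
move=> cf t /cf[{}cf] e /cf[r r0 Hr]; exists r => // s st; apply: Hr.
have -> : s +i* y - t +i* y = (s - t)%:C.
  by apply/eqP; rewrite eq_complex /= subrr !eqxx.
by rewrite abs_real.
Qed.
Lemma pcont_ver (f : C -> C) a b x : (forall t, a <= t <= b -> ccont f (x +i* t)) ->
  pcont a b (fun t => f (x +i* t)).
Proof.
move=> cf t /cf[{}cf] e /cf[r r0 Hr]; exists r => // s st; apply: Hr.
have -> : x +i* s - x +i* t = 0 +i* (s - t).
  by apply/eqP; rewrite eq_complex /= subrr !eqxx.
apply: (le_lt_trans (abs_leReIm _)) => /=; by rewrite normr0 add0r.
Qed.
End ComplexIntegral.

Section Goursat.
Variable R : realType.
Local Notation C := (R[i]).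
Implicit Types (x y s t M : R) (z w a : C) (f g : C -> C).

(* The contour integral over the boundary of a square; opposite sides are
   combined, so that the integrand is constant when [f] is affine. *)
Definition jint f x y s : C :=
  cint x (x + s) (fun t => f (t +i* y) - f (t +i* (y + s)))
  + 'i%C * cint y (y + s) (fun t => f ((x + s) +i* t) - f (x +i* t)).

Definition on_boundary x y s z : Prop := in_square x y s z /\
  [\/ Re z = x, Re z = x + s, Im z = y | Im z = y + s].

Lemma boundary_sides x y s : 0 < s ->
  [/\ forall t, x <= t <= x + s -> on_boundary x y s (t +i* y),
      forall t, x <= t <= x + s -> on_boundary x y s (t +i* (y + s)),
      forall t, y <= t <= y + s -> on_boundary x y s (x +i* t) &
      forall t, y <= t <= y + s -> on_boundary x y s ((x + s) +i* t)].
Proof.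
move=> s0; split=> t /andP[t1 t2]; split => /=.
- by split => /=; lra.
- by constructor 3.
- by split => /=; lra.
- by constructor 4.
- by split => /=; lra.
- by constructor 1.
- by split => /=; lra.
- by constructor 2.
Qed.

Lemma eq_jint f g x y s : 0 < s -> (forall z, on_boundary x y s z -> f z = g z) ->
  jint f x y s = jint g x y s.
Proof.
move=> s0 fg; have [h1 h2 h3 h4] := boundary_sides x y s0.
by rewrite /jint; congr (_ + _ * _); apply: eq_cint => t tt; rewrite !fg; auto.
Qed.

Lemma jint_sides f x y s : 0 < s -> (forall z, on_boundary x y s z -> ccont f z) ->
  [/\ pcont x (x + s) (fun t => f (t +i* y)),
      pcont x (x + s) (fun t => f (t +i* (y + s))),
      pcont y (y + s) (fun t => f (x +i* t)) &
      pcont y (y + s) (fun t => f ((x + s) +i* t))].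
Proof.
move=> s0 cf; have [h1 h2 h3 h4] := boundary_sides x y s0.
by split; (apply: pcont_hor || apply: pcont_ver) => t tt; apply: cf; auto.
Qed.

Lemma jintB f g x y s : 0 < s -> (forall z, on_boundary x y s z -> ccont f z) ->
  (forall z, on_boundary x y s z -> ccont g z) ->
  jint (fun z => f z - g z) x y s = jint f x y s - jint g x y s.
Proof.
move=> s0 /(jint_sides s0)[f1 f2 f3 f4] /(jint_sides s0)[g1 g2 g3 g4].
rewrite /jint.
have -> : cint x (x + s) (fun t => f (t +i* y) - g (t +i* y) - (f (t +i* (y + s)) - g (t +i* (y + s)))) =
   cint x (x + s) (fun t => f (t +i* y) - f (t +i* (y + s))) -
   cint x (x + s) (fun t => g (t +i* y) - g (t +i* (y + s))).
  by rewrite -cintB; [apply: eq_cint => t _; ring|exact: pcontB|exact: pcontB].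
have -> : cint y (y + s) (fun t => f ((x + s) +i* t) - g ((x + s) +i* t) - (f (x +i* t) - g (x +i* t))) =
   cint y (y + s) (fun t => f ((x + s) +i* t) - f (x +i* t)) -
   cint y (y + s) (fun t => g ((x + s) +i* t) - g (x +i* t)).
  by rewrite -cintB; [apply: eq_cint => t _; ring|exact: pcontB|exact: pcontB].
by ring.
Qed.

Lemma jint_abs f x y s M : 0 < s -> (forall z, on_boundary x y s z -> ccont f z) ->
  (forall z, on_boundary x y s z -> abs (f z) <= M) -> abs (jint f x y s) <= 8 * M * s.
Proof.
move=> s0 /(jint_sides s0)[f1 f2 f3 f4] fM; have [h1 h2 h3 h4] := boundary_sides x y s0.
apply: (le_trans (abs_addle _ _)); rewrite absM.
have -> : abs 'i%C = 1 :> R by rewrite /abs /= expr0n /= add0r expr1n sqrtr1.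
have H p q (a b : R) : a <= b -> pcont a b p -> pcont a b q ->
    (forall t, a <= t <= b -> abs (p t) <= M) -> (forall t, a <= t <= b -> abs (q t) <= M) ->
    abs (cint a b (fun t => p t - q t)) <= 4 * M * (b - a).
  move=> ab cp cq pM qM.
  have -> : 4 * M * (b - a) = 2 * (M + M) * (b - a) by ring.
  apply: cint_abs => // [|t tab]; first exact: pcontB.
  by apply: (le_trans (abs_suble _ _)); apply: lerD; auto.
have k1 := H _ _ x (x + s) _ f1 f2 (fun t tt => fM _ (h1 t tt)) (fun t tt => fM _ (h2 t tt)).
have k2 := H _ _ y (y + s) _ f4 f3 (fun t tt => fM _ (h4 t tt)) (fun t tt => fM _ (h3 t tt)).
have {}k1 := k1 ltac:(lra); have {}k2 := k2 ltac:(lra).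
by lra.
Qed.

Lemma jint_affine (c d : C) a x y s : 0 < s -> jint (fun z => c + d * (z - a)) x y s = 0.
Proof.
move=> s0; rewrite /jint.
rewrite (@eq_cint _ x (x + s) _ (fun=> - d * 'i%C * s%:C)); last first.
  move=> t _.
  have -> : t +i* (y + s) = t +i* y + 'i%C * s%:C.
    by apply/eqP; rewrite eq_complex /=; apply/andP; split; apply/eqP; ring.
  by ring.
rewrite (@eq_cint _ y (y + s) _ (fun=> d * s%:C)); last first.
  move=> t _.
  have -> : (x + s) +i* t = x +i* t + s%:C.
    by apply/eqP; rewrite eq_complex /=; apply/andP; split; apply/eqP; ring.
  by ring.
rewrite (@cint_cst _ x) ?(@cint_cst _ y); [|lra..].
by rewrite [x + s]addrC addrK [y + s]addrC addrK; ring.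
Qed.

Lemma jint_split f x y s : 0 < s -> (forall z, in_square x y s z -> ccont f z) ->
  jint f x y s = jint f x y (s / 2) + jint f (x + s / 2) y (s / 2)
     + jint f x (y + s / 2) (s / 2) + jint f (x + s / 2) (y + s / 2) (s / 2).
Proof.
move=> s0 cf; rewrite /jint.
have hs (u : R) : u + s / 2 + s / 2 = u + s by field.
rewrite !hs.
have H (u v w : R) : u <= w -> x <= u -> w <= x + s -> y <= v <= y + s -> pcont u w (fun t => f (t +i* v)).
  move=> uw xu ws /andP[v1 v2]; apply: pcont_hor => t /andP[t1 t2]; apply: cf; split => /=; lra.
have V (u v w : R) : u <= w -> y <= u -> w <= y + s -> x <= v <= x + s -> pcont u w (fun t => f (v +i* t)).
  move=> uw xu ws /andP[v1 v2]; apply: pcont_ver => t /andP[t1 t2]; apply: cf; split => /=; lra.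
rewrite (@cint_split _ x (x + s) (x + s / 2)); [|lra|by apply: pcontB; apply: H; lra].
rewrite (@cint_split _ y (y + s) (y + s / 2)); [|lra|by apply: pcontB; apply: V; lra].
have e1 (u w : R) : u <= w -> x <= u -> w <= x + s ->
    cint u w (fun t => f (t +i* y) - f (t +i* (y + s))) =
    cint u w (fun t => f (t +i* y) - f (t +i* (y + s / 2))) +
    cint u w (fun t => f (t +i* (y + s / 2)) - f (t +i* (y + s))).
  move=> uw xu ws; rewrite -cintD; [|by apply: pcontB; apply: H; lra|by apply: pcontB; apply: H; lra].
  by apply: eq_cint => t _; ring.
have e2 (u w : R) : u <= w -> y <= u -> w <= y + s ->
    cint u w (fun t => f ((x + s) +i* t) - f (x +i* t)) =
    cint u w (fun t => f ((x + s / 2) +i* t) - f (x +i* t)) +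
    cint u w (fun t => f ((x + s) +i* t) - f ((x + s / 2) +i* t)).
  move=> uw xu ws; rewrite -cintD; [|by apply: pcontB; apply: V; lra|by apply: pcontB; apply: V; lra].
  by apply: eq_cint => t _; ring.
rewrite (e1 x (x + s / 2)); [|lra..]; rewrite (e1 (x + s / 2) (x + s)); [|lra..].
rewrite (e2 y (y + s / 2)); [|lra..]; rewrite (e2 (y + s / 2) (y + s)); [|lra..].
by ring.
Qed.

Lemma eps_eq0 (u : R) : 0 <= u -> (forall e : R, 0 < e -> u <= e) -> u = 0.
Proof.
move=> u0 H; apply/eqP; rewrite eq_le u0 andbT leNgt; apply/negP => up.
by have := H (u / 2) ltac:(lra); lra.
Qed.

Lemma goursat f x y s : 0 < s -> (forall z, in_square x y s z -> cdiff f z) ->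
  jint f x y s = 0.
Proof.
move=> s0 df; apply: abs0P; apply: eps_eq0 => [|e e0]; first exact: abs_ge0.
pose d := e / s ^+ 2.
have d0 : 0 < d by rewrite divr_gt0 // exprn_gt0.
(* The target is proportional to the area of the square, so it adds up exactly over the four
   quarters. *)
suff : abs (jint f x y s) <= d * s ^+ 2 by rewrite divfK // expf_neq0 // gt_eqF.
pattern x, y, s; apply: square_ind => //.
- move=> x' y' s' s'0 xx yy xs ys h1 h2 h3 h4; rewrite jint_split //; last first.
    clear h1 h2 h3 h4 => z [z1 z2 z3 z4].
    by apply: cdiff_cont; apply: df; split; lra.
  have -> : d * s' ^+ 2 = d * (s' / 2) ^+ 2 + d * (s' / 2) ^+ 2 + d * (s' / 2) ^+ 2 + d * (s' / 2) ^+ 2.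
    by field.
  by do 3 (apply: (le_trans (abs_addle _ _)); apply: lerD => //).
move=> z /df[c [q [[cq] _ fE]]].
have [r r0 Hr] := cq (d / 16) ltac:(lra); exists (r / 2); first by lra.
move=> x' y' s' s'0 sr xx yy xs ys zi.
have cf w : on_boundary x' y' s' w -> ccont f w.
  by move=> [[w1 w2 w3 w4] _]; apply: cdiff_cont; apply: df; split; lra.
have ca w : on_boundary x' y' s' w -> ccont (fun w => f z + q z * (w - z)) w.
  move=> _; apply: ccontD; first exact: ccont_cst.
  by apply: ccontM; [exact: ccont_cst|exact: ccont_sub].
(* Subtracting the affine part leaves an integrand of modulus at most [d / 16 * (2 * s')] on the
   boundary; the factor [8 * s'] of [jint_abs] then gives [d * s' ^+ 2]. *)
have := jintB s'0 cf ca; rewrite jint_affine // subr0 => <-.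
have -> : d * s' ^+ 2 = 8 * (d / 16 * (2 * s')) * s' by field.
apply: jint_abs => // w wb; first by apply: ccontB; auto.
have wz : abs (w - z) <= 2 * s' by apply: square_abs zi; [lra|case: wb].
have -> : f w - (f z + q z * (w - z)) = (q w - q z) * (w - z) by rewrite fE; ring.
rewrite absM; apply: ler_pM => //; try exact: abs_ge0.
by apply: ltW; apply: Hr; lra.
Qed.

(* The twelve outer squares of a 4 x 4 grid do not contain the centre. *)
Lemma jint_center_half f a s : 0 < s ->
  (forall z, in_square (Re a - s) (Im a - s) (2 * s) z -> ccont f z) ->
  (forall z, in_square (Re a - s) (Im a - s) (2 * s) z -> z != a -> cdiff f z) ->
  jint f (Re a - s) (Im a - s) (2 * s) = jint f (Re a - s / 2) (Im a - s / 2) s.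
Proof.
case: a => a b /= s0 cf df.
have G x y : a - s <= x -> x + s / 2 <= a + s -> b - s <= y -> y + s / 2 <= b + s ->
   [\/ x + s / 2 < a, a < x, y + s / 2 < b | b < y] -> jint f x y (s / 2) = 0.
  move=> x1 x2 y1 y2 H; apply: goursat; first by lra.
  move=> z [z1 z2 z3 z4]; apply: df; first by split; lra.
  by apply/eqP => zE; move: z1 z2 z3 z4; rewrite zE /= => *; case: H; lra.
have S x y : a - s <= x -> x + s <= a + s -> b - s <= y -> y + s <= b + s ->
    forall z, in_square x y s z -> ccont f z.
  by move=> x1 x2 y1 y2 z [z1 z2 z3 z4]; apply: cf; split; lra.
rewrite (@jint_split f (a - s)); [|lra|by []].
have -> : 2 * s / 2 = s by field.
have -> : a - s + s = a by ring.
have -> : b - s + s = b by ring.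
rewrite (@jint_split f (a - s) (b - s) s); [|lra|by apply: S; lra].
rewrite (@jint_split f a (b - s) s); [|lra|by apply: S; lra].
rewrite (@jint_split f (a - s) b s); [|lra|by apply: S; lra].
rewrite (@jint_split f a b s); [|lra|by apply: S; lra].
rewrite (@jint_split f (a - s / 2) (b - s / 2) s); [|lra|by apply: S; lra].
have -> : a - s + s / 2 = a - s / 2 by field.
have -> : b - s + s / 2 = b - s / 2 by field.
have -> : a - s / 2 + s / 2 = a by ring.
have -> : b - s / 2 + s / 2 = b by ring.
rewrite (G (a - s) (b - s)); [|lra..|by constructor 1; lra].
rewrite (G (a - s / 2) (b - s)); [|lra..|by constructor 3; lra].
rewrite (G (a - s) (b - s / 2)); [|lra..|by constructor 1; lra].
rewrite (G a (b - s)); [|lra..|by constructor 3; lra].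
rewrite (G (a + s / 2) (b - s)); [|lra..|by constructor 3; lra].
rewrite (G (a + s / 2) (b - s / 2)); [|lra..|by constructor 2; lra].
rewrite (G (a - s) b); [|lra..|by constructor 1; lra].
rewrite (G (a - s) (b + s / 2)); [|lra..|by constructor 1; lra].
rewrite (G (a - s / 2) (b + s / 2)); [|lra..|by constructor 4; lra].
rewrite (G (a + s / 2) b); [|lra..|by constructor 2; lra].
rewrite (G a (b + s / 2)); [|lra..|by constructor 4; lra].
rewrite (G (a + s / 2) (b + s / 2)); [|lra..|by constructor 4; lra].
by rewrite !(add0r, addr0).
Qed.

Lemma small_pow2 (r : R) (M : R) : 0 < r -> exists n, M / 2 ^+ n < r.
Proof.
move=> r0; pose N := (Num.truncn (M / r)).+1; exists N.
rewrite ltr_pdivrMr ?exprn_gt0 // mulrC -ltr_pdivrMr //.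
apply: (lt_trans (truncnS_gt _)); have := ltn_expl N (isT : 1 < 2)%N.
by rewrite -(ltr_nat R) natrX.
Qed.

(** Halving the square around [a] does not change the integral, while continuity at [a] bounds [f]
    nearby; so the integral is at most a constant times an arbitrarily small side. *)
Lemma goursat_center f a s : 0 < s ->
  (forall z, in_square (Re a - s) (Im a - s) (2 * s) z -> ccont f z) ->
  (forall z, in_square (Re a - s) (Im a - s) (2 * s) z -> z != a -> cdiff f z) ->
  jint f (Re a - s) (Im a - s) (2 * s) = 0.
Proof.
move=> s0 cf df.
have le2 n : s / 2 ^+ n <= s.
  rewrite ler_pdivrMr ?exprn_gt0 //; apply: ler_peMr; first exact: ltW.
  by apply: exprn_ege1; rewrite ler1n.
have half n : jint f (Re a - s) (Im a - s) (2 * s) =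
    jint f (Re a - s / 2 ^+ n) (Im a - s / 2 ^+ n) (2 * (s / 2 ^+ n)).
  elim: n => [|n ->]; first by rewrite expr0 divr1.
  have sn0 : 0 < s / 2 ^+ n by rewrite divr_gt0 // exprn_gt0.
  have sns := le2 n.
  have -> : s / 2 ^+ n.+1 = s / 2 ^+ n / 2.
    by rewrite exprS; field; rewrite expf_neq0 // pnatr_eq0.
  have E : 2 * (s / 2 ^+ n / 2) = s / 2 ^+ n by field; rewrite expf_neq0 // pnatr_eq0.
  rewrite E; apply: jint_center_half => // z [z1 z2 z3 z4]; [apply: cf|apply: df]; split; lra.
have [cfa] : ccont f a by apply: cf; split; lra.
have [r r0 Hr] := cfa 1 ltac:(lra).
apply: abs0P; apply: eps_eq0 => [|e e0]; first exact: abs_ge0.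
pose M := abs (f a) + 1; have M0 : 0 < M by rewrite /M; have := abs_ge0 (f a); lra.
have [n] := @small_pow2 (Num.min (r / 4) (e / (16 * M))) s ltac:(by rewrite lt_min; apply/andP; split; [lra|rewrite divr_gt0 //; lra]).
rewrite lt_min => /andP[n1 n2]; rewrite (half n).
move: n2; rewrite ltr_pdivlMr; last by lra.
have sn0 : 0 < s / 2 ^+ n by rewrite divr_gt0 // exprn_gt0.
have sns := le2 n.
move: (s / 2 ^+ n) n1 sn0 sns => s' n1 sn0 sns n2.
apply: (@le_trans _ _ (8 * M * (2 * s'))); last by lra.
apply: jint_abs; first by lra.
  by move=> z [[z1 z2 z3 z4] _]; apply: cf; split; lra.
move=> z [zi _]; have ai : in_square (Re a - s') (Im a - s') (2 * s') a by split; lra.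
have := square_abs (ltac:(lra) : 0 <= 2 * s') zi ai => za.
have := Hr z ltac:(lra); have := abs_lesub (f z) (f a); rewrite /M; lra.
Qed.

Lemma center_boundary a s z : 0 < s -> on_boundary (Re a - s) (Im a - s) (2 * s) z ->
  s <= abs (z - a) /\ abs (z - a) <= 2 * s.
Proof.
move=> s0 [[z1 z2 z3 z4] zb].
have h1 := abs_Re (z - a); have h2 := abs_Im (z - a); have h3 := abs_leReIm (z - a).
rewrite ReB ImB in h1 h2 h3; split; last first.
  apply: (le_trans h3).
  have k1 : `|Re z - Re a| <= s by rewrite ler_norml; lra.
  have k2 : `|Im z - Im a| <= s by rewrite ler_norml; lra.
  by lra.
case: zb => zE.
- by apply: le_trans h1; rewrite zE ler0_norm; lra.
- by apply: le_trans h1; rewrite zE ger0_norm; lra.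
- by apply: le_trans h2; rewrite zE ler0_norm; lra.
- by apply: le_trans h2; rewrite zE ger0_norm; lra.
Qed.

Lemma inv_sides_lower (t s : R) : 0 < s -> - s <= t <= s ->
  s^-1 <= Im ((t -i* s)^-1 - (t +i* s)^-1 : C) /\
  s^-1 <= Re ((s +i* t)^-1 - ((- s) +i* t)^-1 : C).
Proof.
move=> s0 /andP[t1 t2].
have d0 : 0 < t ^+ 2 + s ^+ 2 by rewrite ltr_wpDl ?sqr_ge0 // exprn_gt0.
have tt : t ^+ 2 <= s ^+ 2 by rewrite !expr2; nra.
have k : s^-1 <= 2 * s / (t ^+ 2 + s ^+ 2).
  rewrite ler_pdivlMr // mulrC ler_pdivrMr //.
  by rewrite -mulrA -expr2; lra.
have kE : 2 * s / (t ^+ 2 + s ^+ 2) = s / (t ^+ 2 + s ^+ 2) + s / (t ^+ 2 + s ^+ 2).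
  by rewrite -mulrDl; congr (_ / _); ring.
rewrite ImB ReB /= !sqrrN !opprK [s ^+ 2 + t ^+ 2]addrC; split.
  by rewrite mulNr opprK -kE.
by rewrite mulNr opprK -kE.
Qed.

(** A lower bound for the imaginary part suffices: on each of the two pairs of opposite sides, of
    length [2 * s], the relevant part of the combined integrand is at least [s^-1]. *)
Lemma jint_inv a s : 0 < s ->
  4 <= abs (jint (fun z => (z - a)^-1) (Re a - s) (Im a - s) (2 * s)).
Proof.
move=> s0; apply: le_trans (abs_Im _); apply: le_trans (ler_norm _).
have s20 : 0 < 2 * s by lra.
have cf z : on_boundary (Re a - s) (Im a - s) (2 * s) z -> ccont (fun z => (z - a)^-1) z.
  move=> /(center_boundary s0)[h _]; apply: ccont_inv_sub.
  by rewrite -subr_eq0 -abs_gt0; lra.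
have [f1 f2 f3 f4] := jint_sides s20 cf.
have iE z : Im ('i%C * z) = Re z by case: z => u v /=; ring.
rewrite /jint ImD iE /=.
case: a cf f1 f2 f3 f4 => u v /= cf f1 f2 f3 f4.
have k1 : s^-1 * (u - s + 2 * s - (u - s)) <= rint (u - s) (u - s + 2 * s) (fun t : R =>
    Im ((t +i* (v - s) - u +i* v)^-1 - (t +i* (v - s + 2 * s) - u +i* v)^-1)).
  apply: rint_ge; first by lra.
    by apply: pcont_Im; apply: pcontB.
  move=> t /andP[t1 t2].
  have -> : t +i* (v - s) - u +i* v = (t - u) -i* s by congr (_ +i* _); rewrite /=; ring.
  have -> : t +i* (v - s + 2 * s) - u +i* v = (t - u) +i* s by congr (_ +i* _); rewrite /=; ring.
  by have [] := @inv_sides_lower (t - u) s s0 ltac:(lra).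
have k2 : s^-1 * (v - s + 2 * s - (v - s)) <= rint (v - s) (v - s + 2 * s) (fun t : R =>
    Re (((u - s + 2 * s) +i* t - u +i* v)^-1 - ((u - s) +i* t - u +i* v)^-1)).
  apply: rint_ge; first by lra.
    by apply: pcont_Re; apply: pcontB.
  move=> t /andP[t1 t2].
  have -> : (u - s) +i* t - u +i* v = (- s) +i* (t - v) by congr (_ +i* _); rewrite /=; ring.
  have -> : (u - s + 2 * s) +i* t - u +i* v = s +i* (t - v) by congr (_ +i* _); rewrite /=; ring.
  by have [] := @inv_sides_lower (t - v) s s0 ltac:(lra).
have hs (w : R) : s^-1 * (w - s + 2 * s - (w - s)) = 2 by field; lra.
by move: k1 k2; rewrite !hs => k1 k2; lra.
Qed.

(** The slope of [f] at [a], divided by [f a], is continuous at [a] and differentiable elsewhere in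
    the square, so its integral vanishes. Hence [f z / f a / (z - a)] and [(z - a)^-1] have the same
    integral; the first is at most [16 * M / abs (f a)] in modulus, the second at least [4]. *)
Lemma cauchy_square f a s M : 0 < s ->
  (forall z, in_square (Re a - s) (Im a - s) (2 * s) z -> cdiff f z) ->
  (forall z, on_boundary (Re a - s) (Im a - s) (2 * s) z -> abs (f z) <= M) ->
  abs (f a) <= 4 * M.
Proof.
move=> s0 df fM; have s20 : 0 < 2 * s by lra.
have M0 : 0 <= M.
  have [h _ _ _] := boundary_sides (Re a - s) (Im a - s) s20.
  by apply: le_trans (fM _ (h (Re a) ltac:(lra))); exact: abs_ge0.
have [fa0|fa0] := eqVneq (f a) 0; first by rewrite fa0 abs0; lra.
have fap : 0 < abs (f a) by rewrite abs_gt0.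
have ai : in_square (Re a - s) (Im a - s) (2 * s) a by split; lra.
have [d [q [cq qa fE]]] := df a ai.
pose k z := q z / f a.
have kE z : z != a -> k z = f z / f a / (z - a) - (z - a)^-1.
  by move=> za; rewrite /k (fE z); field; rewrite fa0 subr_eq0 za.
have kd z : in_square (Re a - s) (Im a - s) (2 * s) z -> z != a -> cdiff k z.
  move=> zi za.
  have D : cdiff (fun z => f z / f a / (z - a) - (z - a)^-1) z.
    have D1 := cdiff_inv_sub za.
    apply: cdiffB => //; apply: cdiffM => //; apply: cdiffM; first exact: df.
    exact: cdiff_cst.
  apply: (cdiff_eq D); exists (abs (z - a)); first by rewrite abs_gt0 subr_eq0.
  by move=> w wz; rewrite kE //; apply: contraTneq wz => ->; rewrite absC ltxx.
have kc z : in_square (Re a - s) (Im a - s) (2 * s) z -> ccont k z.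
  move=> zi; have [->|za] := eqVneq z a; last by apply: cdiff_cont; exact: kd.
  by apply: ccontM => //; exact: ccont_cst.
have J0 := goursat_center s0 kc kd.
have bn z : on_boundary (Re a - s) (Im a - s) (2 * s) z -> z != a.
  move=> /(center_boundary s0)[h _]; apply: contraTneq h => ->.
  by rewrite subrr abs0 -ltNge.
rewrite (eq_jint s20 (fun z zb => kE z (bn z zb))) jintB // in J0; first last.
- by move=> z /bn; exact: ccont_inv_sub.
- move=> z zb; apply: ccontM; last by apply: ccont_inv_sub; exact: bn.
  by apply: ccontM; [apply: cdiff_cont; apply: df; case: zb|exact: ccont_cst].
have := jint_inv a s0; move/eqP: J0; rewrite subr_eq0 => /eqP <-.
have B : abs (jint (fun z => f z / f a / (z - a)) (Re a - s) (Im a - s) (2 * s)) <=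
    8 * (M / abs (f a) / s) * (2 * s).
  apply: jint_abs => // z zb.
    apply: ccontM; last by apply: ccont_inv_sub; exact: bn.
    by apply: ccontM; [apply: cdiff_cont; apply: df; case: zb|exact: ccont_cst].
  have [h1 h2] := center_boundary s0 zb.
  rewrite !abs_div; apply: ler_pM.
  - by rewrite divr_ge0 ?abs_ge0.
  - by rewrite invr_ge0 abs_ge0.
  - by rewrite ler_pdivrMr // divfK ?gt_eqF //; exact: fM.
  - by rewrite lef_pV2 // posrE; lra.
move=> h; have := le_trans h B.
have -> : 8 * (M / abs (f a) / s) * (2 * s) = 16 * M / abs (f a).
  by field; rewrite !gt_eqF.
by rewrite ler_pdivlMr //; lra.
Qed.

End Goursat.

(** * Removable singularities and divided differences *)

Section Removable.
Variable R : realType.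
Local Notation C := (R[i]).
Implicit Types (r s t M : R) (z w a : C) (f g : C -> C).

Lemma bernoulli (d : R) n : 0 <= d -> 1 + n%:R * d <= (1 + d) ^+ n.
Proof.
move=> d0; elim: n => [|n IH]; first by rewrite expr0 mul0r addr0.
rewrite exprS; apply: le_trans (ler_wpM2l _ IH); last by lra.
have : 0 <= n%:R * (d * d) by rewrite mulr_ge0 // mulr_ge0.
by rewrite -natr1; lra.
Qed.

(** If [M < x], the powers of [x / M] exceed [D / c]. This is how multiplicative constants are
    discarded: it improves the factor [4] of the Cauchy inequality to [1], and it turns bounds on
    iterates into bounds on multipliers. *)
Lemma le_of_powers (x M c D : R) : 0 <= x -> 0 <= M -> 0 < c ->
  (forall n, x ^+ n * c <= D * M ^+ n) -> x <= M.
Proof.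
move=> x0 M0 c0 H; rewrite leNgt; apply/negP => Mx.
have [M00|Mn0] := eqVneq M 0.
  have := H 1; rewrite M00 !expr1 mulr0 => h.
  have : 0 < x * c by rewrite mulr_gt0 //; lra.
  lra.
have Mp : 0 < M by rewrite lt_def Mn0.
pose d := x / M - 1.
have d0 : 0 < d by rewrite subr_gt0 ltr_pdivlMr // mul1r.
have xE : x = (1 + d) * M by rewrite /d; field.
pose n := (Num.truncn (D / c / d)).+1.
have nD : D / c / d < n%:R by exact: truncnS_gt.
have := H n; rewrite {1}xE exprMn mulrAC ler_pM2r ?exprn_gt0 // => h.
have b := bernoulli n (ltW d0).
have : (1 + n%:R * d) * c <= D by apply: le_trans h; rewrite ler_pM2r.
rewrite -ler_pdivlMr // => {}h.
by move: nD; rewrite ltr_pdivrMr //; lra.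
Qed.

Lemma center_square a s z : in_square (Re a - s) (Im a - s) (2 * s) z -> abs (z - a) <= 2 * s.
Proof.
move=> [z1 z2 z3 z4]; have h3 := abs_leReIm (z - a); rewrite ReB ImB in h3.
have h1 : `|Re z - Re a| <= s by rewrite ler_norml; lra.
have h2 : `|Im z - Im a| <= s by rewrite ler_norml; lra.
by lra.
Qed.

Lemma cdiff_mulX f z : ccont f z -> cdiff (fun w => (w - z) * f w) z.
Proof.
by move=> cf; exists (f z); exists f; split => // w; rewrite subrr mul0r add0r mulrC.
Qed.

Lemma cdiff_prod (E : seq C) z : cdiff (fun w => \prod_(e <- E) (w - e)) z.
Proof.
elim: E => [|e E IH].
  by apply: (cdiff_eq (cdiff_cst 1 z)); exists 1 => // w _; rewrite big_nil.
have D : cdiff (fun w => (w - e) * \prod_(e <- E) (w - e)) z.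
  by apply: cdiffM => //; exact: cdiff_sub.
by apply: (cdiff_eq D); exists 1 => // w _; rewrite big_cons.
Qed.

(* Exceptional points are removed by applying Cauchy's estimate to
   [f ^ n * \prod_e (z - e)] and letting [n] tend to infinity. *)
Lemma annulus_bound f a s M (E : seq C) : 0 < s ->
  (forall z, abs (z - a) <= 2 * s -> ccont f z) ->
  (forall z, abs (z - a) <= 2 * s -> z \notin E -> cdiff f z) ->
  a \notin E ->
  (forall z, s <= abs (z - a) -> abs (z - a) <= 2 * s -> abs (f z) <= M) ->
  abs (f a) <= M.
Proof.
move=> s0 cf df aE fM.
have M0 : 0 <= M.
  have as_ : abs (a + s%:C - a) = s by rewrite addrC addKr abs_real gtr0_norm.
  by apply: le_trans (fM (a + s%:C) _ _); rewrite ?abs_ge0 // as_; lra.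
pose c := \prod_(e <- E) abs (a - e).
pose D := \prod_(e <- E) (2 * s + abs (a - e)).
have c0 : 0 < c.
  rewrite /c; elim: (E) aE => [|e E' IH]; first by rewrite big_nil.
  rewrite inE negb_or big_cons => /andP[ae /IH]; apply: mulr_gt0.
  by rewrite abs_gt0 subr_eq0.
apply: (@le_of_powers _ M c (4 * D)) => // [|n]; first exact: abs_ge0.
pose g w := f w ^+ n * \prod_(e <- E) (w - e).
have gE z : abs (g z) = abs (f z) ^+ n * \prod_(e <- E) abs (z - e).
  by rewrite /g absM absX abs_prod.
have -> : 4 * D * M ^+ n = 4 * (M ^+ n * D) by ring.
have -> : abs (f a) ^+ n * c = abs (g a) by rewrite gE.
apply: (@cauchy_square _ _ _ s) => //.
  move=> z /center_square zs; have [zE|zE] := boolP (z \in E); last first.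
    by apply: cdiffM; [apply: cdiffX; exact: df|exact: cdiff_prod].
  (* At an exceptional point only the continuity of [f] is known, but the factor [w - z] makes the
     product differentiable there. *)
  have Dz : cdiff (fun w => (w - z) * (f w ^+ n * \prod_(e <- rem z E) (w - e))) z.
    apply: cdiff_mulX; apply: ccontM; first by apply: ccontX; exact: cf.
    by apply: cdiff_cont; exact: cdiff_prod.
  apply: (cdiff_eq Dz); exists 1 => // w _; rewrite /g.
  by rewrite (perm_big _ (perm_to_rem zE)) big_cons mulrCA.
move=> z /(center_boundary s0)[h1 h2]; rewrite gE; apply: ler_pM.
- by rewrite exprn_ge0 // abs_ge0.
- by apply: prodr_ge0 => e _; exact: abs_ge0.
- by apply: lerXn2r; rewrite ?nnegrE ?abs_ge0 //; exact: fM.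
- apply: ler_prod => e _; rewrite abs_ge0 /=.
  by apply: (le_trans (abs_dist a z e)); rewrite lerD2r.
Qed.

Lemma isolated (E : seq C) a : exists2 r : R, 0 < r &
  forall z, 0 < abs (z - a) -> abs (z - a) < r -> z \notin E.
Proof.
elim: E => [|e E [r r0 Hr]]; first by exists 1.
have [->|ea] := eqVneq e a.
  exists r => // z z0 zr; rewrite inE negb_or Hr // andbT.
  by rewrite -subr_eq0 -abs_gt0.
exists (Num.min r (abs (e - a))); first by rewrite lt_min r0 abs_gt0 subr_eq0.
move=> z z0; rewrite lt_min => /andP[zr ze]; rewrite inE negb_or Hr // andbT.
by apply: contraTneq ze => ->; rewrite ltxx.
Qed.

Lemma abs_shift a (t : R) : 0 <= t -> abs (a + t%:C - a) = t.
Proof. by move=> t0; rewrite addrC addKr abs_real ger0_norm. Qed.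

Lemma close_point a r : 0 < r -> exists2 z, z != a & abs (z - a) < r.
Proof.
move=> r0; exists (a + (r / 2)%:C); last by rewrite abs_shift; lra.
by rewrite -subr_eq0 -abs_gt0 abs_shift; lra.
Qed.

Lemma cont_bound f a M : ccont f a ->
  (forall r : R, 0 < r -> exists2 z, abs (z - a) < r & abs (f z) <= M) -> abs (f a) <= M.
Proof.
move=> [cf] H; rewrite leNgt; apply/negP => fM.
have [r r0 Hr] := cf (abs (f a) - M) ltac:(lra).
have [z /Hr zr zM] := H r r0; have := abs_lesub (f a) (f z); rewrite absC in zr; lra.
Qed.

(** For [z] within [s] of [a], the annulus between the radii [2 * s] and [4 * s] around [z] lies in
    the one between [s] and [5 * s] around [a]; this is the origin of [5]. Exceptional points are
    reached by continuity. *)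
Lemma max_inside f a s M (E : seq C) : 0 < s ->
  (forall z, abs (z - a) <= 5 * s -> ccont f z) ->
  (forall z, abs (z - a) <= 5 * s -> z \notin E -> cdiff f z) ->
  (forall z, s <= abs (z - a) -> abs (z - a) <= 5 * s -> abs (f z) <= M) ->
  forall z, abs (z - a) <= 5 * s -> abs (f z) <= M.
Proof.
move=> s0 cf df fM.
have H z : abs (z - a) < s -> z \notin E -> abs (f z) <= M.
  move=> zs zE; apply: (@annulus_bound f z (2 * s) M E) => //; first by lra.
  - by move=> w wz; apply: cf; have := abs_dist z w a; lra.
  - by move=> w wz; apply: df; have := abs_dist z w a; lra.
  - move=> w w1 w2; apply: fM; last by have := abs_dist z w a; lra.
    by have := abs_dist a w z; rewrite (absC a z); lra.
move=> z z5; have [zs|zs] := leP s (abs (z - a)); first exact: fM.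
apply: cont_bound; first exact: cf.
move=> r r0; have [t t0 Ht] := isolated E z.
have m0 : 0 < Num.min (Num.min r t) (s - abs (z - a)) by rewrite !lt_min r0 t0 /=; lra.
have [w wz] := close_point z m0; rewrite !lt_min => /andP[/andP[wr wt] ws].
exists w => //; apply: H; last by apply: Ht => //; rewrite abs_gt0 subr_eq0.
by have := abs_dist z w a; lra.
Qed.

(* Completeness of the plane: [L] is read off the nested intervals with centres
   [Re (q x)], [Im (q x)] and radius [d x]. *)
Lemma near_limit (T : Type) (q : T -> C) (d : T -> R) (x0 : T) :
  (forall x y, abs (q x - q y) <= d x + d y) -> exists L, forall x, abs (q x - L) <= 2 * d x.
Proof.
move=> H.
have lim (p : T -> R) : (forall x y, `|p x - p y| <= d x + d y) -> exists L, forall x, `|p x - L| <= d x.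
  move=> Hp; pose S := [set p x + d x | x in setT].
  have lb y : lbound S (p y - d y).
    move=> _ [x _ <-]; have := Hp x y; rewrite ler_norml; lra.
  have hi : has_inf S by split; [exists (p x0 + d x0); exists x0|exists (p x0 - d x0)].
  exists (inf S) => x; rewrite ler_norml.
  have h1 : inf S <= p x + d x by apply: ge_inf; [case: hi|exists x].
  have h2 : p x - d x <= inf S by apply: lb_le_inf; [case: hi|exact: lb].
  lra.
have [|a Ha] := lim (fun x => Re (q x)).
  by move=> x y; apply: le_trans (H x y); rewrite -ReB; exact: abs_Re.
have [|b Hb] := lim (fun x => Im (q x)).
  by move=> x y; apply: le_trans (H x y); rewrite -ImB; exact: abs_Im.
exists (a +i* b) => x; apply: (le_trans (abs_leReIm _)); rewrite ReB ImB /=.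
by have := Ha x; have := Hb x; lra.
Qed.

(** The Lipschitz bound makes the quotients at [a] a Cauchy family indexed by the punctured disc,
    with error [K * abs (w - a)]; [near_limit] then supplies the derivative. *)
Lemma cdiff_of_quotients f a r K : 0 < r -> 0 <= K ->
  (forall w w', 0 < abs (w - a) < r -> 0 < abs (w' - a) < r -> w != w' ->
     abs ((f w - f a) / (w - a) - (f w' - f a) / (w' - a)) <= K * abs (w - w')) ->
  cdiff f a.
Proof.
move=> r0 K0 H.
pose T := {w : C | 0 < abs (w - a) < r}.
pose mk w (h : 0 < abs (w - a) < r) : T := exist _ w h.
have r2 : 0 < abs (a + (r / 2)%:C - a) < r by rewrite abs_shift; lra.
have [|L HL] := @near_limit T (fun w : T => (f (sval w) - f a) / (sval w - a))
    (fun w : T => K * abs (sval w - a)) (mk _ r2).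
  move=> [w hw] [w' hw'] /=.
  have [->|ww] := eqVneq w w'.
    by rewrite subrr abs0 addr_ge0 // mulr_ge0 // abs_ge0.
  apply: (le_trans (H _ _ hw hw' ww)); rewrite -mulrDr; apply: ler_wpM2l => //.
  by apply: (le_trans (abs_dist a w w')); rewrite [abs (a - w')]absC.
exists L; exists (fun w => if w == a then L else (f w - f a) / (w - a)); split.
- apply/ccontP => e e0; rewrite eqxx.
  exists (Num.min r (e / (2 * K + 1))); first by rewrite lt_min r0 divr_gt0 //; lra.
  move=> w; rewrite lt_min => /andP[wr we]; case: eqP => [_|/eqP wa].
    by rewrite subrr abs0.
  have hw : 0 < abs (w - a) < r by rewrite abs_gt0 subr_eq0 wa.
  apply: (le_lt_trans (HL (mk w hw))) => /=.
  move: we; rewrite ltr_pdivlMr; last by lra.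
  by have := abs_ge0 (w - a); lra.
- by rewrite eqxx.
- move=> w; case: eqP => [->|/eqP wa]; first by rewrite subrr mulr0 addr0.
  by rewrite divfK ?subr_eq0// addrC subrK.
Qed.

(** The slope [q] at [w] is a function of the same kind as [f], with [w] as one more exceptional
    point, so the lemma can be iterated. At distance at least [2 * r] from [a] the denominator is at
    least [r], and the maximum principle carries the bound inside. *)
Lemma quotient_bound f q a w r M (E : seq C) : 0 < r ->
  (forall z, abs (z - a) <= 10 * r -> ccont f z) ->
  (forall z, abs (z - a) <= 10 * r -> z \notin E -> cdiff f z) ->
  (forall z, abs (z - a) <= 10 * r -> abs (f z) <= M) ->
  abs (w - a) < r -> ccont q w -> (forall z, f z = f w + q z * (z - w)) ->
  [/\ forall z, abs (z - a) <= 10 * r -> ccont q z,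
      forall z, abs (z - a) <= 10 * r -> z \notin w :: E -> cdiff q z &
      forall z, abs (z - a) <= 10 * r -> abs (q z) <= 2 * M / r].
Proof.
move=> r0 cf df fM wr cq fE.
have qE z : z != w -> (f z - f w) / (z - w) = q z.
  by move=> zw; rewrite (fE z) addrC addKr mulfK // subr_eq0.
have near z : z != w -> exists2 t : R, 0 < t &
    forall u, abs (u - z) < t -> (f u - f w) / (u - w) = q u.
  move=> zw; exists (abs (z - w)); first by rewrite abs_gt0 subr_eq0.
  by move=> u uz; apply: qE; apply: contraTneq uz => ->; rewrite absC ltxx.
have qc z : abs (z - a) <= 10 * r -> ccont q z.
  move=> zr; have [->//|zw] := eqVneq z w.
  exact: ccont_eq (ccont_quotient (f w) zw (cf z zr)) (near z zw).
have qd z : abs (z - a) <= 10 * r -> z \notin w :: E -> cdiff q z.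
  move=> zr; rewrite inE negb_or => /andP[zw zE].
  exact: cdiff_eq (cdiff_quotient (f w) zw (df z zr zE)) (near z zw).
split=> // z zr.
have E10 : 10 * r = 5 * (2 * r) by ring.
apply: (@max_inside q a (2 * r) _ (w :: E)); rewrite -?E10 //; first by lra.
move=> u u1 u2.
have uw : r <= abs (u - w) by have := abs_dist w u a; lra.
have uw0 : u != w by rewrite -subr_eq0 -abs_gt0; lra.
rewrite -qE // abs_div; apply: ler_pM; rewrite ?invr_ge0 ?abs_ge0 //.
  apply: (le_trans (abs_suble _ _)).
  have := fM u u2; have := fM w ltac:(lra); lra.
by rewrite lef_pV2 // posrE; lra.
Qed.

Lemma quotient_const_ge0 M r : 0 <= M -> 0 < r -> 0 <= 2 * (2 * M / r) / r.
Proof.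
move=> M0 r0; apply: divr_ge0; last exact: ltW.
by apply: mulr_ge0 => //; apply: divr_ge0; lra.
Qed.

(** Slopes are taken at points [w] and [w'] other than [a], and only evaluated at [a]. The second
    divided difference [T a] measures the variation of the quotients at [a]; two applications of
    [quotient_bound] bound it by [K]. *)
Lemma removable f a R0 : 0 < R0 -> (forall z, abs (z - a) < R0 -> ccont f z) ->
  (forall z, abs (z - a) < R0 -> z != a -> cdiff f z) -> cdiff f a.
Proof.
move=> R00 cf df.
have [ca] : ccont f a by apply: cf; rewrite subrr abs0.
have [t t0 Ht] := ca 1 ltac:(lra).
pose M := abs (f a) + 1.
have M0 : 0 <= M by rewrite /M; have := abs_ge0 (f a); lra.
pose r := Num.min R0 t / 20.
have m0 : 0 < Num.min R0 t by rewrite lt_min R00.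
have r0 : 0 < r by rewrite /r; lra.
have [r1 r2] : 10 * r < R0 /\ 10 * r < t.
  have : 10 * r < Num.min R0 t by rewrite /r; lra.
  by rewrite lt_min => /andP.
have fM z : abs (z - a) <= 10 * r -> abs (f z) <= M.
  move=> zr; have := Ht z ltac:(lra); have := abs_lesub (f z) (f a); rewrite /M; lra.
have cf' z : abs (z - a) <= 10 * r -> ccont f z by move=> zr; apply: cf; lra.
have df' z : abs (z - a) <= 10 * r -> z \notin [:: a] -> cdiff f z.
  by rewrite inE => zr za; apply: df => //; lra.
pose K := 2 * (2 * M / r) / r.
have K0 : 0 <= K by apply: quotient_const_ge0.
apply: (@cdiff_of_quotients f a r K) => // w w' /andP[w0 wr] /andP[w'0 w'r] ww.
have wa : w != a by rewrite -subr_eq0 -abs_gt0.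
have wa' : w' != a by rewrite -subr_eq0 -abs_gt0.
have [d [q [cq _ fE]]] : cdiff f w by apply: df => //; lra.
have [qc qd qM] := quotient_bound r0 cf' df' fM wr cq fE.
have [d' [T [cT _ qE]]] : cdiff q w'.
  apply: qd; first by lra.
  by rewrite !inE negb_or wa' andbT eq_sym.
have [Tc Td TM] := quotient_bound r0 qc qd qM w'r cT qE.
have Ta := TM a ltac:(rewrite subrr abs0; lra).
have -> : (f w - f a) / (w - a) - (f w' - f a) / (w' - a) = T a * (w - w').
  have := fE a; have := fE w'; rewrite (qE a) => h1 h2.
  rewrite h2 h1.
  have e : f a = f w + (q w' + T a * (a - w')) * (a - w) := h2.
  field; rewrite !subr_eq0 wa wa' //.
by rewrite absM; apply: ler_wpM2r => //; exact: abs_ge0.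
Qed.

End Removable.

Section DividedDifferences.
Variable R : realType.
Local Notation C := (R[i]).
Implicit Types (r s t M : R) (x y z w a : C) (f g : C -> C) (U : set C).

Definition disc a r : set C := [set z | abs (z - a) < r].
Definition copen U : Prop := forall z, U z -> exists2 r : R, 0 < r & disc z r `<=` U.
Definition holo U f : Prop := forall z, U z -> cdiff f z.
Definition der f z : C := xget 0 [set d | cderiv f z d].
(** The divided difference, completed by the derivative on the diagonal. It is symmetric in [y] and
    [z], and one bound on it controls derivatives and secants alike. *)
Definition dq f y z : C := if z == y then der f y else (f z - f y) / (z - y).

Lemma disc_open a r : copen (disc a r).
Proof.
move=> z zr; exists (r - abs (z - a)); first by rewrite subr_gt0.
by move=> w wz; have := abs_dist z w a; rewrite /disc /= in zr wz *; lra.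
Qed.

Lemma disc_center a r : 0 < r -> disc a r a. Proof. by rewrite /disc /= subrr abs0. Qed.

Lemma derP f z : cdiff f z -> cderiv f z (der f z).
Proof. by move=> [d fd]; rewrite /der; case: xgetP => [e -> //|/(_ d)]. Qed.

Lemma der_eq f z d : cderiv f z d -> der f z = d.
Proof. by move=> fd; apply: (cderiv_uniq _ fd); apply: derP; exists d. Qed.

Lemma dqE f y z : f z - f y = dq f y z * (z - y).
Proof.
by rewrite /dq; case: eqP => [->|/eqP zy]; rewrite ?subrr ?mulr0 // divfK // subr_eq0.
Qed.

Lemma dqC f y z : dq f y z = dq f z y.
Proof.
rewrite /dq [y == z]eq_sym; case: eqP => [->//|_].
by rewrite -(opprB y z) -(opprB (f y)) invrN mulrNN.
Qed.

Lemma dq_diag f y : dq f y y = der f y. Proof. by rewrite /dq eqxx. Qed.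

Lemma dq_cont f y : cdiff f y -> ccont (dq f y) y.
Proof.
move=> /derP[q [cq qy fE]]; apply: (ccont_eq cq); exists 1 => // w _.
rewrite /dq; case: eqP => [->//|/eqP wy].
by rewrite (fE w) addrC addKr mulfK // subr_eq0.
Qed.

Lemma dq_cdiff f y z : z != y -> cdiff f z -> cdiff (dq f y) z.
Proof.
move=> zy fz; apply: (cdiff_eq (cdiff_quotient (f y) zy fz)); exists (abs (z - y)); first by rewrite abs_gt0 subr_eq0.
move=> u uz; rewrite /dq; case: eqP => // uy; move: uz.
by rewrite uy absC ltxx.
Qed.

Lemma dq_holo U f y : copen U -> holo U f -> U y -> holo U (dq f y).
Proof.
move=> oU fU Uy z Uz; have [->|zy] := eqVneq z y; last exact: dq_cdiff (fU z Uz).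
have [r r0 rU] := oU y Uy; apply: (removable r0) => u ur.
  have [->|uy] := eqVneq u y; first exact: dq_cont (fU y Uy).
  by apply: cdiff_cont; apply: dq_cdiff => //; apply: fU; apply: rU.
by move=> uy; apply: dq_cdiff => //; apply: fU; apply: rU.
Qed.

(** At distance [2 * r] or more from [a] the quotient is estimated directly; [12 * r <= R0] leaves
    room for the closed disc of radius [10 * r] that [max_inside] needs. *)
Lemma dq_bound f a R0 r M y z : 0 < r -> 12 * r <= R0 -> holo (disc a R0) f ->
  (forall z, disc a R0 z -> abs (f z) <= M) -> disc a r y -> disc a R0 z ->
  abs (dq f y z) <= 2 * M / r.
Proof.
move=> r0 rR fh fM yr zR.
have yR : disc a R0 y by rewrite /disc /= in yr *; lra.
have H u : disc a R0 u -> 2 * r <= abs (u - a) -> abs (dq f y u) <= 2 * M / r.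
  move=> uR ur; rewrite /disc /= in yr *.
  have uw : r <= abs (u - y) by have := abs_dist y u a; lra.
  have uy : u != y by rewrite -subr_eq0 -abs_gt0; lra.
  rewrite /dq (negPf uy) abs_div; apply: ler_pM; rewrite ?invr_ge0 ?abs_ge0 //.
    by apply: (le_trans (abs_suble _ _)); have := fM u uR; have := fM y yR; lra.
  by rewrite lef_pV2 // posrE; lra.
have [zr|zr] := leP (2 * r) (abs (z - a)); first exact: H.
have dh := dq_holo (@disc_open a R0) fh yR.
apply: (@max_inside _ _ a (2 * r) _ [::]); first by lra.
- by move=> u u5; apply: cdiff_cont; apply: dh; rewrite /disc /=; lra.
- by move=> u u5 _; apply: dh; rewrite /disc /=; lra.
- by move=> u u1 u5; apply: H => //; rewrite /disc /=; lra.
- by lra.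
Qed.

Lemma cauchy_lip f a R0 r M y z : 0 < r -> 12 * r <= R0 -> holo (disc a R0) f ->
  (forall z, disc a R0 z -> abs (f z) <= M) -> disc a r y -> disc a R0 z ->
  abs (f z - f y) <= 2 * M / r * abs (z - y).
Proof.
move=> r0 rR fh fM yr zR; rewrite dqE absM; apply: ler_wpM2r; first exact: abs_ge0.
exact: dq_bound fM yr zR.
Qed.

Lemma dq_lip f a R0 r M x y z : 0 < r -> 12 * r <= R0 -> holo (disc a R0) f ->
  (forall z, disc a R0 z -> abs (f z) <= M) -> disc a r y -> disc a r x -> disc a R0 z ->
  abs (dq f y z - dq f y x) <= 2 * (2 * M / r) / r * abs (z - x).
Proof.
move=> r0 rR fh fM yr xr zR; have yR : disc a R0 y by rewrite /disc /= in yr *; lra.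
apply: (cauchy_lip r0 rR _ _ xr zR); first by apply: dq_holo => //; exact: disc_open.
by move=> u uR; exact: (dq_bound r0 rR fh fM yr uR).
Qed.

(** Pointwise convergence is enough: the quotients at [c] of the uniformly bounded [F n] satisfy a
    Lipschitz bound independent of [n], which survives in the limit. *)
Lemma holo_limit (F : nat -> C -> C) f a r M : 0 < r ->
  (forall n, holo (disc a r) (F n)) ->
  (forall n z, disc a r z -> abs (F n z) <= M) ->
  (forall z, disc a r z -> forall e : R, 0 < e ->
     exists N, forall n, (N <= n)%N -> abs (F n z - f z) < e) ->
  holo (disc a r) f.
Proof.
move=> r0 Fh FM Ff c cr.
have [t t0 ct] := disc_open cr.
pose s := t / 12; have s0 : 0 < s by rewrite /s; lra.
have M0 : 0 <= M by apply: le_trans (FM 0 a (disc_center a r0)); exact: abs_ge0.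
pose K := 2 * (2 * M / s) / s.
have K0 : 0 <= K by apply: quotient_const_ge0.
apply: (@cdiff_of_quotients _ f c s K) => // w w' /andP[w0 ws] /andP[w'0 w's] _.
apply/ler_addgt0Pr => e e0.
have wt : disc c t w by rewrite /disc /= /s in ws *; lra.
have wt' : disc c t w' by rewrite /disc /= /s in w's *; lra.
have m0 : 0 < Num.min (abs (w - c)) (abs (w' - c)) by rewrite lt_min w0.
(* Errors of size [d] in two values of the function change a quotient by at most [e / 2] after
   division by [abs (w - c)] or [abs (w' - c)]. *)
pose d := e / 4 * Num.min (abs (w - c)) (abs (w' - c)).
have d0 : 0 < d by rewrite mulr_gt0 //; lra.
have [N1 H1] := Ff w (ct _ wt) d d0.
have [N2 H2] := Ff w' (ct _ wt') d d0.
have [N3 H3] := Ff c cr d d0.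
pose n := maxn N1 (maxn N2 N3).
have {H1} h1 := H1 n (leq_maxl _ _).
have {H2} h2 := H2 n (leq_trans (leq_maxl _ _) (leq_maxr _ _)).
have {H3} h3 := H3 n (leq_trans (leq_maxr _ _) (leq_maxr _ _)).
have close u : 0 < abs (u - c) -> d <= e / 4 * abs (u - c) -> abs (F n u - f u) < d ->
    abs ((f u - f c) / (u - c) - dq (F n) c u) <= e / 2.
  move=> u0 de hu; have uc : u != c by rewrite -subr_eq0 -abs_gt0.
  have -> : (f u - f c) / (u - c) - dq (F n) c u = ((f u - F n u) + (F n c - f c)) / (u - c).
    by rewrite /dq (negPf uc) -mulrBl; congr (_ / _); ring.
  rewrite abs_div ler_pdivrMr //; apply: (le_trans (abs_addle _ _)).
  by rewrite [abs (f u - _)]absC; lra.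
have k1 : d <= e / 4 * abs (w - c).
  by apply: ler_wpM2l; [lra|rewrite ge_min lexx].
have k2 : d <= e / 4 * abs (w' - c).
  by apply: ler_wpM2l; [lra|rewrite ge_min lexx orbT].
have {}h1 := close w w0 k1 h1; have {}h2 := close w' w'0 k2 h2.
have L : abs (dq (F n) c w - dq (F n) c w') <= K * abs (w - w').
  apply: (@dq_lip _ c t) => //; first by rewrite /s; lra.
  - by move=> z zt; apply: Fh; apply: ct.
  - by move=> z zt; apply: FM; apply: ct.
  - exact: disc_center.
have := abs_dist (dq (F n) c w) ((f w - f c) / (w - c)) ((f w' - f c) / (w' - c)).
have := abs_dist (dq (F n) c w') (dq (F n) c w) ((f w' - f c) / (w' - c)).
by rewrite [abs (dq (F n) c w' - _)]absC; lra.
Qed.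

End DividedDifferences.

(** * Local inverses and zeros *)

Section Roots.
Variable R : realType.
Local Notation C := (R[i]).

Lemma unity_roots l : (0 < l)%N ->
  exists s : seq C, [/\ uniq s, size s = l & forall z, (z \in s) = (z ^+ l == 1)].
Proof.
move=> l0; have [s sE] := closed_field_poly_normal ('X^l - 1 : {poly C}).
have lc : lead_coef ('X^l - 1 : {poly C}) = 1 by rewrite -polyC1 lead_coefXnsubC.
rewrite lc scale1r in sE; exists s; split.
- rewrite -separable_prod_XsubC -sE separable_Xn_sub_1 // pnatr_eq0.
  by rewrite -lt0n.
- by apply: succn_inj; rewrite -(size_prod_XsubC s id) -sE -polyC1 size_XnsubC.
- by move=> z; rewrite -root_prod_XsubC -sE rootE !hornerE subr_eq0.
Qed.

Lemma nth_roots l (lam : C) : (0 < l)%N -> lam != 0 ->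
  exists s : seq C, [/\ uniq s, size s = l & forall z, (z \in s) = (z ^+ l == lam)].
Proof.
move=> l0 lam0; have [s [us ss sP]] := unity_roots l0.
have [c cl] : exists c : C, c ^+ l = lam by exists (l.-root lam); exact: rootCK.
have c0 : c != 0 by apply: contraNneq lam0 => c0; rewrite -cl c0 expr0n gtn_eqF.
exists [seq c * z | z <- s]; split; first by rewrite map_inj_uniq //; apply: mulfI.
  by rewrite size_map.
move=> z; have -> : z = c * (z / c) by rewrite mulrC divfK.
rewrite mem_map; last exact: mulfI.
rewrite sP [in RHS]exprMn cl; apply/eqP/eqP => [->|h]; first by rewrite mulr1.
by apply: (mulfI lam0); rewrite h mulr1.
Qed.
End Roots.

Section LocalInverse.
Variable R : realType.
Local Notation C := (R[i]).
Implicit Types (r s t M : R) (x y z w a p : C) (f g h : C -> C) (U K : set C).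

(** On a compact set without fixed points [abs (T z - z)] has a positive lower bound. Approximate
    fixed points come from orbits, so no limit of an orbit has to be constructed. *)
Lemma fixed_point (K : set C) (T : C -> C) : cbounded K -> cclosed K ->
  (forall z, K z -> forall e : R, 0 < e -> exists2 r : R, 0 < r &
     forall w, K w -> abs (w - z) < r -> abs (T w - T z) < e) ->
  (forall e : R, 0 < e -> exists2 z, K z & abs (T z - z) < e) ->
  exists2 z, K z & T z = z.
Proof.
move=> Kb Kc Tc Te; apply: contrapT => nfix.
have [||c c0 Hc] := @uniform_bound R K (fun z c => c <= abs (T z - z)) Kb Kc.
- by move=> z c c' h _ cc; apply: le_trans cc h.
- move=> z Kz; have Tz : 0 < abs (T z - z).
    by rewrite abs_gt0 subr_eq0; apply/eqP => Tz; apply: nfix; exists z.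
  exists (abs (T z - z) / 2); first by lra.
  have [r r0 Hr] := Tc z Kz (abs (T z - z) / 4) ltac:(lra).
  exists (Num.min r (abs (T z - z) / 4)); first by rewrite lt_min r0; lra.
  move=> w Kw; rewrite lt_min => /andP[/(Hr w Kw) h1 h2].
  have := abs_dist (T w) (T z) z; have := abs_dist w (T w) z.
  by rewrite [abs (T z - T w)]absC; lra.
have [z Kz] := Te c c0; rewrite ltNge Hc //.
Qed.

Lemma closed_disc a r : cclosed [set z | abs (z - a) <= r].
Proof.
move=> z /= /negP; rewrite -ltNge => zr; exists (abs (z - a) - r); first by lra.
by move=> w wz /= wr; have := abs_dist w z a; rewrite [abs (z - w)]absC; lra.
Qed.

Lemma bounded_disc a r : cbounded [set z | abs (z - a) <= r].
Proof.
exists (r + abs a) => z /= zr; have := abs_addle (z - a) a; rewrite subrK; lra.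
Qed.

Lemma contraction_fixed (T : C -> C) a r : 0 <= r ->
  (forall z, abs (z - a) <= r -> abs (T z - a) <= r) ->
  (forall z w, abs (z - a) <= r -> abs (w - a) <= r -> abs (T z - T w) <= abs (z - w) / 2) ->
  exists2 z, abs (z - a) <= r & T z = z.
Proof.
move=> r0 TK Tc.
have := @fixed_point [set z | abs (z - a) <= r] T (bounded_disc a r) (@closed_disc a r).
apply.
- move=> z /= zr e e0; exists e => // w wr we.
  by apply: (le_lt_trans (Tc _ _ wr zr)); have := abs_ge0 (w - z); lra.
- move=> e e0; pose x n := iter n T a.
  have xr n : abs (x n - a) <= r by elim: n => [|n IH]; [rewrite subrr abs0|exact: TK].
  have xd n : abs (x n.+1 - x n) <= abs (T a - a) / 2 ^+ n.
    elim: n => [|n IH]; first by rewrite expr0 divr1.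
    apply: (le_trans (Tc _ _ (xr n.+1) (xr n))).
    have -> : abs (T a - a) / 2 ^+ n.+1 = abs (T a - a) / 2 ^+ n / 2.
      by rewrite exprS; field; rewrite expf_neq0 // pnatr_eq0.
    by rewrite ler_pM2r // invr_gt0.
  have [n Hn] := small_pow2 (abs (T a - a)) e0.
  by exists (x n); [exact: xr|exact: le_lt_trans (xd n) Hn].
Qed.

Lemma locally_bounded f a R0 : 0 < R0 -> ccont f a -> exists t M,
  [/\ 0 < t, t <= R0, 0 <= M & forall z, disc a t z -> abs (f z) <= M].
Proof.
move=> R00 [ca]; have [t t0 Ht] := ca 1 ltac:(lra).
exists (Num.min R0 t), (abs (f a) + 1); split.
- by rewrite lt_min R00.
- by rewrite ge_min lexx.
- by have := abs_ge0 (f a); lra.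
- move=> z; rewrite /disc /= lt_min => /andP[_ /Ht].
  by have := abs_lesub (f z) (f a); lra.
Qed.

Lemma disc_sub a r s : r <= s -> disc a r `<=` disc a s.
Proof. by move=> rs z; rewrite /disc /=; lra. Qed.

Lemma holo_sub (U V : set C) f : V `<=` U -> holo U f -> holo V f.
Proof. by move=> VU fU z /VU/fU. Qed.

Lemma dq_lip_center f a R0 : 0 < R0 -> holo (disc a R0) f ->
  exists r K : R, [/\ 0 < r, r <= R0, 0 <= K & forall x y, disc a r x -> disc a r y ->
     abs (dq f y x - der f a) <= K * (abs (x - a) + abs (y - a))].
Proof.
move=> R00 fh.
have [t [M [t0 tR M0 fM]]] := locally_bounded R00 (cdiff_cont (fh a (disc_center a R00))).
pose s := t / 12; have s0 : 0 < s by rewrite /s; lra.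
pose K := 2 * (2 * M / s) / s.
have K0 : 0 <= K by apply: quotient_const_ge0.
have fht : holo (disc a t) f by apply: holo_sub fh; exact: disc_sub.
have s12 : 12 * s <= t by rewrite /s; lra.
exists s, K; split => //; first by lra.
move=> x y xs ys.
have as_ : disc a s a := disc_center a s0.
have at_ : disc a t a := disc_center a t0.
have xt : disc a t x by rewrite /disc /= in xs *; lra.
have yt : disc a t y by rewrite /disc /= in ys *; lra.
have h1 : abs (dq f y x - dq f y a) <= K * abs (x - a).
  exact: (dq_lip s0 s12 fht fM).
have h2 : abs (dq f a y - dq f a a) <= K * abs (y - a).
  exact: (dq_lip s0 s12 fht fM).
rewrite -dq_diag; have h3 := abs_dist (dq f y a) (dq f y x) (dq f a a).
by rewrite [dq f a y]dqC in h2; lra.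
Qed.

Lemma dq_close f a R0 e : 0 < R0 -> 0 < e -> holo (disc a R0) f ->
  exists r : R, [/\ 0 < r, r <= R0 & forall x y, disc a r x -> disc a r y ->
     abs (dq f y x - der f a) <= e].
Proof.
move=> R00 e0 fh; have [s [K [s0 sR K0 H]]] := dq_lip_center R00 fh.
have K1 : 0 < 2 * K + 1 by lra.
exists (Num.min s (e / (2 * K + 1))); split.
- by rewrite lt_min s0 divr_gt0.
- by rewrite ge_min sR.
move=> x y; rewrite /disc /= !lt_min => /andP[xs xe] /andP[ys ye].
rewrite ltr_pdivlMr // in xe; rewrite ltr_pdivlMr // in ye.
apply: (le_trans (H x y xs ys)).
by have := abs_ge0 (x - a); have := abs_ge0 (y - a); lra.
Qed.

(** Where [dq f] stays within [abs d / 2] of [d], [f] expands distances by at least [abs d / 2],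
    hence is injective, and [x - (f x - w) / d] contracts by [1 / 2]; its fixed point solves
    [f x = w]. The slope of [h] is the reciprocal of a divided difference of [f]. *)
Lemma local_inverse f a R0 : 0 < R0 -> holo (disc a R0) f -> der f a != 0 ->
  exists r rho h, [/\ 0 < r, r <= R0, 0 < rho,
    forall x y, disc a r x -> disc a r y -> f x = f y -> x = y &
    forall w, disc (f a) rho w ->
      [/\ disc a r (h w), f (h w) = w, der f (h w) != 0 & cderiv h w (der f (h w))^-1]].
Proof.
move=> R00 fh d0; set d := der f a in d0.
have dp : 0 < abs d by rewrite abs_gt0.
have [r [r0 rR Hr]] := dq_close R00 (ltac:(lra) : 0 < abs d / 2) fh.
have dql x y : disc a r x -> disc a r y -> abs d / 2 <= abs (dq f y x).
  move=> xr yr; have := Hr x y xr yr; have := abs_lesub d (dq f y x).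
  by rewrite -/d absC; lra.
have expand x y : disc a r x -> disc a r y -> abs d / 2 * abs (x - y) <= abs (f x - f y).
  move=> xr yr; rewrite dqE absM; apply: ler_wpM2r; first exact: abs_ge0.
  exact: dql.
have inj x y : disc a r x -> disc a r y -> f x = f y -> x = y.
  move=> xr yr fxy; have := expand x y xr yr; rewrite fxy subrr abs0 => h.
  have [/eqP|] := eqVneq (x - y) 0; first by rewrite subr_eq0 => /eqP.
  by rewrite -abs_gt0 => xy; exfalso; have := mulr_gt0 (ltac:(lra) : 0 < abs d / 2) xy; lra.
(* Small enough that the Newton step at [a] has length at most [r / 4], so that the closed disc of
   radius [r / 2] is mapped into itself. *)
pose rho := abs d * r / 8.
have rho0 : 0 < rho by rewrite divr_gt0 // mulr_gt0.
have ex w : disc (f a) rho w -> exists x, disc a r x /\ f x = w.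
  move=> wr; pose T x := x - (f x - w) / d.
  have Tc z y : abs (z - a) <= r / 2 -> abs (y - a) <= r / 2 -> abs (T z - T y) <= abs (z - y) / 2.
    move=> zr yr.
    have -> : T z - T y = (z - y) * (d - dq f y z) / d.
      have h : f z = f y + dq f y z * (z - y) by rewrite -dqE addrC subrK.
      by rewrite /T h; field.
    rewrite abs_div absM -mulrA; apply: ler_wpM2l; first exact: abs_ge0.
    rewrite ler_pdivrMr // mulrC absC; apply: Hr; rewrite /disc /=; lra.
  have Ta : abs (T a - a) <= r / 4.
    rewrite /T addrC addKr absN abs_div ler_pdivrMr //.
    by rewrite /disc /= absC in wr; move: wr; rewrite /rho; have := mulr_gt0 dp r0; lra.
  have [||x xr Tx] := @contraction_fixed T a (r / 2) (ltac:(lra)).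
  - move=> z zr; have := Tc z a zr ltac:(rewrite subrr abs0; lra).
    have := abs_dist (T a) (T z) a; lra.
  - exact: Tc.
  - exists x; split; first by rewrite /disc /=; lra.
    move: Tx; rewrite /T => /eqP; rewrite -subr_eq0 addrC addKr oppr_eq0.
    by rewrite mulf_eq0 invr_eq0 (negPf d0) orbF subr_eq0 => /eqP.
pose h w := xget a [set x | disc a r x /\ f x = w].
have hP w : disc (f a) rho w -> disc a r (h w) /\ f (h w) = w.
  by move=> /ex[x xP]; rewrite /h; case: xgetP => [y -> //|/(_ x)].
exists r, rho, h; split => // w0 w0r; have [h0r fh0] := hP w0 w0r.
have dn : der f (h w0) != 0.
  by rewrite -abs_gt0 -dq_diag; have := dql _ _ h0r h0r; lra.
have [t t0 Ht] := disc_open w0r.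
have hc : ccont h w0.
  apply/ccontP => e e0; exists (Num.min t (e * (abs d / 2))).
    by rewrite lt_min t0 mulr_gt0 //; lra.
  move=> w; rewrite lt_min => /andP[/Ht wr we]; have [hr fhw] := hP w wr.
  have := expand _ _ hr h0r; rewrite fhw fh0 => k.
  by rewrite -(ltr_pM2r (ltac:(lra) : 0 < abs d / 2)); lra.
split => //.
have fd0 : cdiff f (h w0) by apply: fh; exact: disc_sub h0r.
have D : cderiv (fun w => h w0 + (dq f (h w0) (h w))^-1 * (w - w0)) w0 (der f (h w0))^-1.
  exists (fun w => (dq f (h w0) (h w))^-1); split.
  - apply: (@ccontV R (fun w => dq f (h w0) (h w))); first by rewrite dq_diag.
    by apply: ccont_comp => //; exact: dq_cont.
  - by rewrite dq_diag.
  - by move=> w; rewrite subrr mulr0 addr0.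
apply: (cderiv_eq D); exists t => // w /Ht wr; have [hr fhw] := hP w wr.
have dn' : dq f (h w0) (h w) != 0.
  by rewrite -abs_gt0; have := dql _ _ hr h0r; lra.
have -> : w - w0 = dq f (h w0) (h w) * (h w - h w0) by rewrite -dqE fhw fh0.
by rewrite mulKf // addrC subrK.
Qed.

(** Otherwise one could divide by [z - p] forever. By the maximum principle the cofactor of
    [(z - p) ^+ n] is at most [M / s ^+ n], so [abs (f z) <= M / 2 ^+ n] for all [n] on the disc of
    radius [s / 2]. *)
Lemma zero_order f p R0 : 0 < R0 -> holo (disc p R0) f ->
  ~ (exists2 r : R, 0 < r & forall z, disc p r z -> f z = 0) ->
  exists k h, [/\ holo (disc p R0) h, h p != 0 &
    forall z, disc p R0 z -> f z = (z - p) ^+ k * h z].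
Proof.
move=> R00 fh nz; apply: contrapT => nord; apply: nz.
have pR := disc_center p R00.
have H k : exists h, holo (disc p R0) h /\ forall z, disc p R0 z -> f z = (z - p) ^+ k * h z.
  elim: k => [|k [h [hh hE]]]; first by exists f; split => // z _; rewrite expr0 mul1r.
  have hp : h p = 0.
    by apply/eqP; apply: contrapT => /negP hp; apply: nord; exists k, h.
  exists (dq h p); split; first by apply: dq_holo => //; exact: disc_open.
  move=> z zR; rewrite hE //.
  have -> : h z = dq h p z * (z - p) by rewrite -dqE hp subr0.
  by rewrite exprS; ring.
have [t [M [t0 tR M0 fM]]] := locally_bounded R00 (cdiff_cont (fh p pR)).
pose s := t / 6; have s0 : 0 < s by rewrite /s; lra.
exists (s / 2); first by lra.
move=> z zs; apply: abs0P; apply: eps_eq0 => [|e e0]; first exact: abs_ge0.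
have [n Hn] := small_pow2 M e0; have [h [hh hE]] := H n.
have sub u : abs (u - p) <= 5 * s -> disc p R0 u by rewrite /disc /= /s; lra.
have hM : abs (h z) <= M / s ^+ n.
  apply: (@max_inside _ h p s _ [::]) => //.
  - by move=> u /sub uR; apply: cdiff_cont; exact: hh.
  - by move=> u /sub uR _; exact: hh.
  - move=> u u1 u5; rewrite ler_pdivlMr ?exprn_gt0 //.
    apply: (@le_trans _ _ (abs (h u) * abs (u - p) ^+ n)).
      apply: ler_wpM2l; first exact: abs_ge0.
      by apply: lerXn2r => //; rewrite nnegrE ?abs_ge0 // ltW.
    rewrite -absX -absM mulrC -hE; last exact: sub.
    by apply: fM; move: u5; rewrite /disc /= /s; lra.
  - by rewrite /disc /= in zs; lra.
apply: le_trans (ltW Hn); rewrite hE; last by apply: sub; rewrite /disc /= in zs; lra.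
rewrite absM absX; apply: (@le_trans _ _ ((s / 2) ^+ n * (M / s ^+ n))).
  apply: ler_pM => //; rewrite ?exprn_ge0 ?abs_ge0 //.
  by apply: lerXn2r; rewrite ?nnegrE ?abs_ge0 //; [lra|rewrite /disc /= in zs; lra].
rewrite expr_div_n le_eqVlt; apply/orP; left; apply/eqP; field.
by rewrite !expf_neq0 // ?pnatr_eq0 // gt_eqF.
Qed.

Lemma identity_theorem f p R0 : 0 < R0 -> holo (disc p R0) f ->
  (forall r : R, 0 < r -> exists z, 0 < abs (z - p) < r /\ f z = 0) ->
  exists2 r : R, 0 < r & forall z, disc p r z -> f z = 0.
Proof.
move=> R00 fh acc; apply: contrapT => nz.
have [k [h [hh hp fE]]] := zero_order R00 fh nz.
have [hc] := cdiff_cont (hh p (disc_center p R00)).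
have [r r0 Hr] := hc (abs (h p)) ltac:(by rewrite abs_gt0).
have [z [/andP[z0]]] := acc (Num.min r R0) ltac:(by rewrite lt_min r0).
rewrite lt_min => /andP[zr zR]; rewrite fE // => /eqP.
rewrite mulf_eq0 => /orP[|/eqP hz].
  by rewrite expf_eq0 => /andP[_]; rewrite -abs_eq0 gt_eqF.
by have := Hr z zr; rewrite hz sub0r absN ltxx.
Qed.

Lemma der_mul_root g p (k : nat) : cdiff g p -> (0 < k)%N ->
  der (fun z => (z - p) ^+ k * g z) p = if k == 1%N then g p else 0.
Proof.
move=> gd; case: k => // k _.
have D1 : cderiv (fun z => (z - p)) p 1.
  by have := cderivB (cderiv_id p) (cderiv_cst p p); rewrite subr0.
have [e De] : cdiff (fun z => (z - p) ^+ k * g z) p.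
  by apply: cdiffM => //; apply: cdiffX; exists 1.
have := cderivM D1 De; rewrite subrr mul0r addr0 mul1r => D.
have -> : (if k.+1 == 1%N then g p else 0) = 0 ^+ k * g p.
  by rewrite expr0n; case: k {De D} => [|k]; rewrite ?mul1r ?mul0r.
by apply: der_eq; apply: (cderiv_eq D); exists 1 => // w _; rewrite exprS mulrA.
Qed.

Lemma der_exp k (c : C) : cderiv (fun z => z ^+ k) c (c ^+ k.-1 *+ k).
Proof.
elim: k => [|k IH].
  rewrite mulr0n; apply: (cderiv_eq (cderiv_cst 1 c)).
  by exists 1 => // w _; rewrite expr0.
have := cderivM (cderiv_id c) IH => D.
have -> : c ^+ k.+1.-1 *+ k.+1 = 1 * c ^+ k + id c * (c ^+ k.-1 *+ k).
  rewrite /= mul1r mulrS; congr (_ + _); rewrite mulrnAr -exprS.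
  by case: k {IH D} => // k; rewrite mulr0n.
by apply: (cderiv_eq D); exists 1 => // w _; rewrite exprS.
Qed.

(** If the derivative vanished, [f - f p] would be [psi ^+ k] with [k >= 2] and [psi] locally
    invertible at [p]; then [f] takes equal values where [psi] equals [w] and [zeta * w], for a
    [k]-th root of unity [zeta] other than [1]. *)
Lemma injective_der f p R0 : 0 < R0 -> holo (disc p R0) f ->
  (forall x y, disc p R0 x -> disc p R0 y -> f x = f y -> x = y) -> der f p != 0.
Proof.
move=> R00 fh inj; have pR := disc_center p R00.
pose F z := f z - f p.
have Fh : holo (disc p R0) F.
  by move=> z zR; apply: cdiffB; [exact: fh|exact: cdiff_cst].
have [|k [h [hh hp FE]]] := zero_order R00 Fh.
  move=> [r r0 Hr]; have m0 : 0 < Num.min r R0 by rewrite lt_min r0.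
  have [u up] := close_point p m0; rewrite lt_min => /andP[ur uR].
  have /eqP : F u = 0 by exact: Hr.
  by rewrite subr_eq0 => /eqP/(inj _ _ uR pR)/eqP; rewrite (negPf up).
have k0 : (0 < k)%N.
  rewrite lt0n; apply: contraNneq hp => k0.
  by have := FE p pR; rewrite k0 expr0 mul1r /F subrr => <-.
have dF : der f p = if k == 1%N then h p else 0.
  rewrite -(der_mul_root (hh p pR) k0); apply/esym/der_eq.
  have := cderivB (derP (fh p pR)) (cderiv_cst (f p) p); rewrite subr0 => D.
  by apply: (cderiv_eq D); exists R0 => // w wR; rewrite -FE.
have [k1|k1] := eqVneq k 1%N; first by rewrite dF k1.
have k2 : (1 < k)%N by rewrite ltn_neqAle eq_sym k1.
exfalso.
(* A branch of the [k]-th root near [h p] is obtained as the local inverse [g] of the power map at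
   one root [c]. *)
have [c ck] : exists c : C, c ^+ k = h p by exists (k.-root (h p)); exact: rootCK.
have c0 : c != 0 by apply: contraNneq hp => c0; rewrite -ck c0 expr0n gtn_eqF.
have Pd : der (fun z => z ^+ k) c != 0.
  by rewrite (der_eq (der_exp k c)) mulrn_eq0 negb_or -lt0n k0 expf_neq0.
have Ph : holo (disc c 1) (fun z => z ^+ k) by move=> z _; apply: cdiffX; exact: cdiff_id.
have [r1 [rho [g [r10 _ rho0 _ gP]]]] := local_inverse ltr01 Ph Pd.
rewrite /= ck in gP.
have [hc] := cdiff_cont (hh p pR).
have [t t0 Ht] := hc rho rho0.
pose t' := Num.min t R0.
have t'0 : 0 < t' by rewrite lt_min t0.
have t't z : disc p t' z -> disc (h p) rho (h z) /\ disc p R0 z.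
  by rewrite /disc /= lt_min => /andP[/Ht].
pose psi z := (z - p) ^+ 1 * g (h z).
have ghd z : disc p t' z -> cdiff (fun z => g (h z)) z.
  move=> /t't[hz zR]; apply: cdiff_comp; first exact: hh.
  by have [_ _ _ gd] := gP _ hz; exact: cderiv_diff gd.
have psih : holo (disc p t') psi.
  move=> z zt; apply: cdiffM; last exact: ghd.
  by apply: cdiffX; exact: cdiff_sub.
have pt' := disc_center p t'0.
have psid : der psi p != 0.
  rewrite der_mul_root //=; last exact: ghd.
  have [hpp _] := t't p pt'; have [_ gk _ _] := gP _ hpp.
  by apply: contraNneq hp => g0; rewrite -gk g0 expr0n gtn_eqF.
have [r2 [rho2 [eta [r20 r2t rho20 _ etaP]]]] := local_inverse t'0 psih psid.
have psip : psi p = 0 by rewrite /psi subrr expr1 mul0r.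
rewrite psip in etaP.
have [zeta zk z1] : exists2 zeta : C, zeta ^+ k = 1 & zeta != 1.
  have [s [us ss sP]] := unity_roots R k0.
  have [[z zs]|nz] := pselect (exists z, z \in s /\ z != 1).
    by case: zs => zs z1; exists z => //; apply/eqP; rewrite -sP.
  exfalso; pose s1 : seq C := [:: 1]; have : (size s <= size s1)%N.
    apply: uniq_leq_size => // z zs; rewrite inE; apply: contrapT => /negP z1.
    by apply: nz; exists z.
  by rewrite ss /= leqNgt k2.
have az : abs zeta = 1.
  have : abs zeta ^+ k = 1 by rewrite -absX zk abs1.
  by move=> /eqP; rewrite pexpr_eq1 ?abs_ge0 // => /eqP.
pose w := (rho2 / 2)%:C : C.
have aw : abs w = rho2 / 2 by rewrite abs_real gtr0_norm //; lra.
have wd : disc 0 rho2 w by rewrite /disc /= subr0 aw; lra.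
have zwd : disc 0 rho2 (zeta * w) by rewrite /disc /= subr0 absM az aw; lra.
have [e1 p1 _ _] := etaP w wd; have [e2 p2 _ _] := etaP _ zwd.
have Fpsi z : disc p t' z -> F z = psi z ^+ k.
  move=> zt; have [hz zR] := t't z zt; have [_ gk _ _] := gP _ hz.
  by rewrite FE // /psi exprMn gk expr1.
have d1 := disc_sub r2t e1; have d2 := disc_sub r2t e2.
have : F (eta w) = F (eta (zeta * w)).
  by rewrite !Fpsi // p1 p2 exprMn zk mul1r.
move=> /(congr1 (fun u => u + f p)); rewrite !subrK => /inj.
have [_ q1] := t't _ d1; have [_ q2] := t't _ d2.
move=> /(_ q1 q2) ee; have : w = zeta * w by rewrite -{1}p1 ee p2.
move/eqP; rewrite -{1}[w]mul1r (inj_eq (mulIf _)); first by rewrite eq_sym (negPf z1).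
by rewrite -abs_gt0 aw; lra.
Qed.

End LocalInverse.

(** * Koenigs linearisation and local roots *)

Section Koenigs.
Variable R : realType.
Local Notation C := (R[i]).
Implicit Types (r s t M : R) (x y z w a p q lam mu : C) (f g h T phi psi : C -> C).

Lemma small_geo (k M e : R) : 0 <= k -> k < 1 -> 0 < e -> exists n, M * k ^+ n < e.
Proof.
move=> k0 k1 e0; apply: contrapT => H.
have He n : e <= M * k ^+ n by rewrite leNgt; apply/negP => h; apply: H; exists n.
have : 1 <= k.
  by apply: (@le_of_powers _ 1 k e M) => // n; rewrite expr1n mul1r.
by rewrite leNgt k1.
Qed.

Lemma geometric_steps (u : nat -> C) (D k : R) : 0 <= k -> k <= 1 -> 0 <= D ->
  (forall n, abs (u n.+1 - u n) <= D * (1 - k) * k ^+ n) ->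
  forall n m, abs (u n - u m) <= D * k ^+ n + D * k ^+ m.
Proof.
move=> k0 k1 D0 H.
have Hd n m : abs (u (n + m)%N - u n) <= D * (k ^+ n - k ^+ (n + m)).
  elim: m => [|m IH]; first by rewrite addn0 !subrr abs0 mulr0.
  have h1 := abs_dist (u (n + m)%N) (u (n + m.+1)%N) (u n).
  have h2 := H (n + m)%N; rewrite -addnS in h2.
  have -> : k ^+ n - k ^+ (n + m.+1) = (k ^+ n - k ^+ (n + m)) + (1 - k) * k ^+ (n + m).
    by rewrite addnS exprS; ring.
  by rewrite mulrDr mulrA; lra.
have kp n : 0 <= D * k ^+ n by rewrite mulr_ge0 // exprn_ge0.
move=> n m; have [/subnKC <-|/ltnW/subnKC <-] := leqP n m.
  by rewrite absC; have := Hd n (m - n)%N; have := kp (n + (m - n))%N; lra.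
by have := Hd m (n - m)%N; have := kp (m + (n - m))%N; lra.
Qed.

(** [phi] is the limit of [u n z = (iter n T z - q) / lam ^+ n]. Consecutive terms differ by the
    factor [dq T q (iter n T z) / lam], which is [1] up to a geometric error because the orbit
    approaches [q] geometrically. *)
Lemma koenigs T q R0 : 0 < R0 -> holo (disc q R0) T -> T q = q ->
  der T q != 0 -> abs (der T q) < 1 ->
  exists r phi, [/\ 0 < r /\ r <= R0,
    forall z, disc q r z -> abs (T z - q) <= abs (z - q),
    holo (disc q r) phi /\ phi q = 0, der phi q != 0 &
    forall z, disc q r z -> phi (T z) = der T q * phi z].
Proof.
move=> R00 Th Tq l0 l1; set lam := der T q in l0 l1 *.
have lp : 0 < abs lam by rewrite abs_gt0.
have [s [K [s0 sR K0 HK]]] := dq_lip_center R00 Th.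
pose k := (1 + abs lam) / 2.
have k0 : 0 < k by rewrite /k; lra.
have k1 : k < 1 by rewrite /k; lra.
(* With [8 * (K * r) <= abs lam * (1 - k)], [T] contracts towards [q] by the factor [k] on the disc,
   and the [n]-th factor of [u] differs from [1] by at most [(1 - k) / 8 * k ^+ n]. *)
pose r := Num.min s (abs lam * (1 - k) / (8 * K + 8)).
have r0 : 0 < r.
  by rewrite lt_min s0 divr_gt0 ?mulr_gt0 //; lra.
have rs : r <= s by rewrite ge_min lexx.
have rK : 8 * (K * r) <= abs lam * (1 - k).
  have : r <= abs lam * (1 - k) / (8 * K + 8) by rewrite ge_min lexx orbT.
  by rewrite ler_pdivlMr; lra.
have lk : K * r <= 1 - k.
  have : 0 <= K * r by rewrite mulr_ge0 // ltW.
  have : abs lam * (1 - k) <= 1 * (1 - k) by apply: ler_wpM2r; lra.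
  lra.
have Tz z : T z - q = dq T q z * (z - q) by rewrite -dqE Tq.
have dqz z : disc q r z -> abs (dq T q z - lam) <= K * abs (z - q).
  move=> zr; have := HK z q (disc_sub rs zr) (disc_center q s0).
  by rewrite subrr abs0 addr0.
have Tk z : disc q r z -> abs (T z - q) <= k * abs (z - q).
  move=> zr; rewrite Tz absM; apply: ler_wpM2r; first exact: abs_ge0.
  have h1 := dqz z zr; have h2 := abs_lesub (dq T q z) lam.
  have h3 : K * abs (z - q) <= K * r by apply: ler_wpM2l => //; apply: ltW.
  have h4 : abs lam * (1 - k) <= 1 - k.
    by rewrite -{2}[1 - k]mul1r; apply: ler_wpM2r; lra.
  have h5 : 0 <= K * r by rewrite mulr_ge0 // ltW.
  have h6 : k - abs lam = 1 - k by rewrite /k; field.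
  lra.
have itk z n : disc q r z -> disc q r (iter n T z) /\ abs (iter n T z - q) <= k ^+ n * abs (z - q).
  move=> zr; elim: n => [|n [IH1 IH2]]; first by rewrite expr0 mul1r.
  have h := Tk _ IH1; split => /=.
    rewrite /disc /= in IH1 *; apply: (le_lt_trans h); have := abs_ge0 (iter n T z - q).
    have : k * abs (iter n T z - q) <= 1 * abs (iter n T z - q).
      by apply: ler_wpM2r; [exact: abs_ge0|lra].
    lra.
  apply: (le_trans h); rewrite exprS -mulrA; apply: ler_wpM2l => //; lra.
pose u n z := (iter n T z - q) / lam ^+ n.
have uS n z : u n.+1 z = u n z * (dq T q (iter n T z) / lam).
  rewrite /u /= Tz exprS; field; by rewrite expf_neq0 // l0.
have eps z n : disc q r z -> abs (dq T q (iter n T z) / lam - 1) <= (1 - k) / 8 * k ^+ n.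
  move=> zr; have [h1 h2] := itk z n zr.
  have -> : dq T q (iter n T z) / lam - 1 = (dq T q (iter n T z) - lam) / lam by field.
  rewrite abs_div ler_pdivrMr //; apply: (le_trans (dqz _ h1)).
  have kn : 0 <= k ^+ n by rewrite exprn_ge0 // ltW.
  apply: (@le_trans _ _ (K * (k ^+ n * r))).
    apply: ler_wpM2l => //; apply: (le_trans h2); apply: ler_wpM2l => //; exact: ltW.
  have := ler_wpM2r kn rK; lra.
(* The induction can carry [2 - k ^+ n], but not the bare bound [2]: the room gained from [n] to
   [n.+1] is [(1 - k) * k ^+ n]. *)
have ub z n : disc q r z -> abs (u n z) <= abs (z - q) * (2 - k ^+ n).
  move=> zr; elim: n => [|n IH].
    by rewrite /u !expr0 divr1 /=; lra.
  rewrite uS absM.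
  have kn : 0 <= k ^+ n by rewrite exprn_ge0 // ltW.
  have kn1 : k ^+ n <= 1 by rewrite exprn_ile1 // ltW.
  have h1 : abs (dq T q (iter n T z) / lam) <= 1 + (1 - k) / 8 * k ^+ n.
    have := eps z n zr; have := abs_lesub (dq T q (iter n T z) / lam) 1; rewrite abs1; lra.
  apply: (@le_trans _ _ (abs (z - q) * (2 - k ^+ n) * (1 + (1 - k) / 8 * k ^+ n))).
    by apply: ler_pM => //; exact: abs_ge0.
  rewrite -mulrA; apply: ler_wpM2l; first exact: abs_ge0.
  have h2 : 0 <= (1 - k) * k ^+ n by rewrite mulr_ge0 //; lra.
  have h3 : 0 <= (1 - k) * k ^+ n * k ^+ n by rewrite mulr_ge0.
  rewrite exprS; lra.
have us z n : disc q r z -> abs (u n.+1 z - u n z) <= abs (z - q) / 4 * (1 - k) * k ^+ n.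
  move=> zr; rewrite uS.
  have -> : u n z * (dq T q (iter n T z) / lam) - u n z = u n z * (dq T q (iter n T z) / lam - 1) by ring.
  rewrite absM.
  have kn : 0 <= k ^+ n by rewrite exprn_ge0 // ltW.
  have -> : abs (z - q) / 4 * (1 - k) * k ^+ n = (abs (z - q) * 2) * ((1 - k) / 8 * k ^+ n) by field.
  apply: ler_pM; rewrite ?abs_ge0 //; last exact: eps.
  apply: (le_trans (ub z n zr)); apply: ler_wpM2l; first exact: abs_ge0.
  lra.
have lim z : exists L, disc q r z -> forall n, abs (u n z - L) <= abs (z - q) / 2 * k ^+ n.
  have [zr|nz] := pselect (disc q r z); last by exists 0.
  have az : 0 <= abs (z - q) / 4 by have := abs_ge0 (z - q); lra.
  have H := @geometric_steps (fun n => u n z) _ k (ltW k0) (ltW k1) az (fun n => us z n zr).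
  have [L HL] := @near_limit R nat (fun n => u n z) (fun n => abs (z - q) / 4 * k ^+ n) 0%N H.
  exists L => _ n; apply: (le_trans (HL n)); rewrite le_eqVlt; apply/orP; left.
  by apply/eqP; field.
pose phi z := xget 0 [set L | disc q r z -> forall n, abs (u n z - L) <= abs (z - q) / 2 * k ^+ n].
have phiP z : disc q r z -> forall n, abs (u n z - phi z) <= abs (z - q) / 2 * k ^+ n.
  have [L HL] := lim z => zr; rewrite /phi; case: xgetP => [y _ Hy|/(_ L)//].
  exact: Hy.
have dr := @disc_center R q r r0.
have phih : holo (disc q r) phi.
  apply: (@holo_limit R u phi q r (r * 2) r0).
  - elim=> [|n IH] z zr.
      apply: cdiffM; last exact: cdiff_cst.
      exact: cdiff_sub.
    have D : cdiff (fun z => lam^-1 * (T (iter n T z) - q) / lam ^+ n) z.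
      apply: cdiffM; last exact: cdiff_cst.
      apply: cdiffM; first exact: cdiff_cst.
      apply: cdiffB; last exact: cdiff_cst.
      apply: cdiff_comp; last by apply: Th; have [h _] := itk z n zr; apply: disc_sub h; lra.
      have E : cdiff (fun z => u n z * lam ^+ n + q) z.
        apply: cdiffD; last exact: cdiff_cst.
        by apply: cdiffM; [exact: IH|exact: cdiff_cst].
      apply: (cdiff_eq E); exists 1 => // w _.
      by rewrite /u divfK ?subrK // expf_neq0.
    apply: (cdiff_eq D); exists 1 => // w _; rewrite /u /= exprS; field.
    by rewrite expf_neq0 // l0.
  - move=> n z zr; apply: (le_trans (ub z n zr)).
    have kn : 0 <= k ^+ n by rewrite exprn_ge0 // ltW.
    have kn1 : k ^+ n <= 1 by rewrite exprn_ile1 // ltW.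
    apply: ler_pM; [exact: abs_ge0|lra|exact: ltW|lra].
  - move=> z zr e e0; have [N HN] := small_geo (abs (z - q) / 2) (ltW k0) k1 e0.
    exists N => n Nn; apply: le_lt_trans HN; apply: (le_trans (phiP z zr n)).
    apply: ler_wpM2l; first by have := abs_ge0 (z - q); lra.
    by apply: ler_wiXn2l => //; apply: ltW.
have phiq : phi q = 0.
  by have := phiP q dr 0%N; rewrite /u expr0 subrr abs0 !mul0r sub0r absN => h;
    apply: abs0P; apply/eqP; rewrite eq_le abs_ge0 h.
(* At [n = 0] the error bound reads [abs (z - q - phi z) <= abs (z - q) / 2]; this forces a non-zero
   derivative of [phi] at [q]. *)
have philow z : disc q r z -> abs (z - q) / 2 <= abs (phi z).
  move=> zr; have := phiP z zr 0%N; rewrite /u expr0 divr1 mulr1 /=.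
  by have := abs_lesub (z - q) (phi z); lra.
exists r, phi; split => //.
- by split => //; lra.
- move=> z zr; apply: (le_trans (Tk z zr)).
  by rewrite -{2}[abs (z - q)]mul1r; apply: ler_wpM2r; [exact: abs_ge0|lra].
- apply/eqP => d0.
  have [dc] := dq_cont (phih q dr).
  have [t t0 Ht] := dc (1 / 4) ltac:(lra).
  have m0 : 0 < Num.min r t by rewrite lt_min r0.
  have [z zq] := close_point q m0; rewrite lt_min => /andP[zr zt].
  have z0 : 0 < abs (z - q) by rewrite abs_gt0 subr_eq0.
  have := Ht z zt; rewrite dq_diag d0 subr0 => h1.
  have h2 := philow z zr.
  have := dqE phi q z; rewrite phiq subr0 => E; rewrite E absM in h2.
  have : abs (dq phi q z) * abs (z - q) < 1 / 4 * abs (z - q) by rewrite ltr_pM2r.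
  lra.
- move=> z zr; apply/eqP; rewrite -subr_eq0 -abs_eq0; apply/eqP.
  apply: eps_eq0 => [|e e0]; first exact: abs_ge0.
  have [Tzr _] := itk z 1%N zr; rewrite /= in Tzr.
  pose B := abs (T z - q) / 2 + abs (z - q) / 2.
  have [n Hn] := small_geo B (ltW k0) k1 e0.
  have h1 := phiP _ Tzr n; have h2 := phiP z zr n.+1.
  have E : u n (T z) = lam * u n.+1 z.
    by rewrite /u -iterSr exprS; field; rewrite expf_neq0 // l0.
  have -> : phi (T z) - lam * phi z = lam * (u n.+1 z - phi z) - (u n (T z) - phi (T z)).
    by rewrite E; ring.
  apply: (le_trans (abs_suble _ _)); rewrite absM.
  have h3 : abs lam * abs (u n.+1 z - phi z) <= abs (u n.+1 z - phi z).
    by rewrite -{2}[abs (u n.+1 z - phi z)]mul1r; apply: ler_wpM2r; [exact: abs_ge0|exact: ltW].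
  have kn : 0 <= k ^+ n by rewrite exprn_ge0 // ltW.
  have h4 : abs (z - q) / 2 * k ^+ n.+1 <= abs (z - q) / 2 * k ^+ n.
    rewrite exprS; apply: ler_wpM2l; first by have := abs_ge0 (z - q); lra.
    by rewrite -{2}[k ^+ n]mul1r; apply: ler_wpM2r => //; apply: ltW.
  by move: Hn; rewrite /B mulrDl; lra.
Qed.

(** [phi] need not map [disc q r] into [disc 0 rho], so [psi] is given only as a right inverse;
    [psi (phi z) = z] follows from injectivity once [phi z] lies in [disc 0 rho]. *)
Definition koenigs_chart T lam q r rho phi psi : Prop :=
  [/\ 0 < r /\ 0 < rho, forall z, disc q r z -> disc q r (T z) /\ phi (T z) = lam * phi z,
      holo (disc q r) phi /\ phi q = 0,
      forall x y, disc q r x -> disc q r y -> phi x = phi y -> x = y &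
      forall w, disc 0 rho w -> [/\ disc q r (psi w), phi (psi w) = w & cdiff psi w]].

Lemma exists_koenigs_chart T q R0 : 0 < R0 -> holo (disc q R0) T -> T q = q ->
  der T q != 0 -> abs (der T q) < 1 ->
  exists r rho phi psi, r <= R0 /\ koenigs_chart T (der T q) q r rho phi psi.
Proof.
move=> R00 Th Tq l0 l1.
have [r [phi [[r0 rR] Tr [phih phiq] phid phiT]]] := koenigs R00 Th Tq l0 l1.
have [r' [rho [psi [r'0 r'r rho0 inj psiP]]]] := local_inverse r0 phih phid.
exists r', rho, phi, psi; split; first by lra.
have sub := @disc_sub R q r' r r'r.
split => //.
- move=> z zr; split; last by apply: phiT; exact: sub.
  by have := Tr z (sub z zr); rewrite /disc /= in zr *; lra.
- by split => //; apply: holo_sub phih.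
- by rewrite phiq in psiP; move=> w /psiP[h1 h2 _ h3]; split => //; exact: cderiv_diff h3.
Qed.

End Koenigs.

Section LocalRoots.
Variable R : realType.
Local Notation C := (R[i]).
Implicit Types (r s t e M : R) (z w a p q lam mu : C) (f g h S phi psi : C -> C).

Lemma same_germP p g h :
  same_germ (p : Cx R) g h <-> exists2 r : R, 0 < r & forall z, disc p r z -> g z = h z.
Proof. exact: Cx_nbhsP. Qed.

Lemma holomorphic_holo (U : set (Cx R)) g : holomorphic_on U g <-> holo U g.
Proof. by split=> H z /H /derivable_cdiff. Qed.

Lemma root_le1 l mu lam : (0 < l)%N -> mu ^+ l = lam -> abs lam < 1 -> abs mu <= 1.
Proof.
move=> l0 ml l1; rewrite leNgt; apply/negP => m1; move: l1.
rewrite -ml absX ltNge => /negP; apply; apply: exprn_ege1; exact: ltW.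
Qed.

Lemma disc0_scale mu z r : abs mu <= 1 -> disc 0 r z -> disc 0 r (mu * z).
Proof.
rewrite /disc /= !subr0 absM => m1; apply: le_lt_trans.
by rewrite -[leRHS]mul1r; apply: ler_wpM2r => //; exact: abs_ge0.
Qed.

Lemma chart_root_iter S lam p r rho phi psi mu k : koenigs_chart S lam p r rho phi psi ->
  abs mu <= 1 -> forall z, disc p r z -> disc 0 rho (phi z) ->
  [/\ disc p r (iter k (fun z => psi (mu * phi z)) z),
      disc 0 rho (phi (iter k (fun z => psi (mu * phi z)) z)) &
      phi (iter k (fun z => psi (mu * phi z)) z) = mu ^+ k * phi z].
Proof.
move=> [[r0 rho0] _ _ _ psiP] m1 z zr zrho; elim: k => [|k [h1 h2 h3]].
  by rewrite expr0 mul1r.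
have md := disc0_scale m1 h2.
have [k1 k2 _] := psiP _ md; rewrite iterS k2; split => //.
by rewrite h3 exprS mulrA.
Qed.

(** In the chart the solution is multiplication by [mu]. Its domain is cut down to the points with
    [phi z] in [disc 0 rho], and this domain is invariant because [abs mu <= 1]. *)
Lemma chart_root_local (D : set (Cx R)) S lam p r rho phi psi mu l :
  koenigs_chart S lam p r rho phi psi -> disc p r `<=` D -> (0 < l)%N -> mu ^+ l = lam ->
  abs lam < 1 -> local_root D S p l (fun z => psi (mu * phi z)).
Proof.
move=> ch rD l0 ml l1; have m1 := root_le1 l0 ml l1.
have it := fun k => @chart_root_iter S lam p r rho phi psi mu k ch m1.
case: (ch) => [[r0 rho0] SP [phih phip] inj psiP].
exists [set z | disc p r z /\ disc 0 rho (phi z)]; split.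
- apply/Cx_openP => z [zr zrho].
  have [t t0 Ht] := disc_open zr; have [s s0 Hs] := disc_open zrho.
  have [pc] := cdiff_cont (phih z zr); have [d d0 Hd] := pc s s0.
  exists (Num.min t d); first by rewrite lt_min t0.
  by move=> w; rewrite lt_min => /andP[wt wd]; split; [exact: Ht|exact/Hs/Hd].
- by split; [exact: disc_center|rewrite phip; exact: disc_center].
- apply/holomorphic_holo => z [zr zrho].
  apply: cdiff_comp; last by have [] := psiP _ (disc0_scale m1 zrho).
  by apply: cdiffM; [exact: cdiff_cst|exact: phih].
- move=> k _ /=; have pr : disc p r p := disc_center p r0.
  have prho : disc 0 rho (phi p) by rewrite phip; exact: disc_center.
  by have [] := it k p pr prho.
- move=> z /(_ 0%N l0)[/= zr zrho]; split; first exact: rD.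
  have [h1 h2 h3] := it l z zr zrho; have [h4 h5] := SP z zr.
  by apply: inj => //; rewrite h3 h5 ml.
Qed.

Lemma chart_root_inj S lam p r rho phi psi mu mu' : koenigs_chart S lam p r rho phi psi ->
  abs mu <= 1 -> abs mu' <= 1 ->
  same_germ (p : Cx R) (fun z => psi (mu * phi z)) (fun z => psi (mu' * phi z)) -> mu = mu'.
Proof.
move=> [[r0 rho0] SP [phih phip] inj psiP] m1 m1' /same_germP[t t0 Ht].
have pr := disc_center p r0.
have [pc] := cdiff_cont (phih p pr); have [d d0 Hd] := pc rho rho0.
have m0 : 0 < Num.min (Num.min r t) d by rewrite !lt_min r0 t0.
have [z zp] := close_point p m0; rewrite !lt_min => /andP[/andP[zr zt] zd].
have zrho : disc 0 rho (phi z) by have := Hd z zd; rewrite phip.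
have [_ e1 _] := psiP _ (disc0_scale m1 zrho).
have [_ e2 _] := psiP _ (disc0_scale m1' zrho).
have /(congr1 phi) := Ht z zt; rewrite e1 e2 => /mulIf; apply.
by apply: contraNneq zp => pz0; apply/eqP; apply: inj; rewrite ?pz0.
Qed.

Lemma iter_near h p k e : ccont h p -> h p = p -> 0 < e ->
  exists2 t : R, 0 < t & forall z, disc p t z -> forall j, (j <= k)%N -> disc p e (iter j h z).
Proof.
move=> [hc] hp e0; elim: k => [|k [t t0 Ht]].
  by exists e => // z zt j; rewrite leqn0 => /eqP ->.
have [s s0 Hs] := hc t t0; exists (Num.min s e); first by rewrite lt_min s0.
move=> z; rewrite /disc /= lt_min => /andP[zs ze] [_|j jk] //=.
rewrite -iterS iterSr; apply: Ht => //.
by have := Hs z zs; rewrite hp.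
Qed.

(* A linear map commuting with a contraction [lam] near [0] is determined by its
   derivative, since its difference quotient is constant along [lam ^ n * w]. *)
Lemma commuting_linear G lam rho : 0 < rho -> lam != 0 -> abs lam < 1 -> cdiff G 0 -> G 0 = 0 ->
  (forall w, disc 0 rho w -> G (lam * w) = lam * G w) ->
  forall w, disc 0 rho w -> G w = der G 0 * w.
Proof.
move=> rho0 l0 l1 Gd G0 GE w wr.
have [->|w0] := eqVneq w 0; first by rewrite G0 mulr0.
have it n : disc 0 rho (lam ^+ n * w) /\ dq G 0 (lam ^+ n * w) = dq G 0 w.
  elim: n => [|n [IH1 IH2]]; first by rewrite expr0 mul1r.
  have ln0 : lam ^+ n * w != 0 by rewrite mulf_neq0 // expf_neq0.
  rewrite exprS -mulrA; split.
    by apply: disc0_scale => //; exact: ltW.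
  rewrite -IH2 /dq (negPf ln0) mulf_eq0 (negPf l0) (negPf ln0) /= GE // G0 !subr0.
  by rewrite invfM mulrACA divff // mul1r.
have E : G w = dq G 0 w * w by have := dqE G 0 w; rewrite G0 !subr0.
rewrite E; congr (_ * _); apply/eqP; rewrite -subr_eq0 -abs_eq0; apply/eqP.
apply: eps_eq0 => [|e e0]; first exact: abs_ge0.
have [dc] := dq_cont Gd; have [t t0 Ht] := dc e e0.
have [n Hn] := small_geo (abs w) (abs_ge0 lam) l1 t0.
have [h1 h2] := it n; rewrite -h2 -dq_diag; apply: ltW; apply: Ht.
by rewrite subr0 absM absX mulrC.
Qed.

(** Near [p] the map [S] is an iterate of [h], so the two commute; hence [phi \o h \o psi] commutes
    with multiplication by [lam] and is linear. Comparing [l]-th iterates gives [mu ^+ l = lam]. *)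
Lemma local_root_chart (D : set (Cx R)) S lam p r rho phi psi h l :
  koenigs_chart S lam p r rho phi psi -> S p = p -> (forall z, D z -> S z = z -> z = p) ->
  (0 < l)%N -> lam != 0 -> abs lam < 1 -> local_root D S p l h ->
  exists2 mu, mu ^+ l = lam & same_germ (p : Cx R) h (fun z => psi (mu * phi z)).
Proof.
move=> [[r0 rho0] SP [phih phip] inj psiP] Sp fixD l0 lam0 lam1 [U [oU Up hU itp HU]].
(* [S (h p) = iter l h (h p) = h (iter l h p) = h (S p) = h p], so [h p] is a fixed point of [S] in
   [D]. The last of the iterates of [h p] is defined because [iter l h p = p]. *)
have hp : h p = p.
  have [_ itS] := HU p itp.
  have dom : iter_dom U h l (h p).
    move=> k kl /=; rewrite -iterSr; move: kl; rewrite leq_eqVlt => /predU1P[->|kl].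
      by rewrite itS Sp.
    exact: itp.
  have [Dh itSh] := HU _ dom; apply: fixD => //.
  by rewrite -itSh -iterSr iterS itS Sp.
have [e1 e10 He1] := (Cx_openP U).1 oU p Up.
pose e := Num.min e1 r.
have e0 : 0 < e by rewrite lt_min e10.
have eU z : disc p e z -> U z by move=> ze; apply: He1; move: ze; rewrite /disc /= lt_min => /andP[].
have er z : disc p e z -> disc p r z by rewrite /disc /= lt_min => /andP[].
have hh := (holomorphic_holo U h).1 hU.
have hc := cdiff_cont (hh p Up).
have [t t0 Ht] := iter_near l.+1 hc hp e0.
have pr := disc_center p r0.
have St z : disc p t z -> [/\ disc p e z, disc p e (h z), S z = iter l h z & S (h z) = h (S z)].
  move=> zt; have Hz := Ht z zt.
  have d1 : iter_dom U h l z.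
    by move=> k kl; apply: eU; apply: Hz; apply: ltnW; apply: leq_trans kl _.
  have d2 : iter_dom U h l (h z).
    by move=> k kl; rewrite -iterSr; apply: eU; apply: Hz; apply: leqW.
  have [_ i1] := HU z d1; have [_ i2] := HU _ d2; split=> //.
  - exact: (Hz 0%N).
  - exact: (Hz 1%N).
  - by rewrite -i2 -iterSr iterS i1.
have psi0 : psi 0 = p.
  have [k1 k2 _] := psiP 0 (disc_center 0 rho0); apply: inj => //.
  by rewrite k2 phip.
have [_ _ psid0] := psiP 0 (disc_center 0 rho0).
have [pc] := cdiff_cont psid0; have [d d0 Hd] := pc t t0.
pose rho' := Num.min d rho.
have rho'0 : 0 < rho' by rewrite lt_min d0.
have rho'P w : disc 0 rho' w -> disc p t (psi w) /\ disc 0 rho w.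
  by rewrite /disc /= lt_min => /andP[/Hd]; rewrite psi0.
pose G w := phi (h (psi w)).
have G0 : G 0 = 0 by rewrite /G psi0 hp phip.
have Gd : cdiff G 0.
  apply: (@cdiff_comp R phi (fun w => h (psi w))); last by rewrite psi0 hp; exact: phih.
  by apply: cdiff_comp => //; rewrite psi0; exact: hh.
have GE w : disc 0 rho' w -> G (lam * w) = lam * G w.
  move=> /rho'P[pt wr].
  have lw : disc 0 rho (lam * w) by apply: disc0_scale => //; exact: ltW.
  have [k1 k2 _] := psiP w wr; have [k3 k4 _] := psiP _ lw.
  have [k5 k6] := SP _ k1.
  have -> : G (lam * w) = phi (h (S (psi w))).
    by rewrite /G; congr (phi (h _)); apply: inj => //; rewrite k4 k6 k2.
  have [_ /er hr _ k7] := St _ pt.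
  by rewrite -k7; have [_ ->] := SP _ hr.
have Glin := commuting_linear rho'0 lam0 lam1 Gd G0 GE.
set mu := der G 0 in Glin.
have [fc] := cdiff_cont (phih p pr); have [s s0 Hs] := fc rho' rho'0.
pose t2 := Num.min s t.
have t20 : 0 < t2 by rewrite lt_min s0.
have hlin z : disc p t2 z -> [/\ disc p t z, disc 0 rho' (phi z) & phi (h z) = mu * phi z].
  rewrite /disc /= lt_min => /andP[zs zt].
  have zr' : disc 0 rho' (phi z) by have := Hs z zs; rewrite phip.
  have [pt wr] := rho'P _ zr'; have [k1 k2 _] := psiP _ wr.
  have [/er zr _ _ _] := St z zt.
  have pz : psi (phi z) = z by apply: inj.
  by split => //; have := Glin _ zr'; rewrite /G pz.
have mul : mu ^+ l = lam.
  have [t3 t30 Ht3] := iter_near l hc hp t20.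
  have m0 : 0 < Num.min t3 t2 by rewrite lt_min t30.
  have [z zp] := close_point p m0; rewrite lt_min => /andP[z3 z2].
  have [zt _ _] : [/\ disc p t z, disc 0 rho' (phi z) & phi (h z) = mu * phi z].
    exact: hlin.
  have it j : (j <= l)%N -> phi (iter j h z) = mu ^+ j * phi z.
    elim: j => [|j IH] jl; first by rewrite expr0 mul1r.
    have [_ _] := hlin _ (Ht3 z z3 j (ltnW jl)); rewrite iterS => ->.
    by rewrite IH 1?ltnW // exprS mulrA.
  have [/er zr _ Sz _] := St z zt; have [_ Sphi] := SP z zr.
  have := it l (leqnn l); rewrite -Sz Sphi => /mulIf ->//.
  by apply: contraNneq zp => pz0; apply/eqP; apply: inj; rewrite ?pz0.
exists mu => //; apply/same_germP; exists t2 => // z /hlin[zt zr' E].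
have m1 := root_le1 l0 mul lam1.
have [_ wr] := rho'P _ zr'.
have md := disc0_scale m1 wr.
have [k1 k2 _] := psiP _ md; have [_ /er hr _ _] := St z zt.
by apply: inj => //; rewrite k2 E.
Qed.

Lemma local_roots (D : set (Cx R)) S p R0 : 0 < R0 -> disc p R0 `<=` D -> holo (disc p R0) S ->
  S p = p -> (forall z, D z -> S z = z -> z = p) -> der S p != 0 -> abs (der S p) < 1 ->
  exists gs : forall l : nat, 'I_l -> C -> C, forall l, (0 < l)%N ->
    [/\ forall j : 'I_l, local_root D S p l (gs l j),
        forall i j : 'I_l, i != j -> ~ same_germ (p : Cx R) (gs l i) (gs l j) &
        forall h, local_root D S p l h -> exists j : 'I_l, same_germ (p : Cx R) h (gs l j)].
Proof.
move=> R00 RD Sh Sp fixD d0 d1.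
have [r [rho [phi [psi [rR ch]]]]] := exists_koenigs_chart R00 Sh Sp d0 d1.
have rD : disc p r `<=` D by move=> z zr; apply: RD; exact: disc_sub zr.
have rts l : exists s : seq C, (0 < l)%N ->
    [/\ uniq s, size s = l & forall z, (z \in s) = (z ^+ l == der S p)].
  have [l0|l0] := posnP l; first by exists [::]; rewrite l0.
  by have [s Hs] := nth_roots l0 d0; exists s.
have [s Hs] := choice rts.
exists (fun l j z => psi ((s l)`_j * phi z)) => l l0; have [us ss sP] := Hs l l0.
have sl (j : 'I_l) : (s l)`_j ^+ l = der S p by apply/eqP; rewrite -sP mem_nth // ss.
split.
- by move=> j; apply: (chart_root_local ch).
- move=> i j ij /(chart_root_inj ch (root_le1 l0 (sl i) d1) (root_le1 l0 (sl j) d1)).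
  move/eqP; rewrite nth_uniq ?ss // => /eqP/val_inj/eqP.
  by rewrite (negPf ij).
- move=> h /(local_root_chart ch Sp fixD l0 d0 d1)[mu mul hg].
  have mus : mu \in s l by rewrite sP mul.
  have il : (index mu (s l) < l)%N by rewrite -[X in (_ < X)%N]ss index_mem.
  by exists (Ordinal il); rewrite /= nth_index.
Qed.

End LocalRoots.

(** * Contraction and fixed points of word maps *)

Lemma finite_uniform (R : realType) (T : finType) (P : T -> R -> Prop) :
  (forall i c c', P i c -> 0 < c' -> c' <= c -> P i c') ->
  (forall i, exists2 c : R, 0 < c & P i c) -> exists2 c : R, 0 < c & forall i, P i c.
Proof.
move=> Pm H.
have H' i : exists c : R, 0 < c /\ P i c by have [c c0 Hc] := H i; exists c.
have [d Hd] := choice H'.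
have m0 : 0 < \big[Num.min/1]_i d i.
  elim/big_ind: _ => [|x y x0 y0|j _]; rewrite ?ltr01 //; first by rewrite lt_min x0.
  by have [] := Hd j.
exists (\big[Num.min/1]_i d i) => // i; have [_ h] := Hd i.
by apply: Pm h _ _ => //; rewrite (bigD1 i) //= ge_min lexx.
Qed.

Section MeanValue.
Variable R : realType.
Local Notation C := (R[i]).
Implicit Types (r K M : R) (x y z a : C) (f : C -> C).

Lemma disc_segment a r x y (u : R) : disc a r x -> disc a r y -> 0 <= u -> u <= 1 ->
  disc a r (x + u%:C * (y - x)).
Proof.
rewrite /disc /= => xr yr u0 u1.
have -> : x + u%:C * (y - x) - a = (1 - u)%:C * (x - a) + u%:C * (y - a).
  by rewrite rmorphB rmorph1; ring.
apply: (le_lt_trans (abs_addle _ _)); rewrite !absM !abs_real.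
rewrite (ger0_norm u0) ger0_norm; last by lra.
have [->|un0] := eqVneq u 0; first by rewrite mul0r addr0 subr0 mul1r.
have up : 0 < u by rewrite lt_def un0.
have h1 : (1 - u) * abs (x - a) <= (1 - u) * r by apply: ler_wpM2l; lra.
have h2 : u * abs (y - a) < u * r by rewrite ltr_pM2l.
lra.
Qed.

(* Subdividing the segment into [N] pieces leaves a second-order error [O(1/N)]. *)
Lemma mean_value f a R0 r M K x y : 0 < r -> 12 * r <= R0 -> 0 <= M -> holo (disc a R0) f ->
  (forall z, disc a R0 z -> abs (f z) <= M) -> (forall z, disc a r z -> abs (der f z) <= K) ->
  disc a r x -> disc a r y -> abs (f y - f x) <= K * abs (y - x).
Proof.
move=> r0 rR M0 fh fM fK xr yr.
pose L := 2 * (2 * M / r) / r.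
have L0 : 0 <= L by apply: quotient_const_ge0.
have rR' : r <= R0 by lra.
have main (N : nat) : abs (f y - f x) <= K * abs (y - x) + L * abs (y - x) ^+ 2 / N.+1%:R.
  pose d := (y - x) / N.+1%:R.
  have N0 : (N.+1%:R : C) != 0 by rewrite pnatr_eq0.
  have Np : (0 : R) < N.+1%:R by rewrite ltr0n.
  have ad : abs d = abs (y - x) / N.+1%:R by rewrite /d abs_div abs_nat.
  pose z (k : nat) : C := x + k%:R * d.
  have zr k : (k <= N.+1)%N -> disc a r (z k).
    move=> kN; have -> : z k = x + ((k%:R / N.+1%:R : R)%:C) * (y - x).
      by rewrite /z /d rmorphM fmorphV !rmorph_nat; ring.
    apply: disc_segment => //; try exact: divr_ge0.
    by rewrite ler_pdivrMr // mul1r ler_nat.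
  have step k : (k <= N)%N -> abs (f (z k.+1) - f (z k)) <= (K + L * abs d) * abs d.
    move=> kN; have zk := zr k (leqW kN); have zk1 := zr k.+1 kN.
    have E : z k.+1 - z k = d by rewrite /z -natr1; ring.
    rewrite dqE absM E; apply: ler_wpM2r; first exact: abs_ge0.
    have h1 : abs (dq f (z k) (z k.+1) - dq f (z k) (z k)) <= L * abs d.
      by rewrite -E; apply: (dq_lip r0 rR fh fM) => //; exact: disc_sub zk1.
    have h2 := fK _ zk; rewrite -dq_diag in h2.
    by have := abs_lesub (dq f (z k) (z k.+1)) (dq f (z k) (z k)); lra.
  have tele k : (k <= N.+1)%N -> abs (f (z k) - f x) <= k%:R * ((K + L * abs d) * abs d).
    elim: k => [|k IH] kN; first by rewrite /z mul0r addr0 subrr abs0 mul0r.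
    apply: (le_trans (abs_dist (f (z k)) _ _)).
    rewrite -natr1 mulrDl mul1r addrC; apply: lerD; [exact: IH (ltnW kN)|exact: step].
  have := tele N.+1 (leqnn _).
  have -> : z N.+1 = y by rewrite /z /d mulrC divfK // addrC subrK.
  move=> h; apply: (le_trans h); rewrite ad le_eqVlt; apply/orP; left; apply/eqP.
  by field; rewrite gt_eqF.
apply/ler_addgt0Pr => e e0.
pose B := L * abs (y - x) ^+ 2.
have B0 : 0 <= B by rewrite mulr_ge0 // exprn_ge0 // abs_ge0.
pose N := Num.truncn (B / e).
have := truncnS_gt (B / e); rewrite ltr_pdivrMr // => hN.
apply: (le_trans (main N)); rewrite lerD2l ler_pdivrMr ?ltr0n //.
by rewrite [e * _]mulrC; exact: ltW.
Qed.
End MeanValue.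

Section IFS.
Variable R : realType.
Local Notation C := (R[i]).
Implicit Types (r s t e M K : R) (x y z a p q : C).

(* The third clause is connectedness of [Om]: locally constant properties are
   constant. *)
Definition tame_ifs (J : finType) (Om : set C) (f : J -> C -> C) (M dl : R) : Prop :=
  [/\ copen Om /\ (forall z, Om z -> abs z <= M), 0 <= M /\ 0 < dl,
    forall X : set C, (forall z, Om z -> exists2 r : R, 0 < r &
        forall w, Om w -> abs (w - z) < r -> (X w <-> X z)) ->
      forall x y, Om x -> Om y -> X x -> X y,
    forall j, holo Om (f j) /\ (forall x y, Om x -> Om y -> f j x = f j y -> x = y) &
    forall j z w, Om z -> abs (w - f j z) < dl -> Om w].

Lemma Cx_bounded (A : set (Cx R)) : bounded_set A -> exists M : R, forall z, A z -> abs z <= M.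
Proof.
move=> [M [Mr HM]]; exists (Re (M + 1)) => z Az.
have : M < M + 1 by rewrite ltrDl ltr01.
by move=> /HM/(_ z Az) /=; rewrite [X in X <= _]normE lecE => /andP[].
Qed.

Lemma Cx_closed (A : set (Cx R)) : closed A -> cclosed (A : set C).
Proof.
move=> Ac z nAz; have := (Cx_openP (~` A)).1 (closed_openC Ac) z nAz.
by move=> [r r0 Hr]; exists r.
Qed.

(** [U Y] is the union of the open discs on whose part in [A] the property [Y] holds. Applied to [X]
    and to its complement, it shows that [X] is open and closed relative to [A]. *)
Lemma connected_spread (A : set (Cx R)) : connected A ->
  forall X : set C, (forall z, A z -> exists2 r : R, 0 < r &
        forall w, A w -> abs (w - z) < r -> (X w <-> X z)) ->
      forall x y : C, A x -> A y -> X x -> X y.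
Proof.
move=> Ac X HX x y Ax Ay Xx.
pose U (Y : set C) : set (Cx R) :=
  [set z | exists2 w, A w /\ Y w & exists2 r : R, abs (z - w) < r & forall u, A u -> abs (u - w) < r -> Y u].
have Uo Y : open (U Y).
  apply/Cx_openP => z [w [Aw Yw] [r zr Hr]]; exists (r - abs (z - w)); first by lra.
  move=> u uz; exists w => //; exists r => //.
  by have := abs_dist z u w; lra.
have UX : A `&` X = A `&` U X.
  apply/seteqP; split => z [Az Xz]; split => //.
    have [r r0 Hr] := HX z Az; exists z => //; exists r; first by rewrite subrr abs0.
    by move=> u Au uz; apply/(Hr u Au uz).
  by case: Xz => w _ [r zr]; apply.
have UnX : A `&` X = A `&` ~` (U (~` X)).
  apply/seteqP; split => z [Az Xz]; split => //.
    by move=> [w _ [r zr Hr]]; apply: (Hr z Az zr).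
  apply: contrapT => nXz; apply: Xz.
  have [r r0 Hr] := HX z Az; exists z => //; exists r; first by rewrite subrr abs0.
  by move=> u Au uz /(Hr u Au uz).
suff h : A `&` X = A by have [] : (A `&` X) y by rewrite h.
apply: Ac; [by exists x|by exists (U X)|].
by exists (~` U (~` X)) => //; apply: open_closedC.
Qed.

Lemma holomorphic_tame (J : finType) (Om : set (Cx R)) (f : J -> Cx R -> Cx R) :
  holomorphic_IFS Om f -> exists M dl, @tame_ifs J Om f M dl.
Proof.
move=> [[Om0 Omo Omc Omb] Hf].
have [M0 HM0] := Cx_bounded Omb.
pose M := Num.max M0 0.
have HM z : Om z -> abs z <= M by move=> /HM0 h; rewrite le_max h.
have Mp : 0 <= M by rewrite le_max lexx orbT.
have Oo : copen (Om : set C) by move=> z /((Cx_openP Om).1 Omo)[r r0 Hr]; exists r.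
have [d d0 Hd] : exists2 c : R, 0 < c & forall j, forall z : C, closure (f j @` Om) z ->
    forall w : C, abs (w - z) < c -> Om w.
  apply: finite_uniform => [j c c' H _ cc z zcl w wz|j].
    by apply: H zcl _ _; apply: lt_le_trans wz cc.
  have [_ _ cl] := Hf j.
  apply: (@uniform_bound R (closure (f j @` Om)) (fun z c => forall w, abs (w - z) < c -> Om w)).
  - by exists M => z /cl/HM.
  - by apply: Cx_closed; exact: closed_closure.
  - by move=> z c c' Hz _ cc w wz; apply: Hz; apply: lt_le_trans wz cc.
  - move=> z /cl/Oo[r r0 Hr]; exists (r / 2); first by lra.
    exists (r / 2); first by lra.
    move=> w _ wz u uw; apply: Hr; rewrite /disc /=.
    by have := abs_dist w u z; lra.
exists M, d; split => //.
- exact: connected_spread.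
- move=> j; have [fh fi _] := Hf j; split; first exact/holomorphic_holo.
  by move=> x y xO yO; apply: fi; rewrite inE.
- move=> j z w Oz wz; apply: (Hd j (f j z)) => //.
  by apply: subset_closure; exists z.
Qed.

Variables (J : finType) (Om : set C) (f : J -> C -> C) (M dl : R).
Hypothesis tame : tame_ifs Om f M dl.
Implicit Types (v w : seq J).

Local Notation W := (@word_map R J f).

Lemma word_cat v w z : W (v ++ w) z = W v (W w z).
Proof. by elim: v => //= j v; rewrite /= => ->. Qed.

Lemma tame_map j z : Om z -> Om (f j z).
Proof. by case: tame => _ [_ d0] _ _ H Oz; apply: (H j z) => //; rewrite subrr abs0. Qed.

Lemma word_in v z : Om z -> Om (W v z).
Proof. by move=> Oz; elim: v => //= j v IH; apply: tame_map. Qed.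

Lemma word_inj v x y : Om x -> Om y -> W v x = W v y -> x = y.
Proof.
move=> Ox Oy; elim: v => //= j v IH.
by case: tame => _ _ _ /(_ j)[_ inj] _ /(inj _ _ (word_in v Ox) (word_in v Oy)).
Qed.

Lemma word_holo v : holo Om (W v).
Proof.
elim: v => [|j v IH] z Oz /=; first exact: cdiff_id.
apply: cdiff_comp; first exact: IH.
by case: tame => _ _ _ /(_ j)[fh _] _; apply: fh; apply: word_in.
Qed.

(** Two values of [f j] are at most [2 * M] apart, and [rate_gain * (2 * M) < dl], so moving a value
    of [f j] by that much does not leave [Om]. The added [4] keeps the denominator positive when
    [M = 0]. *)
Definition rate_gain : R := dl / (4 * M + 4).
Definition rate : R := (1 + rate_gain)^-1.

Lemma rate_gain_gt0 : 0 < rate_gain.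
Proof. by case: tame => _ [M0 d0] _ _ _; rewrite divr_gt0 //; lra. Qed.
Lemma rate_gt0 : 0 < rate.
Proof. by rewrite invr_gt0; have := rate_gain_gt0; lra. Qed.
Lemma rate_lt1 : rate < 1.
Proof. by rewrite invf_lt1; have := rate_gain_gt0; lra. Qed.

(* Earle-Hamilton: each factor [f j] may be replaced by
   [f j + t (f j - f j (x'))], with [x'] the current orbit point; this still maps
   [Om] into itself and multiplies the derivative at [x] by [1 + t]. *)
Lemma expanded_word v x : Om x -> exists G, [/\ holo Om G, forall z, Om z -> Om (G z),
  G x = W v x & der G x = ((1 + rate_gain) ^+ size v)%:C * der (W v) x].
Proof.
move=> Ox; have t0 := rate_gain_gt0.
elim: v => [|j v [G [Gh GO Gx Gd]]].
  exists id; split => //; first by move=> z _; exact: cdiff_id.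
  by rewrite expr0 mul1r.
case: tame => [[Oo OM] [M0 d0] _ fhi Hd]; have [fh _] := fhi j.
pose t := rate_gain%:C : C.
exists (fun z => f j (G z) + t * (f j (G z) - f j (W v x))).
have fG z : Om z -> cdiff (fun z => f j (G z)) z.
  by move=> Oz; apply: cdiff_comp; [exact: Gh|exact/fh/GO].
split.
- move=> z Oz; apply: cdiffD; first exact: fG.
  apply: cdiffM; first exact: cdiff_cst.
  by apply: cdiffB; [exact: fG|exact: cdiff_cst].
- move=> z Oz; apply: (Hd j (G z)); first exact: GO.
  rewrite addrC addKr absM abs_real gtr0_norm //.
  have h1 := OM _ (tame_map j (GO z Oz)); have h2 := OM _ (tame_map j (word_in v Ox)).
  apply: (@le_lt_trans _ _ (rate_gain * (2 * M))).
    apply: ler_wpM2l; first exact: ltW.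
    by apply: (le_trans (abs_suble _ _)); lra.
  by rewrite /rate_gain mulrAC ltr_pdivrMr; nra.
- by rewrite /= Gx subrr mulr0 addr0.
- have dfj : cdiff (f j) (W v x) by apply: fh; exact: word_in.
  have d1 : cderiv (fun z => f j (G z)) x (der (f j) (W v x) * der G x).
    by apply: cderiv_comp; [exact/derP/Gh|rewrite Gx; exact: derP].
  have d2 : cderiv (W (j :: v)) x (der (f j) (W v x) * der (W v) x).
    by apply: cderiv_comp; [exact/derP/word_holo|exact: derP].
  have d3 := cderivD d1 (cderivZ t (cderivB d1 (cderiv_cst (f j (W v x)) x))).
  rewrite (der_eq d3) (der_eq d2) Gd /= exprS rmorphM rmorphD rmorph1 /t.
  by ring.
Qed.

(** The expanded map [G] has values in [Om], so Cauchy's estimate bounds its derivative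
    independently of [v]; that of [W v] is smaller by the factor [rate ^+ size v]. *)
Lemma word_der_bound v x r : 0 < r -> disc x r `<=` Om ->
  abs (der (W v) x) <= 24 * M / r * rate ^+ size v.
Proof.
move=> r0 xr; have Ox : Om x by apply: xr; exact: disc_center.
have [G [Gh GO Gx Gd]] := expanded_word v Ox.
case: tame => [[_ OM] [M0 _] _ _ _].
have tp : 0 < (1 + rate_gain) ^+ size v.
  by rewrite exprn_gt0 //; have := rate_gain_gt0; lra.
have : abs (dq G x x) <= 2 * M / (r / 12).
  apply: (@dq_bound R G x r (r / 12) M) => //; [lra|lra|..].
  - exact: holo_sub Gh.
  - by move=> z /xr/GO/OM.
  - by apply: disc_center; lra.
  - exact: disc_center.
rewrite dq_diag Gd absM abs_real gtr0_norm // => h.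
rewrite /rate exprVn ler_pdivlMr // mulrC; apply: (le_trans h).
by rewrite le_eqVlt; apply/orP; left; apply/eqP; field; rewrite gt_eqF.
Qed.

(** The radius [r / 24] satisfies the condition [12 * (r / 24) <= r] of [mean_value], and each of
    its points keeps a disc of radius [r / 2] inside [Om], which doubles the constant
    [24 * M / r]. *)
Lemma word_lip x r : 0 < r -> disc x r `<=` Om -> forall v y z,
  disc x (r / 24) y -> disc x (r / 24) z ->
  abs (W v y - W v z) <= 48 * M / r * rate ^+ size v * abs (y - z).
Proof.
move=> r0 xr v y z yr zr; case: tame => [[_ OM] [M0 _] _ _ _].
apply: (@mean_value R (W v) x r (r / 24) M) => //; [lra|lra|..].
- by apply: holo_sub (word_holo v).
- by move=> u /xr /(word_in v)/OM.
- move=> u ur; have ur2 : disc u (r / 2) `<=` Om.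
    move=> w wr; apply: xr; rewrite /disc /= in ur wr *.
    by have := abs_dist u w x; lra.
  apply: (le_trans (word_der_bound v (ltac:(lra) : 0 < r / 2) ur2)).
  by rewrite le_eqVlt; apply/orP; left; apply/eqP; field; rewrite gt_eqF.
Qed.

(** [word_lip] is local. Having an exponential bound with respect to [x] is a locally constant
    property of the other point, so connectedness of [Om] propagates it; [K] still depends on the
    pair. *)
Lemma word_contract_pair x y : Om x -> Om y ->
  exists2 K : R, 0 <= K & forall v, abs (W v x - W v y) <= K * rate ^+ size v.
Proof.
move=> Ox Oy; case: (tame) => [[Oo OM] [M0 _] conn _ _].
pose X : set C := [set y | exists2 K : R, 0 <= K & forall v, abs (W v x - W v y) <= K * rate ^+ size v].
apply: (conn X) Ox Oy _; last first.
  by exists 0 => // v; rewrite subrr abs0 mul0r.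
move=> z Oz; have [r r0 zr] := Oo z Oz.
have rp n : 0 <= rate ^+ n by rewrite exprn_ge0 // ltW // rate_gt0.
have L0 : 0 <= 48 * M / r by rewrite divr_ge0 ?mulr_ge0 // ltW.
exists (r / 24); first by lra.
have zz : disc z (r / 24) z by apply: disc_center; lra.
have loc u u' : disc z (r / 24) u -> disc z (r / 24) u' -> X u -> X u'.
  move=> ur ur' [K K0 HK]; exists (K + 48 * M / r * abs (u - u')).
    by rewrite addr_ge0 // mulr_ge0 // abs_ge0.
  move=> v; apply: (le_trans (abs_dist (W v u) _ _)); rewrite mulrDl; apply: lerD => //.
  by apply: (le_trans (word_lip r0 zr v ur ur')); rewrite mulrAC.
by move=> w Ow wz; split; apply: loc.
Qed.

Lemma rate_small K e : 0 < e -> exists n, forall m, (n <= m)%N -> K * rate ^+ m < e.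
Proof.
move=> e0; have r0 := rate_gt0; have r1 := rate_lt1.
have [K0|K0] := leP K 0.
  exists 0%N => m _; apply: le_lt_trans e0.
  by apply: mulr_le0_ge0 => //; rewrite exprn_ge0 // ltW.
have [n Hn] := small_geo K (ltW r0) r1 e0; exists n => m nm; apply: le_lt_trans Hn.
by rewrite ler_pM2l //; apply: ler_wiXn2l => //; apply: ltW.
Qed.

Lemma iter_word w n z : iter n (W w) z = W (flatten (nseq n w)) z.
Proof. by elim: n => [|n IH] //=; rewrite IH word_cat. Qed.

Lemma size_iter_word w n : w != [::] -> (n <= size (flatten (nseq n w)))%N.
Proof.
move=> w0; elim: n => [|n IH] //=; rewrite size_cat -add1n leq_add //.
by rewrite lt0n size_eq0.
Qed.

Lemma word_fixed_uniq w x y : w != [::] -> Om x -> Om y -> W w x = x -> W w y = y -> x = y.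
Proof.
move=> w0 Ox Oy fx fy; apply/eqP; rewrite -subr_eq0 -abs_eq0; apply/eqP.
apply: eps_eq0 => [|e e0]; first exact: abs_ge0.
have [K K0 HK] := word_contract_pair Ox Oy.
have [n Hn] := rate_small K e0.
have it u : W w u = u -> W (flatten (nseq n w)) u = u.
  by rewrite -iter_word => fu; elim: n {Hn} => //= n ->.
rewrite -{1}(it x fx) -{1}(it y fy); apply: (le_trans (HK _)); apply: ltW; apply: Hn.
exact: size_iter_word.
Qed.

Section Attractor.
Variable A : set C.
Hypotheses (A0 : A !=set0) (Ac : cclosed A) (AO : A `<=` Om)
  (Af : forall j z, A z -> A (f j z)).

Lemma attractor_bounded : cbounded A.
Proof. by case: tame => [[_ OM] _ _ _ _]; exists M => z /AO/OM. Qed.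

Lemma word_attractor v z : A z -> A (W v z).
Proof. by move=> Az; elim: v => //= j v IH; apply: Af. Qed.

(** By compactness of [A]: near the diagonal [word_lip] applies, and away from it [abs (x - y)] is
    bounded below, so that the pairwise bound suffices. Compactness produces a small constant [c],
    whose inverse is [K]. *)
Lemma word_contract : exists2 K : R, 0 < K &
  forall v x y, A x -> A y -> abs (W v x - W v y) <= K * rate ^+ size v * abs (x - y).
Proof.
have rp n : 0 <= rate ^+ n by rewrite exprn_ge0 // ltW // rate_gt0.
case: (tame) => [[Oo OM] [M0 _] conn _ _].
have [||c c0 Hc] := @uniform_bound2 R A (fun x y c => forall v,
    c * abs (W v x - W v y) <= rate ^+ size v * abs (x - y)) attractor_bounded Ac.
- move=> x y c c' H c'0 cc v; apply: le_trans (H v).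
  by apply: ler_wpM2r => //; exact: abs_ge0.
- move=> x y Ax Ay; have [Ox Oy] := (AO Ax, AO Ay).
  have [r r0 xr] := Oo x Ox; have [s s0 ys] := Oo y Oy.
  have [xy|xy] := eqVneq x y.
    exists (r / (48 * M + 1)); first by rewrite divr_gt0 //; lra.
    exists (r / 24); first by lra.
    move=> x' y' _ _ xx yy v; rewrite mulrAC ler_pdivrMr; last by lra.
    have yr : disc x (r / 24) y' by rewrite xy.
    have := word_lip r0 xr v xx yr.
    have -> : 48 * M / r * rate ^+ size v * abs (x' - y') = 48 * M * (rate ^+ size v * abs (x' - y')) / r by ring.
    rewrite ler_pdivlMr // => h; rewrite mulrC; apply: (le_trans h).
    have : 0 <= rate ^+ size v * abs (x' - y') by rewrite mulr_ge0 // abs_ge0.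
    lra.
  have dxy : 0 < abs (x - y) by rewrite abs_gt0 subr_eq0.
  have [K K0 HK] := word_contract_pair Ox Oy.
  pose B := 48 * M / r * r + K + 48 * M / s * s.
  have B0 : 0 <= B.
    by rewrite /B !divfK ?gt_eqF //; lra.
  exists (abs (x - y) / 2 / (B + 1)); first by rewrite !divr_gt0 //; lra.
  pose m := Num.min (Num.min (r / 24) (s / 24)) (abs (x - y) / 4).
  exists m; first by rewrite !lt_min; apply/andP; split; [apply/andP; split|]; lra.
  move=> x' y' _ _; rewrite !lt_min => /andP[/andP[x1 x2] x3] /andP[/andP[y1 y2] y3] v.
  have xx : disc x (r / 24) x by apply: disc_center; lra.
  have yy : disc y (s / 24) y by apply: disc_center; lra.
  have h1 := word_lip r0 xr v (x1 : disc x (r / 24) x') xx.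
  have h2 := word_lip s0 ys v (y2 : disc y (s / 24) y') yy.
  have h3 := HK v.
  have h4 : abs (W v x' - W v y') <= B * rate ^+ size v.
    apply: (le_trans (abs_dist (W v x) _ _)).
    have := abs_dist (W v y) (W v x) (W v y'); rewrite [abs (W v y - W v y')]absC.
    have k1 : 48 * M / r * rate ^+ size v * abs (x' - x) <= 48 * M / r * rate ^+ size v * r.
      apply: ler_wpM2l; last by lra.
      by rewrite mulr_ge0 // divr_ge0 ?mulr_ge0 // ltW.
    have k2 : 48 * M / s * rate ^+ size v * abs (y' - y) <= 48 * M / s * rate ^+ size v * s.
      apply: ler_wpM2l; last by lra.
      by rewrite mulr_ge0 // divr_ge0 ?mulr_ge0 // ltW.
    rewrite /B; lra.
  have h5 : abs (x - y) / 2 <= abs (x' - y').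
    have := abs_dist x' x y; have := abs_dist y' x' y; rewrite [abs (x - x')]absC; lra.
  rewrite mulrAC ler_pdivrMr; last by lra.
  apply: (@le_trans _ _ (abs (x - y) / 2 * (B * rate ^+ size v))).
    by apply: ler_wpM2l => //; lra.
  have h6 : abs (x - y) / 2 * rate ^+ size v <= abs (x' - y') * rate ^+ size v by apply: ler_wpM2r.
  have h7 := ler_wpM2r (ltac:(lra) : 0 <= B + 1) h6.
  have h8 : 0 <= abs (x - y) / 2 * rate ^+ size v by rewrite mulr_ge0 //; lra.
  lra.
exists c^-1; first by rewrite invr_gt0.
move=> v x y Ax Ay; rewrite -mulrA -ler_pdivrMl ?invr_gt0 // invrK.
exact: Hc.
Qed.

Lemma word_fixed w : w != [::] -> exists2 q, A q & W w q = q.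
Proof.
move=> w0; apply: fixed_point => //; first exact: attractor_bounded.
  move=> z Az e e0; have [[h]] : ccont (W w) z /\ True.
    by split => //; apply: cdiff_cont; apply: word_holo; exact: AO.
  by have [r r0 Hr] := h e e0; exists r => // u _; exact: Hr.
move=> e e0; have [x Ax] := A0; have [K K0 HK] := word_contract.
have [n Hn] := rate_small (K * abs (W w x - x)) e0.
exists (W (flatten (nseq n w)) x); first exact: word_attractor.
have -> : W w (W (flatten (nseq n w)) x) = W (flatten (nseq n w)) (W w x).
  by rewrite -!iter_word -iterS iterSr.
apply: (le_lt_trans (HK _ _ _ (word_attractor w Ax) Ax)); rewrite mulrAC; apply: Hn.
exact: size_iter_word.
Qed.

(** Injectivity excludes a zero multiplier. Its [n]-th power is the derivative at [q] of the
    [n]-fold word, which is at most a constant times [rate ^+ n] in modulus; hence the multiplier is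
    at most [rate] in modulus. *)
Lemma word_multiplier w q : w != [::] -> Om q -> W w q = q ->
  der (W w) q != 0 /\ abs (der (W w) q) < 1.
Proof.
move=> w0 Oq fq; case: (tame) => [[Oo OM] [M0 _] _ _ _].
have [r r0 qr] := Oo q Oq; split.
  apply: (injective_der r0); first exact: holo_sub (word_holo w).
  by move=> x y /qr Ox /qr Oy; apply: word_inj.
apply: le_lt_trans rate_lt1.
apply: (@le_of_powers R _ rate 1 (24 * M / r)) => // [||n]; [exact: abs_ge0|exact/ltW/rate_gt0|].
have E : der (W (flatten (nseq n w))) q = der (W w) q ^+ n.
  apply: der_eq; elim: n => [|n IH]; first by rewrite expr0; exact: cderiv_id.
  have it : W (flatten (nseq n w)) q = q.
    by rewrite -iter_word; elim: (n) => //= m ->.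
  have D : cderiv (fun z => W w (W (flatten (nseq n w)) z)) q (der (W w) q * der (W w) q ^+ n).
    by apply: cderiv_comp => //; rewrite it; apply: derP; exact: word_holo.
  by rewrite exprS; apply: (cderiv_eq D); exists 1 => // z _; rewrite /= word_cat.
rewrite mulr1 -absX -E; apply: (le_trans (word_der_bound _ r0 qr)).
apply: ler_wpM2l; first by rewrite divr_ge0 ?mulr_ge0 // ltW.
apply: ler_wiXn2l; [exact/ltW/rate_gt0|exact/ltW/rate_lt1|exact: size_iter_word].
Qed.

Local Notation S v w := (@conj_map R J Om f v w).

Lemma conj_map_word v w z : Om z -> S v w (W v z) = W v (W w z).
Proof.
move=> Oz; rewrite /conj_map /= pinvKV ?inE //.
by move=> x y; rewrite !inE; exact: word_inj.
Qed.

(** Near [p = W v q] the set-theoretic inverse in [conj_map] is the holomorphic local inverse [h],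
    so the conjugate is holomorphic there; by the chain rule its multiplier is that of [W w] at
    [q]. *)
Lemma conj_map_roots v w : v != [::] -> w != [::] ->
  exists p, exists gs : forall l : nat, 'I_l -> C -> C,
    let D := (W v @` Om : set (Cx R)) in
    [/\ S v w @` D `<=` D, [set z | D z /\ S v w z = z] = [set (p : Cx R)],
      (exists2 r : R, 0 < r & disc p r `<=` D /\ holo (disc p r) (S v w)) &
      forall l, (0 < l)%N ->
      [/\ forall j : 'I_l, local_root D (S v w) p l (gs l j),
          forall i j : 'I_l, i != j -> ~ same_germ (p : Cx R) (gs l i) (gs l j) &
          forall h, local_root D (S v w) p l h -> exists j : 'I_l, same_germ (p : Cx R) h (gs l j)]].
Proof.
move=> v0 w0; have [q Aq fq] := word_fixed w0; have Oq := AO Aq.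
pose p := W v q; pose D : set (Cx R) := W v @` Om.
case: (tame) => [[Oo OM] _ _ _ _].
have [r r0 qr] := Oo q Oq.
have Wv0 : der (W v) q != 0.
  apply: (injective_der r0); first exact: holo_sub (word_holo v).
  by move=> x y /qr Ox /qr Oy; apply: word_inj.
have [r' [rho [h [r'0 r'r rho0 inj hP]]]] :=
  local_inverse r0 (holo_sub qr (word_holo v)) Wv0.
have hO z : disc p rho z -> Om (h z) by move=> /hP[/(disc_sub r'r)/qr].
have pD : disc p rho `<=` D.
  by move=> z zr; have [_ e _ _] := hP z zr; exists (h z); [exact: hO|].
have SE z : disc p rho z -> S v w z = W v (W w (h z)).
  by move=> zr; have [_ e _ _] := hP z zr; rewrite -{1}e conj_map_word //; exact: hO.
have Sh : holo (disc p rho) (S v w).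
  move=> z zr; have [_ _ _ hd] := hP z zr.
  have D1 : cdiff (fun z => W v (W w (h z))) z.
    apply: (@cdiff_comp R (W v) (fun z => W w (h z))); last first.
      by apply: word_holo; apply: word_in; exact: hO.
    apply: cdiff_comp; first exact: cderiv_diff hd.
    by apply: word_holo; exact: hO.
  have [t t0 Ht] := disc_open zr.
  by apply: (cdiff_eq D1); exists t => // u /Ht ur; rewrite SE.
have Sp : S v w p = p by rewrite conj_map_word // fq.
have fixD z : D z -> S v w z = z -> z = p.
  move=> [x Ox <-]; rewrite conj_map_word // => /(word_inj (word_in w Ox) Ox) fx.
  by congr (W v _); apply: (word_fixed_uniq w0).
have [d0 d1] := word_multiplier w0 Oq fq.
have dS : der (S v w) p = der (W w) q.
  have pr := disc_center p rho0.
  have e1 : cderiv (fun z => S v w (W v z)) q (der (S v w) p * der (W v) q).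
    apply: cderiv_comp; first by apply: derP; exact: word_holo.
    by apply: derP; exact: Sh.
  have e2 : cderiv (fun z => W v (W w z)) q (der (W v) q * der (W w) q).
    apply: cderiv_comp; first by apply: derP; exact: word_holo.
    by rewrite fq; apply: derP; exact: word_holo.
  have e3 : cderiv (fun z => S v w (W v z)) q (der (W v) q * der (W w) q).
    by apply: (cderiv_eq e2); exists r => // z /qr Oz; rewrite conj_map_word.
  by apply: (mulIf Wv0); rewrite (cderiv_uniq e1 e3) mulrC.
rewrite -dS in d0 d1.
have [gs Hgs] := local_roots rho0 pD Sh Sp fixD d0 d1.
exists p, gs; split => //.
- move=> _ [_ [x Ox <-] <-]; rewrite conj_map_word //.
  by exists (W w x) => //; exact: word_in.
- apply/seteqP; split => z; first by case=> /= Dz /(fixD z Dz) ->.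
  by move=> /= ->; split => //; apply: pD; exact: disc_center.
- by exists rho.
Qed.

End Attractor.
End IFS.

(** * Distortion, separation and rigidity on the attractor *)

Section Distortion.
Variable R : realType.
Local Notation C := (R[i]).
Implicit Types (r s t e M K L c : R) (x y z a p q : C).

Lemma dq_comp (f g : C -> C) x y : cdiff g y -> cdiff f (g y) -> (g x = g y -> x = y) ->
  dq (fun z => f (g z)) y x = dq f (g y) (g x) * dq g y x.
Proof.
move=> gd fd inj; have [->|xy] := eqVneq x y.
  by rewrite !dq_diag; apply: der_eq; apply: cderiv_comp; exact: derP.
have gxy : g x != g y by apply: contra_neq xy.
by rewrite /dq (negPf xy) (negPf gxy) mulrA divfK // subr_eq0.
Qed.

Lemma dq_id x y : dq id y x = 1.
Proof.
rewrite /dq; case: eqP => [_|/eqP ne]; last by rewrite divff // subr_eq0.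
by apply: der_eq; exact: cderiv_id.
Qed.

Lemma dq_neq0 (f : C -> C) U x y : copen U -> holo U f ->
  (forall x y, U x -> U y -> f x = f y -> x = y) -> U x -> U y -> dq f y x != 0.
Proof.
move=> Uo fh inj Ux Uy; have [->|xy] := eqVneq x y.
  have [r r0 yr] := Uo y Uy; rewrite dq_diag; apply: (injective_der r0).
    exact: holo_sub fh.
  by move=> u w /yr Uu /yr Uw; apply: inj.
rewrite /dq (negPf xy) mulf_neq0 ?invr_eq0 ?subr_eq0 //.
by apply: contra_neq xy; apply: inj.
Qed.

Lemma expR_sub1 (t : R) : expR t - 1 <= t * expR t.
Proof.
have h := expR_ge1Dx (- t).
have := ler_wpM2r (expR_ge0 t) h; rewrite -expRD addNr expR0; lra.
Qed.

Lemma ratio_mul (u w : C) (a b : R) : abs (u - 1) <= a -> abs (w - 1) <= b ->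
  abs (u * w - 1) <= (1 + a) * (1 + b) - 1.
Proof.
move=> ua wb; have -> : u * w - 1 = (u - 1) * (w - 1) + (u - 1) + (w - 1) by ring.
have h1 := abs_addle ((u - 1) * (w - 1) + (u - 1)) (w - 1).
have h2 := abs_addle ((u - 1) * (w - 1)) (u - 1).
have h3 : abs ((u - 1) * (w - 1)) <= a * b by rewrite absM; apply: ler_pM; rewrite ?abs_ge0.
by have := abs_ge0 (u - 1); lra.
Qed.

Variables (J : finType) (Om : set C) (f : J -> C -> C) (M dl : R).
Hypothesis tame : tame_ifs Om f M dl.
Implicit Types (v w : seq J).
Local Notation W := (@word_map R J f).

Variable A : set C.
Hypotheses (A0 : A !=set0) (Ac : cclosed A) (AO : A `<=` Om)
  (Af : forall j z, A z -> A (f j z))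
  (Acov : forall z, A z -> exists j, exists2 y, A y & z = f j y)
  (ssc : forall i j x y, i != j -> A x -> A y -> f i x != f j y).

Let Ab : cbounded A := attractor_bounded tame AO.
Let WA := @word_attractor R J f A Af.

Lemma attractor_abs x y : A x -> A y -> abs (x - y) <= 2 * M.
Proof.
case: (tame) => [[_ OM] _ _ _ _] /AO/OM xM /AO/OM yM.
by apply: (le_trans (abs_suble _ _)); lra.
Qed.

Lemma attractor_room : exists2 r : R, 0 < r & forall x, A x -> disc x r `<=` Om.
Proof.
case: (tame) => [[Oo _] _ _ _ _].
apply: (@uniform_bound R A (fun x c => disc x c `<=` Om)) => //.
- by move=> z c c' Hz _ cc; apply: subset_trans Hz; exact: disc_sub.
- move=> z /AO/Oo[r r0 Hr]; exists (r / 2); first by lra.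
  exists (r / 2); first by lra.
  move=> w _ wz u; rewrite /disc /= => uw; apply: Hr; rewrite /disc /=.
  by have := abs_dist w u z; lra.
Qed.

(** Points closer than [R0] are handled by Cauchy's estimate for [dq (f j) y] on a disc around [x'];
    for distant ones the bound on the divided difference itself suffices. *)
Lemma letter_lip : exists2 L : R, 0 < L & forall j x x' y, A x -> A x' -> A y ->
  abs (dq (f j) y x - dq (f j) y x') <= L * abs (x - x').
Proof.
have [R0 R00 HR] := attractor_room.
case: (tame) => [[Oo OM] [M0 _] _ fhi _].
pose r := R0 / 12; have r0 : 0 < r by rewrite /r; lra.
have rR : 12 * r <= R0 by rewrite /r; lra.
pose B := 2 * M / r; have B0 : 0 <= B by rewrite divr_ge0 ?mulr_ge0 // ltW.
have fM j z : Om z -> abs (f j z) <= M by move=> Oz; apply/OM/(tame_map tame).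
have dB j y z : A y -> Om z -> abs (dq (f j) y z) <= B.
  move=> Ay Oz; have [fh _] := fhi j.
  have [zR|zR] := ltP (abs (z - y)) R0.
    apply: (@dq_bound R (f j) y R0 r M) => //; last exact: disc_center.
      exact: holo_sub (HR y Ay) fh.
    by move=> u /(HR y Ay); exact: fM.
  have zy : z != y by rewrite -subr_eq0 -abs_gt0; lra.
  rewrite /dq (negPf zy) abs_div; apply: ler_pM; rewrite ?invr_ge0 ?abs_ge0 //.
    apply: (le_trans (abs_suble _ _)).
    by have := fM j z Oz; have := fM j y (AO Ay); lra.
  have zp : 0 < abs (z - y) by lra.
  by rewrite lef_pV2 ?posrE //; lra.
have q0 : 0 <= 2 * B / r by apply: divr_ge0; [lra|exact: ltW].
exists (2 * B / r + 1); first by lra.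
move=> j x x' y Ax Ax' Ay; have [fh _] := fhi j.
have [xx|xx] := ltP (abs (x - x')) R0.
  have h : abs (dq (f j) y x - dq (f j) y x') <= 2 * B / r * abs (x - x').
    apply: (@cauchy_lip R (dq (f j) y) x' R0 r B) => //.
    - by apply: holo_sub (HR x' Ax') _; apply: dq_holo => //; exact: AO.
    - by move=> z /(HR x' Ax'); exact: dB.
    - exact: disc_center.
  by apply: (le_trans h); have := abs_ge0 (x - x'); lra.
apply: (@le_trans _ _ (2 * B)).
  apply: (le_trans (abs_suble _ _)).
  by have := dB j y x Ay (AO Ax); have := dB j y x' Ay (AO Ax'); lra.
apply: (@le_trans _ _ (2 * B / r * R0)).
  rewrite mulrAC ler_pdivlMr //; apply: ler_wpM2l; rewrite /r; lra.
by apply: ler_pM => //; lra.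
Qed.

Lemma letter_lower : exists2 c : R, 0 < c & forall j x y, A x -> A y -> c <= abs (dq (f j) y x).
Proof.
have [L L0 HL] := letter_lip; case: (tame) => [[Oo OM] [M0 _] _ fhi _].
suff [c c0 Hc] : exists2 c : R, 0 < c & forall j, forall x y, A x -> A y -> c <= abs (dq (f j) y x) by exists c.
apply: finite_uniform => [j c c' H _ cc x y Ax Ay|j].
  by apply: le_trans cc (H x y Ax Ay).
have [fh fi] := fhi j.
apply: (@uniform_bound2 R A (fun x y c => c <= abs (dq (f j) y x))) => //.
  by move=> x y c c' H _ cc; apply: le_trans cc H.
move=> x y Ax Ay; have d0 : 0 < abs (dq (f j) y x).
  by rewrite abs_gt0; apply: (dq_neq0 Oo fh fi); exact: AO.
exists (abs (dq (f j) y x) / 2); first by lra.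
exists (abs (dq (f j) y x) / (4 * L)); first by rewrite divr_gt0 //; lra.
move=> x' y' Ax' Ay'; rewrite !ltr_pdivlMr; [|lra..] => hx hy.
have h1 := HL j x x' y Ax Ax' Ay; have h2 := HL j y y' x' Ay Ay' Ax'.
rewrite ![dq (f j) x' _]dqC in h2.
have := abs_dist (dq (f j) y x') (dq (f j) y x) (dq (f j) y' x').
have := abs_lesub (dq (f j) y x) (dq (f j) y' x').
rewrite [abs (x - x')]absC in h1; rewrite [abs (y - y')]absC in h2; lra.
Qed.

Lemma word_dq_cons j v x y : A x -> A y ->
  dq (W (j :: v)) y x = dq (f j) (W v y) (W v x) * dq (W v) y x.
Proof.
move=> Ax Ay; case: (tame) => [_ _ _ /(_ j)[fh fi] _].
have Oy := AO Ay; have Ox := AO Ax.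
apply: (@dq_comp (f j) (W v)).
- exact: (word_holo tame).
- by apply: fh; exact: (word_in tame).
- exact: (word_inj tame).
Qed.

Lemma word_dq_neq0 v x y : A x -> A y -> dq (W v) y x != 0.
Proof.
move=> /AO Ox /AO Oy; case: (tame) => [[Oo _] _ _ _ _].
apply: (dq_neq0 Oo (word_holo tame v)) => // u w Ou Ow.
exact: (word_inj tame).
Qed.

Lemma word_dq_cat u v x y : A x -> A y ->
  dq (W (u ++ v)) y x = dq (W u) (W v y) (W v x) * dq (W v) y x.
Proof.
move=> Ax Ay; elim: u => [|j u IH].
  by rewrite [dq (W [::]) _ _]dq_id mul1r.
rewrite cat_cons word_dq_cons // IH word_dq_cons; try exact: WA.
by rewrite !word_cat mulrA.
Qed.

(* Bounded distortion: the defect of the [k]-th factor is [O(rate ^ k)]. *)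
Lemma distortion_ratio : exists2 B : R, 0 < B & forall v x y x' y', A x -> A y -> A x' -> A y' ->
  abs (dq (W v) y x / dq (W v) y' x' - 1) <= B * (abs (x - x') + abs (y - y')).
Proof.
have [L L0 HL] := letter_lip; have [c c0 Hc] := letter_lower.
have [K K0 HK] := word_contract tame Ac AO.
have r0 := rate_gt0 tame; have r1 := rate_lt1 tame.
case: (tame) => [_ [M0 _] _ _ _].
set th := rate M dl in HK r0 r1.
(* Sum of the geometric series of the single-letter distortions [L / c * K * th ^+ k]. *)
pose b := L / c * K / (1 - th).
have b0 : 0 < b by rewrite !(divr_gt0, mulr_gt0) //; lra.
exists (b * expR (b * (4 * M))); first by rewrite mulr_gt0 // expR_gt0.
move=> v x y x' y' Ax Ay Ax' Ay'; pose D := abs (x - x') + abs (y - y').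
have D0 : 0 <= D by rewrite addr_ge0 // abs_ge0.
(* Partial sums of that series, scaled by [D]. The exponential dominates the product of the factors
   one plus defect and makes the induction additive. *)
pose S (n : nat) := b * D * (1 - th ^+ n).
have main : abs (dq (W v) y x / dq (W v) y' x' - 1) <= expR (S (size v)) - 1.
  elim: v => [|j v IH].
    by rewrite ![dq (W [::]) _ _]dq_id divr1 subrr abs0 subr_ge0 -[leLHS]addr0; apply: le_trans (expR_ge1Dx _); rewrite /S expr0 subrr mulr0.
  rewrite !word_dq_cons //.
  have n1 := word_dq_neq0 v Ax Ay; have n2 := word_dq_neq0 v Ax' Ay'.
  have Wx := WA v Ax; have Wy := WA v Ay; have Wx' := WA v Ax'; have Wy' := WA v Ay'.
  have low := Hc j _ _ Wx' Wy'.
  have n3 : dq (f j) (W v y') (W v x') != 0 by rewrite -abs_gt0; lra.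
  have -> : dq (f j) (W v y) (W v x) * dq (W v) y x / (dq (f j) (W v y') (W v x') * dq (W v) y' x')
     = (dq (f j) (W v y) (W v x) / dq (f j) (W v y') (W v x')) * (dq (W v) y x / dq (W v) y' x').
    by field; rewrite n2 n3.
  have tn : 0 <= th ^+ size v by rewrite exprn_ge0 // ltW.
  have h : abs (dq (f j) (W v y) (W v x) / dq (f j) (W v y') (W v x') - 1) <=
      L / c * K * D * th ^+ size v.
    have -> : dq (f j) (W v y) (W v x) / dq (f j) (W v y') (W v x') - 1 =
       (dq (f j) (W v y) (W v x) - dq (f j) (W v y') (W v x')) / dq (f j) (W v y') (W v x').
      by field.
    rewrite abs_div ler_pdivrMr; last by lra.
    have h1 := HL j _ _ _ Wx Wx' Wy; have h2 := HL j _ _ _ Wy Wy' Wx'.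
    rewrite ![dq (f j) (W v x') _]dqC in h2.
    apply: (le_trans (abs_dist (dq (f j) (W v y) (W v x')) _ _)).
    have k1 := HK v x x' Ax Ax'; have k2 := HK v y y' Ay Ay'.
    have k3 := ler_wpM2l (ltW L0) k1; have k4 := ler_wpM2l (ltW L0) k2.
    apply: (@le_trans _ _ (L * (K * th ^+ size v * D))).
      by rewrite /D mulrDr mulrDr; lra.
    have -> : L * (K * th ^+ size v * D) = L / c * K * D * th ^+ size v * c by field; rewrite gt_eqF.
    by apply: ler_wpM2l => //; rewrite !mulr_ge0 ?invr_ge0 // ltW.
  apply: (le_trans (ratio_mul h IH)); rewrite lerD2r.
  have -> : 1 + (expR (S (size v)) - 1) = expR (S (size v)) by ring.
  have -> : S (size (j :: v)) = L / c * K * D * th ^+ size v + S (size v).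
    have c1 : c != 0 by rewrite gt_eqF.
    have th1 : 1 - th != 0 by rewrite subr_eq0 gt_eqF.
    by rewrite /S /b /= exprS; field; rewrite ?c1 ?th1.
  rewrite expRD; apply: ler_wpM2r; first exact: expR_ge0.
  exact: expR_ge1Dx.
have SD : S (size v) <= b * D.
  rewrite -[leRHS]mulr1; apply: ler_wpM2l; first by rewrite mulr_ge0 // ltW.
  by rewrite gerBl exprn_ge0 // ltW.
have DM : D <= 4 * M.
  by have := attractor_abs Ax Ax'; have := attractor_abs Ay Ay'; rewrite /D; lra.
have bD0 : 0 <= b * D by rewrite mulr_ge0 // ltW.
apply: (le_trans main).
have e1 : expR (S (size v)) <= expR (b * D) by rewrite ler_expR.
apply: (@le_trans _ _ (b * D * expR (b * D))).
  by have := expR_sub1 (b * D); lra.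
have e2 : expR (b * D) <= expR (b * (4 * M)).
  by rewrite ler_expR; apply: ler_wpM2l => //; exact: ltW.
by have := ler_wpM2l bD0 e2; rewrite -/D; lra.
Qed.

Lemma distortion : exists2 D : R, 0 < D & forall v x y x' y', A x -> A y -> A x' -> A y' ->
  abs (dq (W v) y x) <= D * abs (dq (W v) y' x').
Proof.
have [B B0 HB] := distortion_ratio; case: (tame) => [_ [M0 _] _ _ _].
exists (1 + B * (4 * M)); first by rewrite ltr_pwDl // mulr_ge0 //; lra.
move=> v x y x' y' Ax Ay Ax' Ay'.
have n0 : 0 < abs (dq (W v) y' x') by rewrite abs_gt0; exact: word_dq_neq0.
rewrite -ler_pdivrMr // -abs_div.
have h := HB v x y x' y' Ax Ay Ax' Ay'.
have h1 := abs_lesub (dq (W v) y x / dq (W v) y' x') 1; rewrite abs1 in h1.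
have h2 : B * (abs (x - x') + abs (y - y')) <= B * (4 * M).
  apply: ler_wpM2l; first exact: ltW.
  by have := attractor_abs Ax Ax'; have := attractor_abs Ay Ay'; lra.
lra.
Qed.

Lemma letter_gap : exists2 g : R, 0 < g &
  forall i j x y, i != j -> A x -> A y -> g <= abs (f i x - f j y).
Proof.
suff [c c0 Hc] : exists2 c : R, 0 < c & forall ij : J * J, forall x y, ij.1 != ij.2 -> A x -> A y ->
    c <= abs (f ij.1 x - f ij.2 y).
  by exists c => // i j x y ij Ax Ay; exact: (Hc (i, j)).
apply: finite_uniform => [ij c c' H _ cc x y ne Ax Ay|[i j] /=].
  by apply: le_trans cc (H x y ne Ax Ay).
have [ij|ij] := eqVneq i j; first by exists 1 => // x y.
case: (tame) => [_ _ _ fhi _].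
have [fi _] := fhi i; have [fj _] := fhi j.
have [||c c0 Hc] := @uniform_bound2 R A (fun x y c => c <= abs (f i x - f j y)) Ab Ac.
- by move=> x y c c' H _ cc; apply: le_trans cc H.
- move=> x y Ax Ay; have d0 : 0 < abs (f i x - f j y) by rewrite abs_gt0 subr_eq0; exact: ssc.
  have [ci] := cdiff_cont (fi x (AO Ax)); have [cj] := cdiff_cont (fj y (AO Ay)).
  exists (abs (f i x - f j y) / 2); first by lra.
  have [r r0 Hr] := ci (abs (f i x - f j y) / 4) ltac:(lra).
  have [s s0 Hs] := cj (abs (f i x - f j y) / 4) ltac:(lra).
  exists (Num.min r s); first by rewrite lt_min r0.
  move=> x' y' _ _; rewrite !lt_min => /andP[/Hr h1 _] /andP[_ /Hs h2].
  have := abs_dist (f i x') (f i x) (f j y); have := abs_dist (f j y') (f i x') (f j y).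
  rewrite [abs (f i x - f i x')]absC; lra.
by exists c => // x y _; exact: Hc.
Qed.

Lemma code_word n x : A x -> exists v, size v = n /\ exists2 y, A y & x = W v y.
Proof.
elim: n x => [|n IH] x Ax; first by exists [::]; split => //; exists x.
have [j [y Ay ->]] := Acov Ax; have [v [sv [z Az ->]]] := IH y Ay.
by exists (j :: v); split; [rewrite /= sv|exists z].
Qed.

(** Separation lets the first letter be read off from a single point of the image, and injectivity
    strips it. *)
Lemma word_prefix v v' x x' : A x -> A x' -> W v x = W v' x' -> (size v <= size v')%N ->
  exists w, v' = v ++ w.
Proof.
move=> Ax Ax'; elim: v v' => [|j v IH] [|k v'] //=; first by exists [::].
- by exists (k :: v').
- move=> e; rewrite ltnS => sz; have [jk|jk] := eqVneq j k; last first.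
    by have := ssc jk (WA v Ax) (WA v' Ax'); rewrite e eqxx.
  case: (tame) => [_ _ _ /(_ k)[_ fi] _].
  rewrite -jk in e fi *.
  have [w ->] := IH v' (fi _ _ (AO (WA v Ax)) (AO (WA v' Ax')) e) sz.
  by exists w.
Qed.

Lemma split_word w y : A y -> ~ (exists2 z, A z & y = W w z) ->
  exists u j u', [/\ w = u ++ j :: u', exists2 z, A z & y = W u z &
     ~ exists2 z, A z & y = W (rcons u j) z].
Proof.
move=> Ay; elim/last_ind: w => [|w j IH] ny; first by exfalso; apply: ny; exists y.
have [yw|nyw] := pselect (exists2 z, A z & y = W w z).
  by exists w, j, [::]; split => //; rewrite cats1.
have [u [k [u' [-> yu nyu]]]] := IH nyw.
by exists u, k, (rcons u' j); split => //; rewrite rcons_cat.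
Qed.

Lemma word_rcons v j z : W (rcons v j) z = W v (f j z).
Proof. by rewrite -cats1 word_cat. Qed.

(** Let [u] be the part of [w] before the letter at which [y] leaves the cylinders of [w]. Inside
    [W u] the two points come from different first-level pieces, at least [g] apart; bounded
    distortion scales this gap by the size of [W u], which dominates that of [W w]. *)
Lemma cylinder_gap (a : C) : A a -> exists2 c : R, 0 < c & forall w x y, A x -> A y ->
  ~ (exists2 z, A z & y = W w z) -> c * abs (dq (W w) a a) <= abs (y - W w x).
Proof.
move=> Aa; have [D D0 HD] := distortion; have [g g0 Hg] := letter_gap.
(* A second point of [A] turns contraction into a bound on derivatives, through bounded distortion.
   If [A] is a single point, every word fixes it with a multiplier of modulus at most [1]. *)
have [K K0 HK] : exists2 K : R, 0 < K & forall v, abs (dq (W v) a a) <= K.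
  have [K K0 HK] := word_contract tame Ac AO.
  have r0 := rate_gt0 tame; have r1 := rate_lt1 tame.
  have [[b Ab' ba]|nb] := pselect (exists2 b, A b & b != a); last first.
    have one b : A b -> b = a.
      by move=> Ab'; apply/eqP; apply: contrapT => /negP ba; apply: nb; exists b.
    exists 1 => // v; have [v0|v0] := eqVneq v [::].
      by rewrite v0 dq_diag (der_eq (cderiv_id a)) abs1.
    rewrite dq_diag; apply: ltW.
    have Wa : W v a = a by apply: one; exact: WA.
    by have [] := word_multiplier tame v0 (AO Aa) Wa.
  exists (D * K); first by rewrite mulr_gt0.
  move=> v; apply: (le_trans (HD v a a b a Aa Aa Ab' Aa)); apply: ler_wpM2l; first exact: ltW.
  have ba0 : 0 < abs (b - a) by rewrite abs_gt0 subr_eq0.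
  rewrite -(ler_pM2r ba0) -absM -dqE; apply: (le_trans (HK v b a Ab' Aa)).
  apply: ler_wpM2r; first exact: abs_ge0.
  rewrite -[leRHS]mulr1; apply: ler_wpM2l; first exact: ltW.
  by apply: exprn_ile1; apply: ltW.
exists (g / (D * (D * K))); first by rewrite divr_gt0 // !mulr_gt0.
move=> w x y Ax Ay ny.
have [u [j [u' [-> [y' Ay' yE] nyu]]]] := split_word Ay ny.
have [k [y'' Ay'' y'E]] := Acov Ay'.
have kj : k != j.
  apply/eqP => kj; apply: nyu; exists y'' => //.
  by rewrite word_rcons -kj -y'E.
rewrite word_cat yE y'E dqE absM word_dq_cat // absM.
have h1 := Hg k j _ _ kj Ay'' (WA u' Ax).
have A1 : A (f k y'') by exact: Af.
have A2 : A (f j (W u' x)) by apply: Af; exact: WA.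
have A3 : A (W (j :: u') a) by exact: WA.
have h2 := HD u (W (j :: u') a) (W (j :: u') a) _ _ A3 A3 A1 A2.
have h3 := HK (j :: u').
rewrite mulrAC ler_pdivrMr ?mulr_gt0 //.
apply: (@le_trans _ _ (g * (D * abs (dq (W u) (f j (W u' x)) (f k y'')) * K))).
  by apply: ler_wpM2l; [exact: ltW|apply: ler_pM; rewrite ?abs_ge0].
apply: (@le_trans _ _ (abs (f k y'' - f j (W u' x)) * (D * abs (dq (W u) (f j (W u' x)) (f k y'')) * K))).
  by apply: ler_wpM2r => //; rewrite !mulr_ge0 ?abs_ge0 // ltW.
have D1 : 1 <= D.
  have := HD u _ _ _ _ A3 A3 A3 A3.
  rewrite -{1}[abs _]mul1r ler_pM2r // abs_gt0; exact: word_dq_neq0.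
have k0 : 0 <= abs (dq (W u) (f j (W u' x)) (f k y'')) * abs (f k y'' - f j (W u' x)) * (D * K).
  by rewrite !mulr_ge0 ?abs_ge0 // ltW.
have := ler_wpM2r k0 D1; rewrite /=; lra.
Qed.

(* If [u] moved some cylinder [W v @` A] into itself but not the child containing
   [y], it would move [y] by a definite fraction of the size of the cylinder, and
   all its points by nearly the same vector; iterating [u] then leaves the cylinder. *)
Lemma rigidity : exists2 eta : R, 0 < eta & forall u : C -> C, (forall x, A x -> A (u x)) ->
  (forall x y, A x -> A y -> abs ((u x - u y) - (x - y)) <= eta * abs (x - y)) ->
  forall x, A x -> u x = x.
Proof.
have [D D0 HD] := distortion; have [g g0 Hg] := letter_gap.
have [K K0 HK] := word_contract tame Ac AO.
case: (tame) => [_ [M0 _] _ _ _].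
(* If a point of a cylinder is moved into another child by [d], every point of the cylinder is
   within [T * d] of it: [d] is at least [g] times a divided difference, and the distances are at
   most [2 * M * D] times the same one. *)
pose T := 2 * M * D / g.
have T0 : 0 <= T by rewrite divr_ge0 ?mulr_ge0 // ltW.
pose eta := (2 * T + 1)^-1.
have eta0 : 0 < eta by rewrite invr_gt0; lra.
have etaT : eta * T <= 1 / 2.
  by rewrite mulrC ler_pdivrMr; lra.
exists eta => // u uA ueta.
have cyl v : forall z, A z -> exists2 z', A z' & u (W v z) = W v z'.
  elim/last_ind: v => [|v j IH] z Az; first by exists (u z) => //; exact: uA.
  have Afz := Af j Az; have [z' Az' uE] := IH _ Afz.
  have [k [z'' Az'' z'E]] := Acov Az'.
  have [kj|kj] := eqVneq k j.
    by exists z'' => //; rewrite !word_rcons uE z'E kj.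
  exfalso; pose y := W v (f j z); pose d := abs (u y - y).
  have Ay : A y by exact: WA.
  have A1 : A (f k z'') by exact: Af.
  have dE : d = abs (dq (W v) (f j z) (f k z'')) * abs (f k z'' - f j z).
    by rewrite /d /y uE z'E dqE absM.
  have q0 : 0 < abs (dq (W v) (f j z) (f k z'')) by rewrite abs_gt0; exact: word_dq_neq0.
  have gd := Hg k j _ _ kj Az'' Az.
  have d0 : 0 < d by rewrite dE mulr_gt0 //; lra.
  have diam (w : C) : A w -> abs (W v w - y) <= T * d.
    move=> Aw; rewrite dqE absM dE.
    have h1 := HD v w (f j z) (f k z'') (f j z) Aw Afz A1 Afz.
    have h2 := attractor_abs Aw Afz.
    apply: (@le_trans _ _ (D * abs (dq (W v) (f j z) (f k z'')) * (2 * M))).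
      by apply: ler_pM; rewrite ?abs_ge0.
    rewrite /T; set qq := abs _; set pp := abs _.
    have -> : 2 * M * D / g * (qq * pp) = 2 * M * D * (qq * pp) / g by ring.
    rewrite ler_pdivlMr //.
    have k0 : 0 <= 2 * M * D * qq by rewrite !mulr_ge0 ?abs_ge0 // ltW.
    by have := ler_wpM2l k0 gd; rewrite -/pp; lra.
  have it n : exists2 w, A w & iter n u y = W v w.
    elim: n => [|n [w Aw E]]; first by exists (f j z).
    by rewrite iterS E; exact: IH.
  (* Every iterate stays in the parent cylinder, hence within [T * d] of [y], so each step differs
     from [u y - y] by at most [eta * T * d <= d / 2]. After [N > 2 * T] steps the displacement
     exceeds [T * d]. *)
  have moved n : abs (iter n u y - y - n%:R * (u y - y)) <= n%:R * (d / 2).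
    elim: n => [|n IHn]; first by rewrite subrr !mul0r subr0 abs0.
    have [w Aw E] := it n.
    have Ai : A (iter n u y) by rewrite E; exact: WA.
    have h := ueta _ _ Ai Ay.
    have h2 : eta * abs (iter n u y - y) <= d / 2.
      rewrite E; apply: (le_trans (ler_wpM2l (ltW eta0) (diam w Aw))).
      have := ler_wpM2r (ltW d0) etaT; lra.
    rewrite -!(natr1 n) iterS.
    have -> : u (iter n u y) - y - (n%:R + 1) * (u y - y) =
      (iter n u y - y - n%:R * (u y - y)) + (u (iter n u y) - u y - (iter n u y - y)) by ring.
    apply: (le_trans (abs_addle _ _)); rewrite mulrDl mul1r.
    by apply: lerD => //; exact: (le_trans h h2).
  pose N := (Num.truncn (2 * T)).+1.
  have TN : 2 * T < N%:R by exact: truncnS_gt.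
  have [w Aw E] := it N.
  have h1 := moved N; have h2 := diam w Aw; rewrite -E in h2.
  have h3 := abs_lesub (N%:R * (u y - y)) (N%:R * (u y - y) - (iter N u y - y)).
  rewrite subKr absM abs_nat -/d in h3.
  have h4 : 2 * T * d < N%:R * d by rewrite ltr_pM2r.
  by rewrite [leLHS]absC in h1; lra.
(* [u] preserves every cylinder, and the cylinders containing [x] shrink to [x]. *)
move=> x Ax; apply/eqP; rewrite -subr_eq0 -abs_eq0; apply/eqP.
apply: eps_eq0 => [|e e0]; first exact: abs_ge0.
have [n Hn] := rate_small tame (K * (2 * M)) e0.
have [v [sv [y Ay xE]]] := code_word n Ax.
have [z Az uE] := cyl v y Ay.
rewrite xE uE; apply: (le_trans (HK v z y Az Ay)).
have kt : 0 <= K * rate M dl ^+ size v.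
  by rewrite mulr_ge0 ?exprn_ge0 // ltW // (rate_gt0 tame).
apply: (le_trans (ler_wpM2l kt (attractor_abs Az Ay))).
by have := Hn n (leqnn n); rewrite sv; lra.
Qed.

End Distortion.

(** * Two systems with the same attractor *)

Lemma nat_pigeonhole (T : finType) (F : nat -> T) : exists m n, (m < n)%N /\ F m = F n.
Proof.
apply: contrapT => H.
have inj : injective (fun i : 'I_#|T|.+1 => F i).
  move=> i j ij; apply/val_inj => /=; case: (ltngtP i j) => // lij; exfalso; apply: H.
    by exists i, j.
  by exists j, i.
by have := leq_card _ inj; rewrite card_ord ltnn.
Qed.

Lemma nat_max (P : nat -> Prop) N k0 : P k0 -> (forall k, P k -> (k <= N)%N) ->
  exists2 k, P k & forall k', P k' -> (k' <= k)%N.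
Proof.
move=> P0 PN.
have ex : exists k, `[<P k>] by exists k0; apply/asboolP.
have ub k : `[<P k>] -> (k <= N)%N by move=> /asboolP/PN.
by case: (ex_maxnP ex ub) => k /asboolP Pk Hk; exists k => // k' Pk'; apply: Hk; apply/asboolP.
Qed.

Section TwoIFS.
Variable R : realType.
Local Notation C := (R[i]).
Implicit Types (r s t e M K L c : R) (x y z a p q : C).

(** A finite form of the Arzela-Ascoli theorem: arguments are sampled on a net of [A] and values
    rounded to a net of the disc of radius [M], so only finitely many patterns occur. The index [b]
    lets several families be close for the same [m] and [n]. *)
Lemma equicontinuous_close (B : finType) (A : set C) (Phi : nat -> B -> C -> C -> C) M L e :
  cbounded A -> 0 < L -> 0 < e ->
  (forall n b x y, A x -> A y -> abs (Phi n b x y) <= M) ->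
  (forall n b x y x' y', A x -> A y -> A x' -> A y' ->
     abs (Phi n b x y - Phi n b x' y') <= L * (abs (x - x') + abs (y - y'))) ->
  exists m n, (m < n)%N /\
    forall b x y, A x -> A y -> abs (Phi n b x y - Phi m b x y) <= e.
Proof.
move=> Ab L0 e0 PM PL.
pose rho := e / (8 * L); have rho0 : 0 < rho by rewrite divr_gt0 //; lra.
have [t [tA tnet]] := finite_net Ab rho0.
have [s [_ snet]] := finite_net (bounded_disc 0 M) (ltac:(lra) : 0 < e / 4).
pose near z := xget 0 [set a | a \in s /\ abs (z - a) < e / 4].
have nearP z : abs z <= M -> near z \in s /\ abs (z - near z) < e / 4.
  move=> zM; have [|a sa za] := snet z; first by rewrite /= subr0.
  by rewrite /near; case: xgetP => [b -> //|/(_ a)]; case.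
pose F n : {ffun B * 'I_(size t) * 'I_(size t) -> 'I_(size s).+1} :=
  [ffun k : B * 'I_(size t) * 'I_(size t) => inord (index (near (Phi n k.1.1 (t`_k.1.2) (t`_k.2))) s)].
have [m [n [mn Fmn]]] := nat_pigeonhole F.
exists m, n; split => // b x y Ax Ay.
have [a ta xa] := tnet x Ax; have [a' ta' ya'] := tnet y Ay.
have Aa := tA a ta; have Aa' := tA a' ta'.
have [N1 k1] := nearP _ (PM m b a a' Aa Aa'); have [N2 k2] := nearP _ (PM n b a a' Aa Aa').
have E : near (Phi m b a a') = near (Phi n b a a').
  have i1 : (index a t < size t)%N by rewrite index_mem.
  have i2 : (index a' t < size t)%N by rewrite index_mem.
  have := congr1 (fun G : {ffun _} => G (b, Ordinal i1, Ordinal i2)) Fmn.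
  rewrite !ffunE /= !nth_index // => /(congr1 val) /=.
  rewrite !inordK ?ltnS ?index_size // => ii.
  by rewrite -(nth_index 0 N1) ii nth_index.
have h1 := PL m b x y a a' Ax Ay Aa Aa'; have h2 := PL n b x y a a' Ax Ay Aa Aa'.
have h3 : L * (abs (x - a) + abs (y - a')) <= e / 4.
  have : abs (x - a) + abs (y - a') <= rho + rho by lra.
  move/(ler_wpM2l (ltW L0)) => h; apply: (le_trans h).
  by rewrite le_eqVlt /rho; apply/orP; left; apply/eqP; field; rewrite gt_eqF.
rewrite E in k1.
have -> : Phi n b x y - Phi m b x y = (Phi n b x y - Phi n b a a') +
   ((Phi n b a a' - near (Phi n b a a')) - (Phi m b a a' - near (Phi n b a a')))
   - (Phi m b x y - Phi m b a a') by ring.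
apply: (le_trans (abs_suble _ _)).
have := abs_addle (Phi n b x y - Phi n b a a')
  ((Phi n b a a' - near (Phi n b a a')) - (Phi m b a a' - near (Phi n b a a'))).
have := abs_suble (Phi n b a a' - near (Phi n b a a')) (Phi m b a a' - near (Phi n b a a')).
lra.
Qed.

Variables (J : finType) (OmF : set C) (f : J -> C -> C) (MF dF : R).
Variables (I : finType) (OmG : set C) (g : I -> C -> C) (MG dG : R).
Hypotheses (tameF : tame_ifs OmF f MF dF) (tameG : tame_ifs OmG g MG dG).
Variable A : set C.
Hypotheses (Ac : cclosed A) (AF : A `<=` OmF) (AG : A `<=` OmG)
  (fA : forall j z, A z -> A (f j z)) (gA : forall j z, A z -> A (g j z))
  (fcov : forall z, A z -> exists j, exists2 y, A y & z = f j y)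
  (gcov : forall z, A z -> exists j, exists2 y, A y & z = g j y)
  (fssc : forall i j x y, i != j -> A x -> A y -> f i x != f j y)
  (gssc : forall i j x y, i != j -> A x -> A y -> g i x != g j y).
Variables (b1 b2 : C).
Hypotheses (Ab1 : A b1) (Ab2 : A b2) (b12 : b1 != b2).
Implicit Types (v w : seq J) (i : I).

Local Notation W := (@word_map R J f).
Local Notation V i n := (@word_map R I g (nseq n i)).

Lemma word_nseq i n z : V i n z = iter n (g i) z.
Proof. by elim: n => //= n ->. Qed.

Lemma word_nseqD i m n z : V i (m + n) z = V i m (V i n z).
Proof. by rewrite !word_nseq iterD. Qed.

Let FA := @word_attractor R J f A fA.
Let GA := @word_attractor R I g A gA.

(** The lengths are bounded because cylinders shrink as words grow, whereas the distinct points
    [V i n b1] and [V i n b2] must both lie in the cylinder; the empty word is always admissible. *)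
Lemma longest_word i n : exists v, (forall x, A x -> exists2 y, A y & V i n x = W v y) /\
  forall v', (forall x, A x -> exists2 y, A y & V i n x = W v' y) -> (size v' <= size v)%N.
Proof.
pose P k := exists v, size v = k /\ forall x, A x -> exists2 y, A y & V i n x = W v y.
have d0 : 0 < abs (V i n b1 - V i n b2).
  rewrite abs_gt0 subr_eq0; apply: contra_neq b12 => e.
  exact: (word_inj tameG (AG Ab1) (AG Ab2) e).
have [K K0 HK] := word_contract tameF Ac AF.
have [N HN] := rate_small tameF (K * (2 * MF)) d0.
have [|k Pk|k [v [<- Hv]] kmax] := @nat_max P N 0%N.
- by exists [::]; split => // x Ax; exists (V i n x) => //; exact: GA.
- case: Pk => v [<- Hv]; rewrite leqNgt; apply/negP => Nv.
  have [y1 A1 e1] := Hv b1 Ab1; have [y2 A2 e2] := Hv b2 Ab2.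
  have := HN _ (ltnW Nv); rewrite ltNge => /negP; apply.
  rewrite e1 e2; apply: (le_trans (HK v y1 y2 A1 A2)).
  have kt : 0 <= K * rate MF dF ^+ size v.
    by rewrite mulr_ge0 ?exprn_ge0 // ltW // (rate_gt0 tameF).
  by have := ler_wpM2l kt (attractor_abs tameF AF A1 A2); lra.
- by exists v; split => // v' Hv'; apply: kmax; exists v'.
Qed.

(* The rescaled iterates [h n = (W (v n))^-1 \o g i ^ n] form an equicontinuous
   family of maps of [A] into itself whose images are uniformly open in [A]; two
   of them that are close enough differ by a map covered by [rigidity]. *)
Lemma two_iterates_agree i : exists m n v v', [/\ (m < n)%N,
  forall v', (forall x, A x -> exists2 y, A y & V i n x = W v' y) -> (size v' <= size v)%N &
  forall x, A x -> exists2 y, A y & V i n x = W v y /\ V i m x = W v' y].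
Proof.
have [v Hv] := choice (longest_word i).
have hex n : exists h : C -> C, forall x, A x -> A (h x) /\ V i n x = W (v n) (h x).
  have [Hn _] := Hv n.
  have H x : exists y, A x -> A y /\ V i n x = W (v n) y.
    have [Ax|nAx] := pselect (A x); last by exists 0.
    by have [y Ay e] := Hn x Ax; exists y.
  by have [h Hh] := choice H; exists h.
have [h Hh] := choice hex.
have hA n x : A x -> A (h n x) by move=> /(Hh n)[].
have hE n x : A x -> V i n x = W (v n) (h n x) by move=> /(Hh n)[].
have [gam gam0 Hgam] := letter_gap tameF Ac AF fssc.
(* By maximality of [v n]: if every [h n x] were closer than [gam] to [h n b1], all would lie in the
   same child [j], and the longer word [rcons (v n) j] would be admissible. *)
have hsplit n : exists x y, [/\ A x, A y & gam <= abs (h n x - h n y)].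
  apply: contrapT => no; have [j [y1 Ay1 e1]] := fcov (hA n _ Ab1).
  have := (Hv n).2 (rcons (v n) j); rewrite size_rcons ltnn => H; suff : false by [].
  apply: H => x Ax; have [k [y Ay e]] := fcov (hA n _ Ax).
  have [kj|kj] := eqVneq k j; first by exists y => //; rewrite hE // e word_rcons kj.
  exfalso; apply: no; exists x, b1; split => //; rewrite e e1; exact: Hgam.
have [DF DF0 HDF] := distortion tameF Ac AF fA.
have [DG DG0 HDG] := distortion tameG Ac AG gA.
(* The divided difference of [h n], written as a quotient of divided differences of words; it makes
   sense on the diagonal although [h n] is controlled only on [A]. *)
pose Q n x y := dq (V i n) y x / dq (W (v n)) (h n y) (h n x).
have F0 n x y : A x -> A y -> dq (W (v n)) (h n y) (h n x) != 0.
  by move=> Ax Ay; apply: (word_dq_neq0 tameF AF); exact: hA.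
have G0 n x y : A x -> A y -> dq (V i n) y x != 0.
  by move=> Ax Ay; apply: (word_dq_neq0 tameG AG).
have hQ n x y : A x -> A y -> h n x - h n y = Q n x y * (x - y).
  move=> Ax Ay; rewrite /Q mulrAC -dqE !hE // [X in _ = X / _](dqE (W (v n))).
  by rewrite mulrAC divff ?mul1r // F0.
pose sig n := abs (dq (V i n) b1 b1); pose sc n := abs (dq (W (v n)) b1 b1).
have sig0 n : 0 < sig n by rewrite abs_gt0; exact: G0.
have sc0 n : 0 < sc n by rewrite abs_gt0; apply: (word_dq_neq0 tameF AF).
(* Ratio of the scales of [V i n] and [W (v n)] at [b1]; by bounded distortion every [Q n x y] is
   comparable with it up to the factor [E]. It is bounded above because [h n] maps into the bounded
   set [A], and below by [hsplit]. *)
pose tau n := sig n / sc n; have tau0 n : 0 < tau n by rewrite divr_gt0.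
pose E := DF * DG; have E0 : 0 < E by rewrite mulr_gt0.
have Qup n x y : A x -> A y -> abs (Q n x y) <= E * tau n.
  move=> Ax Ay; rewrite /Q abs_div ler_pdivrMr ?abs_gt0 ?F0 //.
  apply: (le_trans (HDG _ x y b1 b1 Ax Ay Ab1 Ab1)).
  have := HDF (v n) b1 b1 _ _ Ab1 Ab1 (hA n x Ax) (hA n y Ay) => k.
  have -> : E * tau n * abs (dq (W (v n)) (h n y) (h n x)) =
     (DG * sig n / sc n) * (DF * abs (dq (W (v n)) (h n y) (h n x))).
    by rewrite /E /tau; ring.
  apply: (@le_trans _ _ (DG * sig n / sc n * sc n)); first by rewrite divfK ?gt_eqF.
  by apply: ler_wpM2l => //; rewrite !mulr_ge0 ?invr_ge0 // ltW.
have Qlow n x y : A x -> A y -> tau n <= E * abs (Q n x y).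
  move=> Ax Ay; rewrite /Q abs_div mulrA ler_pdivlMr ?abs_gt0 ?F0 //.
  have k1 := HDF (v n) _ _ b1 b1 (hA n x Ax) (hA n y Ay) Ab1 Ab1.
  have k2 := HDG _ b1 b1 x y Ab1 Ab1 Ax Ay.
  apply: (@le_trans _ _ (tau n * (DF * sc n))).
    by apply: ler_wpM2l => //; exact: ltW.
  have -> : tau n * (DF * sc n) = DF * sig n by rewrite /tau; field; rewrite gt_eqF.
  by rewrite /E -mulrA; apply: ler_wpM2l; [exact: ltW|exact: k2].
have d12 : 0 < abs (b1 - b2) by rewrite abs_gt0 subr_eq0.
have MF0 : 0 < 2 * MF by apply: lt_le_trans d12 (attractor_abs tameF AF Ab1 Ab2).
have tauup n : tau n <= E * (2 * MF / abs (b1 - b2)).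
  apply: (le_trans (Qlow n b1 b2 Ab1 Ab2)); apply: ler_wpM2l; first exact: ltW.
  by rewrite ler_pdivlMr // -absM -hQ //; apply: (attractor_abs tameF AF); exact: hA.
pose t0 := gam / (2 * MF) / E.
have t00 : 0 < t0 by rewrite !divr_gt0.
have taulow n : t0 <= tau n.
  have [x [y [Ax Ay xy]]] := hsplit n.
  rewrite /t0 ler_pdivrMr // ler_pdivrMr //; apply: (le_trans xy).
  rewrite hQ // absM; apply: ler_pM; rewrite ?abs_ge0 //.
    by rewrite mulrC; exact: Qup.
  exact: (attractor_abs tameF AF).
pose C1 := E * (E * (2 * MF / abs (b1 - b2))).
have C10 : 0 < C1 by rewrite mulr_gt0 // mulr_gt0 // divr_gt0.
have QC n x y : A x -> A y -> abs (Q n x y) <= C1.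
  move=> Ax Ay; apply: (le_trans (Qup n x y Ax Ay)).
  by apply: ler_wpM2l => //; exact: ltW.
clearbody C1.
pose c1 := t0 / E; have c10 : 0 < c1 by rewrite divr_gt0.
have Qc n x y : A x -> A y -> c1 <= abs (Q n x y).
  move=> Ax Ay; rewrite /c1 ler_pdivrMr // mulrC.
  exact: le_trans (taulow n) (Qlow n x y Ax Ay).
clearbody c1.
have [BF BF0 HBF] := distortion_ratio tameF Ac AF fA.
have [BG BG0 HBG] := distortion_ratio tameG Ac AG gA.
have hlip n x y : A x -> A y -> abs (h n x - h n y) <= C1 * abs (x - y).
  by move=> Ax Ay; rewrite hQ // absM; apply: ler_wpM2r; [exact: abs_ge0|exact: QC].
pose C2 := C1 * (DG * (BF * C1) + BG).
have C20 : 0 < C2.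
  by apply: mulr_gt0 => //; apply: addr_gt0 => //; apply: mulr_gt0 => //; exact: mulr_gt0.
have Qlip n x y x' y' : A x -> A y -> A x' -> A y' ->
    abs (Q n x y - Q n x' y') <= C2 * (abs (x - x') + abs (y - y')).
  move=> Ax Ay Ax' Ay'.
  pose rG := dq (V i n) y x / dq (V i n) y' x'.
  pose rF := dq (W (v n)) (h n y') (h n x') / dq (W (v n)) (h n y) (h n x).
  have n1 := F0 n x y Ax Ay; have n2 := F0 n x' y' Ax' Ay'.
  have n3 := G0 n x y Ax Ay; have n4 := G0 n x' y' Ax' Ay'.
  have -> : Q n x y - Q n x' y' = Q n x' y' * (rG * (rF - 1) + (rG - 1)).
    by rewrite /Q /rG /rF; field; rewrite n1 n2 n4.
  have k1 : abs rG <= DG.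
    by rewrite /rG abs_div ler_pdivrMr ?abs_gt0 //; exact: HDG.
  have k2 := HBG _ x y x' y' Ax Ay Ax' Ay'.
  have k3 := HBF (v n) _ _ _ _ (hA n x' Ax') (hA n y' Ay') (hA n x Ax) (hA n y Ay).
  have k4 : abs (h n x' - h n x) + abs (h n y' - h n y) <= C1 * (abs (x - x') + abs (y - y')).
    rewrite mulrDr [abs (x - x')]absC [abs (y - y')]absC.
    by apply: lerD; exact: hlip.
  rewrite absM /C2 -mulrA; apply: ler_pM; rewrite ?abs_ge0 //; first exact: QC.
  apply: (le_trans (abs_addle _ _)); rewrite absM mulrDl; apply: lerD; last exact: k2.
  rewrite -!mulrA; apply: ler_pM; rewrite ?abs_ge0 //.
  by apply: (le_trans k3); apply: ler_wpM2l; [exact: ltW|exact: k4].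
clearbody Q.
have [c3 c30 Hc3] := cylinder_gap tameG Ac AG gA gcov gssc Ab1.
pose c' := c3 * t0 / DF; have c'0 : 0 < c' by rewrite divr_gt0 // mulr_gt0.
(* The image of [h n] is relatively open, uniformly in [n]: a point of [A] outside it is sent by
   [W (v n)] outside the cylinder of [V i n], and [cylinder_gap] for the second system, rescaled,
   keeps it away. *)
have hgap : forall n x y, A x -> A y -> ~ (exists2 z, A z & y = h n z) -> c' <= abs (y - h n x).
  move=> n x y Ax Ay ny.
  have nWy : ~ exists2 z, A z & W (v n) y = V i n z.
    move=> [z Az e]; apply: ny; exists z => //.
    by apply: (word_inj tameF (AF Ay) (AF (hA n z Az)) (v := v n)); rewrite e hE.
  have := Hc3 _ x _ Ax (FA (v n) Ay) nWy; rewrite hE // dqE absM -/(sig n) => k.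
  have k1 := HDF (v n) _ _ b1 b1 Ay (hA n x Ax) Ab1 Ab1.
  have k2 : c3 * sig n <= DF * sc n * abs (y - h n x).
    by apply: (le_trans k); apply: ler_wpM2r => //; exact: abs_ge0.
  rewrite /c' ler_pdivrMr //.
  apply: (@le_trans _ _ (c3 * tau n)); first by apply: ler_wpM2l; [exact: ltW|].
  by rewrite /tau mulrA ler_pdivrMr //; lra.
have [eta eta0 Heta] := rigidity tameF Ac AF fA fcov fssc.
pose kk := 1 + 2 * C2 / c1.
have kk0 : 0 < kk.
  have : 0 < 2 * C2 / c1 by apply: divr_gt0 => //; apply: mulr_gt0.
  by rewrite /kk; lra.
clearbody C2.
(* [e < c'] puts [h m x] into the image of [h n], so that [u] exists. [e * kk <= eta * c1] gives the
   hypothesis of [rigidity]: [kk] collects the error of [Q] and the effect of moving both arguments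
   by at most [e / c1]. *)
pose e := Num.min (c' / 2) (eta * c1 / kk).
have e0 : 0 < e by rewrite lt_min !divr_gt0 // mulr_gt0.
have ec : e < c' by apply: (@le_lt_trans _ _ (c' / 2)); [rewrite ge_min lexx|lra].
have ek : e * kk <= eta * c1 by rewrite -ler_pdivlMr // ge_min lexx orbT.
pose Phi n (b : bool) x y := if b then Q n x y else h n x.
have [|n b x y Ax Ay|n b x y x' y' Ax Ay Ax' Ay'|m [n [mn close]]] :=
  @equicontinuous_close bool A Phi (C1 + MF) (C1 + C2) e (attractor_bounded tameF AF) _ e0.
- exact: addr_gt0.
- rewrite /Phi; case: b; first by apply: (le_trans (QC n x y Ax Ay)); lra.
  case: (tameF) => [[_ OM] _ _ _ _]; apply: (le_trans (OM _ (AF (hA n x Ax)))); lra.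
- have D0 := abs_ge0 (x - x'); have D1 := abs_ge0 (y - y').
  have m1 : 0 <= C1 * abs (x - x') by rewrite mulr_ge0 // ltW.
  have m2 : 0 <= C1 * abs (y - y') by rewrite mulr_ge0 // ltW.
  have m3 : 0 <= C2 * abs (x - x') by rewrite mulr_ge0 // ltW.
  have m4 : 0 <= C2 * abs (y - y') by rewrite mulr_ge0 // ltW.
  rewrite /Phi; case: b.
    by apply: (le_trans (Qlip n x y x' y' Ax Ay Ax' Ay')); lra.
  by apply: (le_trans (hlip n x x' Ax Ax')); lra.
have hclose x : A x -> abs (h n x - h m x) <= e by move=> Ax; exact: (close false x x Ax Ax).
have Qclose x y : A x -> A y -> abs (Q n x y - Q m x y) <= e by exact: (close true).
have uex x : exists u, A x -> A u /\ h n u = h m x.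
  have [Ax|nAx] := pselect (A x); last by exists 0.
  have [[u Au e1]|no] := pselect (exists2 u, A u & h m x = h n u); first by exists u.
  have := hgap n x (h m x) Ax (hA m x Ax) no; have := hclose x Ax.
  by rewrite absC => k1 k2; exfalso; lra.
have [u Hu] := choice uex.
have uA x : A x -> A (u x) by move=> /Hu[].
have uE x : A x -> h n (u x) = h m x by move=> /Hu[].
have udist x : A x -> abs (u x - x) <= e / c1.
  move=> Ax; rewrite ler_pdivlMr //; apply: le_trans (hclose x Ax).
  rewrite absC -(uE x Ax) hQ ?absM; [|by []|exact: uA].
  by rewrite mulrC; apply: ler_wpM2r; [exact: abs_ge0|apply: Qc => //; exact: uA].
have uid : forall x, A x -> u x = x.
  apply: Heta => // x y Ax Ay; have Aux := uA x Ax; have Auy := uA y Ay.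
  have q0 : Q n (u x) (u y) != 0.
    by rewrite -abs_gt0; apply: (lt_le_trans c10); exact: Qc.
  have e1 : Q n (u x) (u y) * (u x - u y) = Q m x y * (x - y).
    by rewrite -!hQ // !uE.
  (* The deviation of [u] from the identity becomes a relative error between quotients, uniform over
     all scales of [A]. *)
  have -> : u x - u y - (x - y) = (Q m x y - Q n (u x) (u y)) / Q n (u x) (u y) * (x - y).
    have -> : u x - u y = Q m x y * (x - y) / Q n (u x) (u y) by rewrite -e1 mulrC mulKf.
    by field.
  rewrite absM; apply: ler_wpM2r; first exact: abs_ge0.
  rewrite abs_div ler_pdivrMr ?abs_gt0 //.
  have k1 := Qclose x y Ax Ay; have k2 := Qlip n x y _ _ Ax Ay Aux Auy.
  have k3 := udist x Ax; have k4 := udist y Ay.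
  rewrite [abs (x - _)]absC [abs (y - _)]absC in k2.
  have k5 : abs (Q m x y - Q n (u x) (u y)) <= e * kk.
    apply: (le_trans (abs_dist (Q n x y) _ _)); rewrite [abs (Q m x y - _)]absC.
    have k6 : C2 * (abs (u x - x) + abs (u y - y)) <= C2 * (e / c1 + e / c1).
      by apply: ler_wpM2l; [exact: ltW|lra].
    rewrite /kk; lra.
  apply: (le_trans k5); apply: (le_trans ek); apply: ler_wpM2l; first exact: ltW.
  exact: Qc.
exists m, n, (v n), (v m); split => //; first by case: (Hv n).
move=> x Ax; exists (h n x); first exact: hA.
split; first by rewrite -hE.
by rewrite hE // -uE // uid.
Qed.

End TwoIFS.

Section Continuation.
Variable R : realType.
Local Notation C := (R[i]).
Implicit Types (x y z p q : C).
Variables (J : finType) (OmF : set C) (f : J -> C -> C) (MF dF : R).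
Variables (I : finType) (OmG : set C) (g : I -> C -> C) (MG dG : R).
Hypotheses (tameF : tame_ifs OmF f MF dF) (tameG : tame_ifs OmG g MG dG).
Variable A : set C.
Hypotheses (Ac : cclosed A) (AF : A `<=` OmF) (AG : A `<=` OmG)
  (fA : forall j z, A z -> A (f j z)) (gA : forall j z, A z -> A (g j z))
  (fcov : forall z, A z -> exists j, exists2 y, A y & z = f j y)
  (gcov : forall z, A z -> exists j, exists2 y, A y & z = g j y)
  (fssc : forall i j x y, i != j -> A x -> A y -> f i x != f j y)
  (gssc : forall i j x y, i != j -> A x -> A y -> g i x != g j y).
Variables (b1 b2 : C).
Hypotheses (Ab1 : A b1) (Ab2 : A b2) (b12 : b1 != b2).

Local Notation W := (@word_map R J f).
Local Notation V i n := (@word_map R I g (nseq n i)).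
Local Notation S v w := (@conj_map R J OmF f v w).

(** On [A] the maps [V i n] and [V i m] are [W v] and [W v'] after one common map. As [v = v' ++ w],
    passing from level [m] to level [n] is both an application of [V i (n - m)] and an insertion of
    [w]. The conjugation is by [v], since the shorter [v'] could be empty. *)
Lemma commuting_words i : exists v w l n, [/\ v != [::], w != [::], (0 < l)%N &
  forall x, A x -> exists2 y, A y & V i n x = W v y /\ V i l (V i n x) = W v (W w y)].
Proof.
have [m [n [v [v' [mn vmax agree]]]]] :=
  two_iterates_agree tameF tameG Ac AF AG fA gA fcov gcov fssc gssc Ab1 Ab2 b12 i.
have GA k x : A x -> A (V i k x) by exact: word_attractor.
have nE : n = (m + (n - m))%N by rewrite subnKC // ltnW.
have l0 : (0 < n - m)%N by rewrite subn_gt0.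
have Vn x : V i n x = V i m (V i (n - m) x) by rewrite {1}nE word_nseqD.
(* [V i n] factors through [V i m], so [v'] is admissible at level [n] and the maximality of [v]
   applies. *)
have sz : (size v' <= size v)%N.
  apply: vmax => x Ax; rewrite Vn; have [y Ay [_ e]] := agree _ (GA (n - m)%N x Ax).
  by exists y.
have [w vE] : exists w, v = v' ++ w.
  have [y Ay [e1 _]] := agree _ Ab1; have [y' Ay' [_ e2]] := agree _ (GA (n - m)%N _ Ab1).
  by apply: (word_prefix tameF AF fA fssc Ay' Ay) => //; rewrite -e1 -e2 -Vn.
(* Otherwise [V i (n - m)] would fix the distinct points [V i m b1] and [V i m b2], while a
   non-empty word has only one fixed point. *)
have w0 : w != [::].
  apply/eqP => w0; rewrite w0 cats0 in vE.
  have fx x : A x -> V i (n - m) (V i m x) = V i m x.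
    move=> Ax; rewrite -word_nseqD subnK ?(ltnW mn) //.
    by have [y Ay [-> ->]] := agree _ Ax; rewrite vE.
  have nn : nseq (n - m) i != [::] by case: (n - m)%N l0.
  have := word_fixed_uniq tameG nn (AG (GA m _ Ab1)) (AG (GA m _ Ab2)) (fx _ Ab1) (fx _ Ab2).
  by move=> /(word_inj tameG (AG Ab1) (AG Ab2))/eqP; rewrite (negPf b12).
exists v, w, (n - m)%N, n; split => //; first by rewrite vE; case: (v').
move=> x Ax; have [y Ay [e1 e2]] := agree _ Ax; exists y => //; split => //.
have [y1 Ay1 [e3 e4]] := agree _ (GA (n - m)%N _ Ax).
have y1E : y1 = W w y.
  apply: (word_inj tameF (AF Ay1) (AF (word_attractor fA w Ay)) (v := v')).
  by rewrite -e4 -Vn e1 vE word_cat.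
by rewrite -word_nseqD addnC word_nseqD e3 y1E.
Qed.

(** [p] is the fixed point of [g i]. The map [V i l] agrees with the conjugate on the image of [A]
    under [V i n]; the points [V i (n + N) b] lie in it, differ from [p] by injectivity and tend to
    [p], so the agreement extends to a disc around [p]. *)
Lemma local_root_ifs i : exists v w l p, [/\ v != [::] /\ w != [::], (0 < l)%N, A p,
  (W v @` OmF) p /\ S v w p = p & local_root (W v @` OmF : set (Cx R)) (S v w) p l (g i)].
Proof.
have A0 : A !=set0 by exists b1.
have [v [w [l [n [v0 w0 l0 comm]]]]] := commuting_words i.
have [p Ap gp] := word_fixed tameG A0 Ac AG gA (isT : [:: i] != [::]).
have Vp k : V i k p = p by rewrite word_nseq; elim: k => //= k ->.
have SV z : (exists2 x, A x & z = V i n x) -> (W v @` OmF) z /\ S v w z = V i l z.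
  move=> [x Ax ->]; have [y Ay [e1 e2]] := comm x Ax; split.
    by exists y => //; exact: AF.
  by rewrite e2 e1 (conj_map_word tameF) //; exact: AF.
have [Dp Sp] : (W v @` OmF) p /\ S v w p = V i l p by apply: SV; exists p.
rewrite Vp in Sp.
have [p' [gs [_ fixE [r r0 [rD Sh]] _]]] := conj_map_roots tameF A0 Ac AF fA v0 w0.
have pE : p' = p.
  by have : [set z | (W v @` OmF) z /\ S v w z = z] p by []; rewrite fixE.
rewrite pE in rD Sh.
case: (tameG) => [[Go _] _ _ fhi _]; have [gh _] := fhi i.
have [s s0 sG] := Go p (AG Ap).
pose R0 := Num.min r s; have R00 : 0 < R0 by rewrite lt_min r0.
have R0r : R0 <= r by rewrite ge_min lexx.
have R0s : R0 <= s by rewrite ge_min lexx orbT.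
have Fh : holo (disc p R0) (fun z => V i l z - S v w z).
  move=> z zR; apply: cdiffB; last exact/Sh/(disc_sub R0r).
  by apply: (word_holo tameG); apply: sG; exact: disc_sub zR.
have [b Ab bp] : exists2 b, A b & b != p.
  have [b1p|b1p] := eqVneq b1 p; last by exists b1.
  by exists b2 => //; rewrite -b1p eq_sym.
have [|t t0 Ht] := identity_theorem R00 Fh.
  move=> e e0; have [K K0 HK] := word_contract tameG Ac AG.
  have [N HN] := rate_small tameG (K * abs (b - p)) e0.
  exists (V i (n + N) b); split; last first.
    have [|_ ->] := SV (V i (n + N) b); last by rewrite subrr.
    by exists (V i N b); [exact: word_attractor|rewrite word_nseqD].
  rewrite -{1 2}(Vp (n + N)%N); apply/andP; split.
    rewrite abs_gt0 subr_eq0; apply: contra_neq bp.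
    exact: (word_inj tameG (AG Ab) (AG Ap)).
  apply: (le_lt_trans (HK _ _ _ Ab Ap)); rewrite mulrAC; apply: HN.
  by rewrite size_nseq leq_addl.
pose t' := Num.min t R0; have t'0 : 0 < t' by rewrite lt_min t0.
have t'R : t' <= R0 by rewrite ge_min lexx orbT.
have t't : t' <= t by rewrite ge_min lexx.
exists v, w, l, p; split => //.
exists (disc p t'); split.
- by apply/Cx_openP => z /disc_open[e e0 He]; exists e.
- exact: disc_center.
- apply/holomorphic_holo => z zt; apply: gh; apply: sG.
  by apply: disc_sub zt; exact: le_trans t'R R0s.
- by move=> k _ /=; rewrite -word_nseq Vp; exact: disc_center.
- move=> z /(_ 0%N l0) /= zt; split.
    by apply: rD; apply: disc_sub zt; exact: le_trans t'R R0r.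
  have := Ht z (disc_sub t't zt); rewrite word_nseq => /eqP.
  by rewrite subr_eq0 => /eqP.
Qed.

End Continuation.

Section AttractorFacts.
Variable R : realType.
Variables (J : finType) (Om : set (Cx R)) (f : J -> Cx R -> Cx R) (A : set (Cx R)).
Hypothesis hA : is_attractor Om f A.

Lemma attractor_closed : cclosed A.
Proof.
case: hA => _ Ac _ _; apply: Cx_closed; apply: compact_closed Ac.
exact: norm_hausdorff.
Qed.

Lemma attractor_invariant j z : A z -> A (f j z).
Proof. by case: hA => _ _ _ AE Az; rewrite AE; exists j => //; exists z. Qed.

Lemma attractor_cover z : A z -> exists j, exists2 y, A y & z = f j y.
Proof.
case: hA => _ _ _ AE; rewrite {1}AE => -[j _ [y Ay <-]].
by exists j, y.
Qed.

Lemma separation_neq : strong_separation f A ->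
  forall i j x y, i != j -> A x -> A y -> f i x != f j y.
Proof.
move=> ssc i j x y ij Ax Ay; apply/eqP => e.
have : (f i @` A `&` f j @` A) (f i x) by split; [exists x|rewrite e; exists y].
by rewrite ssc.
Qed.
End AttractorFacts.

Theorem theorem3p12 (R : realType) (J : finType) (OmF : set (Cx R))
    (f : J -> Cx R -> Cx R) (A : set (Cx R))
    (hF : holomorphic_IFS OmF f) (hA : is_attractor OmF f A)
    (hA2 : exists x y, [/\ A x, A y & x <> y])
    (hSSC : strong_separation f A) :
  exists (p : seq J -> seq J -> Cx R)
         (gsol : seq J -> seq J -> forall l : nat, 'I_l -> Cx R -> Cx R),
    (forall v w : seq J, v != [::] -> w != [::] ->
       let D := word_map f v @` OmF in
       let S := conj_map OmF f v w in
       [/\ S @` D `<=` D,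
           [set z | D z /\ S z = z] = [set p v w] &
           forall l : nat, (0 < l)%N ->
             [/\ forall r : 'I_l, local_root D S (p v w) l (gsol v w l r),
                 forall r s : 'I_l, r != s ->
                   ~ same_germ (p v w) (gsol v w l r) (gsol v w l s) &
                 forall h : Cx R -> Cx R, local_root D S (p v w) l h ->
                   exists r : 'I_l, same_germ (p v w) h (gsol v w l r)]])
    /\
    (forall (I : finType) (OmG : set (Cx R)) (g : I -> Cx R -> Cx R),
       holomorphic_IFS OmG g -> is_attractor OmG g A ->
       strong_separation g A ->
       exists K : nat, forall i : I,
         exists (v w : seq J) (l : nat) (r : 'I_l),
           [/\ v != [::], w != [::], (0 < l <= K)%N, OmG (p v w) &
               same_germ (p v w) (g i) (gsol v w l r)]).
Proof.
have [MF [dF tameF]] := holomorphic_tame hF.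
have [A0 _ AF _] := hA.
have Ac := attractor_closed hA.
have fA := attractor_invariant hA.
(* Fixed point and solutions are fixed before the second system appears; in (ii) the root [g i] is
   matched with them through the completeness clause of (i). For an empty word the claim is void and
   arbitrary values are returned. *)
have ex (vw : seq J * seq J) : exists pg : Cx R * (forall l : nat, 'I_l -> Cx R -> Cx R),
    vw.1 != [::] -> vw.2 != [::] ->
    let D := word_map f vw.1 @` OmF in
    let S := conj_map OmF f vw.1 vw.2 in
    [/\ S @` D `<=` D, [set z | D z /\ S z = z] = [set pg.1] &
        forall l : nat, (0 < l)%N ->
          [/\ forall r : 'I_l, local_root D S pg.1 l (pg.2 l r),
              forall r s : 'I_l, r != s -> ~ same_germ pg.1 (pg.2 l r) (pg.2 l s) &
              forall h : Cx R -> Cx R, local_root D S pg.1 l h ->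
                exists r : 'I_l, same_germ pg.1 h (pg.2 l r)]].
  have [v0|v0] := eqVneq vw.1 [::]; first by exists (0, fun _ _ => id).
  have [w0|w0] := eqVneq vw.2 [::]; first by exists (0, fun _ _ => id).
  have [p [gs [h1 h2 _ h3]]] := conj_map_roots tameF A0 Ac AF fA v0 w0.
  by exists (p, gs) => _ _; split.
have [pg Hpg] := choice ex.
exists (fun v w => (pg (v, w)).1), (fun v w => (pg (v, w)).2); split.
  by move=> v w v0 w0; exact: (Hpg (v, w)).
move=> I OmG g hG hAG gSSC.
have [MG [dG tameG]] := holomorphic_tame hG.
have [_ _ AG _] := hAG.
have [b1 [b2 [Ab1 Ab2 /eqP b12]]] := hA2.
have H i : exists l, (0 < l)%N /\ exists (v w : seq J) (r : 'I_l),
    [/\ v != [::], w != [::], OmG (pg (v, w)).1 & same_germ (pg (v, w)).1 (g i) ((pg (v, w)).2 l r)].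
  have [v [w [l [p [[v0 w0] l0 Ap [Dp Sp] lr]]]]] :=
    local_root_ifs tameF tameG Ac AF AG fA (attractor_invariant hAG) (attractor_cover hA)
      (attractor_cover hAG) (separation_neq hSSC) (separation_neq gSSC) Ab1 Ab2 b12 i.
  have [_ fixE roots] := Hpg (v, w) v0 w0.
  have pE : p = (pg (v, w)).1.
    have : [set z | (word_map f v @` OmF) z /\ conj_map OmF f v w z = z] p by [].
    by rewrite fixE.
  have [_ _ complete] := roots l l0.
  rewrite pE in lr Ap; have [r Hr] := complete _ lr.
  by exists l; split => //; exists v, w, r; split => //; exact: AG.
have [l Hl] := choice H.
exists (\max_i l i)%N => i; have [l0 [v [w [r [v0 w0 pO sg]]]]] := Hl i.
exists v, w, (l i), r; split => //.
by rewrite l0 (leq_bigmax i).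
Qed.
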